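(* Let $n\ge2$, $1\le k\le n$, and let $\Omega\subseteq\mathbb{R}^n$ be a bounded, strictly $(k-1)$-convex domain with $\partial\Omega\in C^{3,1}$. Let $f:(0,\infty)\to\mathbb{R}$ satisfy: $(\mathbf{f_1})$ $f\in C^1(0,\infty)$, $f>0$ and $f$ is nondecreasing on $(0,\infty)$; $(\mathbf{f_2})$ with $F(\tau)=\int_0^\tau f(s)\,ds$ and $H(\tau)=((k+1)F(\tau))^{1/(k+1)}$, the integral $\Phi(s)=\int_s^\infty\frac{d\tau}{H(\tau)}$ is finite for every $s>0$; $(\mathbf{f_3})$ there is $C_f>0$ with $\lim_{s\to\infty}H'(s)\int_s^\infty\frac{d\tau}{H(\tau)}=C_f$. Let $b$ satisfy: $(\mathbf{b_1})$ $b\in C^{1,1}(\overline\Omega)$ is positive in $\Omega$; $(\mathbf{b_2})$ there exist $\delta_0>0$, a positive nondecreasing function $m\in C^1(0,\delta_0)$ and positive constants $\underline b,\overline b$ with $$\underline b=\liminf_{x\in\Omega,\ d(x)\to0}\frac{b(x)}{m^{k+1}(d(x))}\le\limsup_{x\in\Omega,\ d(x)\to0}\frac{b(x)}{m^{k+1}(d(x))}=\overline b,$$ where $M(t)=\int_0^t m(s)\,ds<\infty$ for $0<t<\delta_0$, and there is $C_m\in[0,\infty)$ with $\lim_{t\to0^+}\big(M(t)/m(t)\big)'=C_m$. Assume $C_f>1-C_m$. Then every viscosity solution $u$ of $S_k(D^2u)=b(x)f(u)$ in $\Omega$, $u=\infty$ on $\partial\Omega$, satisfies $$1\le\liminf_{x\in\Omega,\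 d(x)\to0}\frac{u(x)}{\varphi(\overline\xi M(d(x)))}\quad\text{and}\quad\limsup_{x\in\Omega,\ d(x)\to0}\frac{u(x)}{\varphi(\underline\xi M(d(x)))}\le1,$$ where $$\underline\xi=\left(\frac{\underline b}{L_0(1-C_f^{-1}(1-C_m))}\right)^{1/(k+1)},\qquad \overline\xi=\left(\frac{\overline b}{l_0(1-C_f^{-1}(1-C_m))}\right)^{1/(k+1)}.$$
   Context: $d(x)=\operatorname{dist}(x,\partial\Omega)$. For a symmetric matrix $A$ with eigenvalues $\lambda$, $S_k(A)=\sigma_k(\lambda)$, the $k$-th elementary symmetric function ($\sigma_0=1$). $\Gamma_k=\{\lambda\in\mathbb{R}^n:\sigma_j(\lambda)>0,\ j=1,\dots,k\}$; a $C^2$ function is $k$-admissible if the eigenvalues of its Hessian lie in $\Gamma_k$ everywhere. For $\bar x\in\partial\Omega$, $\rho(\bar x)=(\rho_1(\bar x),\dots,\rho_{n-1}(\bar x))$ are the principal curvatures of $\partial\Omega$ relative to the interior normal; $\Omega$ is strictly $(k-1)$-convex if $\sigma_j(\rho(\bar x))>0$ for $j=1,\dots,k-1$ and all $\bar x\in\partial\Omega$. $L_0=\max_{\bar x\in\partial\Omega}\sigma_{k-1}(\rho(\bar x))$ and $l_0=\min_{\bar x\in\partial\Omega}\sigma_{k-1}(\rho(\bar x))$. The function $\varphi$ is the inverse of $\Phi$, i.e. $\int_{\varphi(t)}^\infty\frac{d\tau}{H(\tau)}=t$ for all $t>0$. A function $u\in C(\Omega)$ is a viscosity subsolution (resp.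 supersolution) of $S_k(D^2u)=b(x)f(u)$ if whenever $x_0\in\Omega$, $A$ is an open neighborhood of $x_0$, $\psi\in C^2(A)$ is $k$-admissible and $u-\psi$ has a local maximum (resp. minimum) at $x_0$, then $S_k(D^2\psi(x_0))\ge b(x_0)f(\psi(x_0))$ (resp. $\le$); a viscosity solution is both. The condition $u=\infty$ on $\partial\Omega$ means $u(x)\to+\infty$ as $d(x)\to0^+$. *)

(* Defs.v *)
From HB Require Import structures.
From mathcomp Require Import all_boot all_order all_algebra.
From mathcomp Require Import all_classical all_reals all_analysis.
Set Implicit Arguments. Unset Strict Implicit. Unset Printing Implicit Defensive.
Import Order.TTheory GRing.Theory Num.Theory.
Import numFieldNormedType.Exports.
Local Open Scope classical_set_scope.
Local Open Scope ring_scope.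

Section Defs.
Variables (R : realType) (n : nat).
Notation V := 'rV[R]_n.

Definition evec (i : 'I_n) : V := delta_mx 0 i.

Definition dotr (x y : V) : R := \sum_(i < n) x ord0 i * y ord0 i.
Definition enorm (x : V) : R := Num.sqrt (dotr x x).

Definition partial (i : 'I_n) (f : V -> R) : V -> R := fun x => 'D_(evec i) f x.
Definition pd (s : seq 'I_n) (f : V -> R) : V -> R := foldr partial f s.

Definition hess (f : V -> R) (x : V) : 'M[R]_n :=
  \matrix_(i, j) partial i (partial j f) x.

Definition Ck_on (m : nat) (A : set V) (f : V -> R) : Prop :=
  (forall s : seq 'I_n, (size s < m)%N ->
      forall i x, A x -> derivable (pd s f) x (evec i)) /\
  (forall s : seq 'I_n, (size s <= m)%N ->
      forall x, A x -> {for x, continuous (pd s f)}).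

Definition top_lipschitz (m : nat) (A : set V) (f : V -> R) : Prop :=
  exists L : R, forall s : seq 'I_n, size s = m ->
    forall x y, A x -> A y -> `|pd s f x - pd s f y| <= L * enorm (x - y).

Definition Ck1_closure (m : nat) (A : set V) (f : V -> R) : Prop :=
  Ck_on m A f /\
  (forall s : seq 'I_n, (size s <= m)%N ->
     exists K : R, forall x, A x -> `|pd s f x| <= K) /\
  top_lipschitz m A f.

Definition sigma (j : nat) (l : V) : R :=
  \sum_(I : {set 'I_n} | #|I| == j) \prod_(i in I) l ord0 i.

Definition Gamma (k : nat) (l : V) : Prop :=
  forall j, (1 <= j <= k)%N -> 0 < sigma j l.

Definition is_spectrum (A : 'M[R]_n) (l : V) : Prop :=
  char_poly A = \prod_(i < n) ('X - (l ord0 i)%:P).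

(** the eigenvalue vector of A (well defined for symmetric real A) *)
Definition eigs (A : 'M[R]_n) : V := xget 0 [set l | is_spectrum A l].

Definition Sk (k : nat) (A : 'M[R]_n) : R := sigma k (eigs A).

Definition k_admissible (k : nat) (A : set V) (psi : V -> R) : Prop :=
  forall x, A x -> Gamma k (eigs (hess psi x)).

Definition bdry (O : set V) : set V := closure O `\` interior O.
Definition dist_bd (O : set V) (x : V) : R :=
  inf [set enorm (x - y) | y in bdry O].

Definition bd_filter (O : set V) : set (set V) :=
  filter_from [set d : R | 0 < d] (fun d => [set x | O x /\ dist_bd O x < d]).

Definition liminf_bd (O : set V) (g : V -> R) : \bar R :=
  limf_einf (fun x => (g x)%:E) (bd_filter O).
Definition limsup_bd (O : set V) (g : V -> R) : \bar R :=
  limf_esup (fun x => (g x)%:E) (bd_filter O).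

(** Local boundary chart at xb in ∂O: a unit vector nu (interior normal)
    and a C^{3,1} function g on the ball B_r(0), invariant in the direction
    nu (so g is a function of the projection onto nu^⊥), with g(0) = 0,
    Dg(0) = 0, and O ∩ B_r(xb) = {x ∈ B_r(xb) : <x - xb, nu> > g(x - xb)}. *)
Definition bdry_chart (O : set V) (xb nu : V) (g : V -> R) (r : R) : Prop :=
  [/\ 0 < r /\ enorm nu = 1,
      (forall y (t : R), g (y + t *: nu) = g y),
      g 0 = 0 /\ (forall i, partial i g 0 = 0),
      Ck1_closure 3 [set y | enorm y < r] g &
      (forall x, enorm (x - xb) < r -> (O x <-> g (x - xb) < dotr (x - xb) nu))].

Definition C31_boundary (O : set V) : Prop :=
  forall xb, bdry O xb -> exists nu g r, bdry_chart O xb nu g r.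

(** sigma_j of the principal curvatures read off a chart g: the Hessian of
    g at 0 has eigenvalues rho_1..rho_{n-1} (principal curvatures w.r.t.
    the interior normal) and 0 (direction nu); the extra 0 does not change
    sigma_j. *)
Definition curv_sigma (j : nat) (g : V -> R) : R := sigma j (eigs (hess g 0)).

Definition strictly_convex_k (k : nat) (O : set V) : Prop :=
  forall xb nu g r, bdry O xb -> bdry_chart O xb nu g r ->
    forall j, (1 <= j <= k)%N -> 0 < curv_sigma j g.

Definition curv_values (j : nat) (O : set V) : set R :=
  [set s | exists xb nu g r, [/\ bdry O xb, bdry_chart O xb nu g r &
                                 s = curv_sigma j g]].
Definition L0 (k : nat) (O : set V) : R := sup (curv_values k.-1 O).
Definition l0 (k : nat) (O : set V) : R := inf (curv_values k.-1 O).

Definition bounded_domain (O : set V) : Prop :=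
  [/\ open O, connected O, O !=set0 &
      exists K : R, forall x, O x -> enorm x <= K].

Definition visc_sub (k : nat) (O : set V) (b : V -> R) (f : R -> R) (u : V -> R) :=
  forall x0, O x0 -> forall (A : set V) (psi : V -> R),
    open A -> A x0 -> Ck_on 2 A psi -> k_admissible k A psi ->
    psi x0 = u x0 ->
    (\forall x \near x0, u x - psi x <= u x0 - psi x0) ->
    b x0 * f (psi x0) <= Sk k (hess psi x0).

Definition visc_super (k : nat) (O : set V) (b : V -> R) (f : R -> R) (u : V -> R) :=
  forall x0, O x0 -> forall (A : set V) (psi : V -> R),
    open A -> A x0 -> Ck_on 2 A psi -> k_admissible k A psi ->
    psi x0 = u x0 ->
    (\forall x \near x0, u x0 - psi x0 <= u x - psi x) ->
    Sk k (hess psi x0) <= b x0 * f (psi x0).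

(** u ∈ C(O), u > 0 in O (f is only defined on (0,oo)), viscosity solution *)
Definition visc_sol (k : nat) (O : set V) (b : V -> R) (f : R -> R) (u : V -> R) :=
  [/\ forall x, O x -> {for x, continuous u},
      forall x, O x -> 0 < u x,
      visc_sub k O b f u & visc_super k O b f u].

Definition blows_up (O : set V) (u : V -> R) : Prop :=
  forall K : R, exists d : R, 0 < d /\
    forall x, O x -> dist_bd O x < d -> K < u x.

End Defs.

Section OneDim.
Variable (R : realType).

Definition Fint (f : R -> R) (t : R) : R :=
  fine (\int[lebesgue_measure]_(s in `]0%R, t]) (f s)%:E)%E.
Definition Hfun (k : nat) (f : R -> R) (t : R) : R :=
  (k.+1%:R * Fint f t) `^ (k.+1%:R)^-1.
Definition Phi_int (k : nat) (f : R -> R) (s : R) : \bar R :=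
  (\int[lebesgue_measure]_(t in `[s, +oo[) ((Hfun k f t)^-1)%:E)%E.
Definition Phi (k : nat) (f : R -> R) (s : R) : R := fine (Phi_int k f s).
Definition varphi (k : nat) (f : R -> R) (t : R) : R :=
  xget 0 [set s | 0 < s /\ Phi k f s = t].
Definition Mint (m : R -> R) (t : R) : R :=
  fine (\int[lebesgue_measure]_(s in `]0%R, t[) (m s)%:E)%E.
End OneDim.

(* Main.v *)
Require Import Defs.
From HB Require Import structures.
From mathcomp Require Import all_boot all_order all_algebra.
From mathcomp Require Import all_classical all_reals all_analysis.
From mathcomp Require Import ring lra zify.
From mathcomp Require Import complex.
Import Order.TTheory GRing.Theory Num.Theory.
Import numFieldNormedType.Exports.
Local Open Scope classical_set_scope.
Local Open Scope ring_scope.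
Set Implicit Arguments. Unset Strict Implicit. Unset Printing Implicit Defensive.

(** Near a boundary point with inner normal nu and curvature matrix A the
    functions h(q), with h(t) = phi(xi M(t)) and q a quadratic polynomial of
    gradient nu and Hessian close to -A, satisfy
    S_k(D^2 h(q)) = |h'|^(k-1) h'' (sigma_(k-1)(rho) + o(1))
                  = xi^(k+1) (1 - (1 - C_m) / C_f + o(1)) m^(k+1) f(h) (sigma_(k-1)(rho) + o(1)),
    since h'' / |h'| tends to infinity and S_k(A + s p^T p) is affine in s.
    For xi slightly below (above) the critical value they are strict
    supersolutions (subsolutions).  Perturbing q by small tangential quadratic
    terms makes it smaller (larger) than the distance to the boundary with
    equality along the normal, so that no regularity of the distance function
    is needed: comparison in a ball of uniform radius gives
    u <= phi(xi M(d)) + C, respectively u >= phi(xi M(d)) - C.  The constant is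
    absorbed because phi(xi M(d)) blows up, and xi is moved to its critical
    value by phi(c t) <= c^(-P) phi(t) for 0 < c < 1 and small t. *)

(** * Elementary symmetric functions as characteristic polynomial coefficients *)

Section ElementarySymmetric.

(** [L0] and [l0] range over every chart at every boundary point, so each estimate must hold for all
    of them with the same constants. Compactness of the boundary gives this once the normal and the
    Hessian of a chart are known to depend on the point only and the Hessian is known to vary
    continuously; second-order contact ([osculating]) is the notion that makes charts with different
    centres comparable. The critical value of xi comes from two limits. With h = phi(xi M), the
    identity H^k H' = f gives h''/|h'| = (m/M)(q - p), where q = xi M H'(h) tends to C_f and p = M
    m'/m^2 tends to 1 - C_m. Hence |h'|^k (h''/|h'|) = xi^(k+1) (1 - p/q) m^(k+1) f(h), and C_f > 1
    - C_m makes h convex near 0. On the sphere that cuts out the ball only a bound by a constant C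
    is needed: adding a constant to a barrier does not change its Hessian, and at a touching point
    the sign of u - h(q) together with the monotonicity of f contradicts the strict inequality. Thus
    the additive error C is the only price for working locally. *)

Lemma coef_prod_XsubC (R : comNzRingType) n (l : 'I_n -> R) j : (j <= n)%N ->
  (\prod_(i < n) ('X - (l i)%:P))`_(n - j) =
  (-1) ^+ j * \sum_(I : {set 'I_n} | #|I| == j) \prod_(i in I) l i.
Proof.
move=> jn.
under eq_bigr do rewrite addrC -polyCN.
(* Each factor contributes its constant term or X; J collects the former, and the power of X is n -
   j exactly when |J| = j. *)
rewrite (bigA_distr _ _ (fun i => (- l i)%:P) (fun=> 'X)).
rewrite coef_sum mulr_sumr [RHS]big_mkcond /=; apply: eq_bigr => J _.
have -> : \prod_i (if i \in J then (- l i)%:P else 'X) =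
   (\prod_(i in J) (- l i))%:P * 'X^(#|~: J|).
  rewrite (bigID (mem J)) /=; congr (_ * _).
    rewrite rmorph_prod /=; apply: eq_bigr => i iJ.
    by rewrite iJ.
  rewrite (eq_bigr (fun=> 'X)); last by move=> i /negbTE ->.
  by rewrite (eq_bigl (fun i => i \in ~: J)) ?prodr_const// => i; rewrite inE.
rewrite coefCM coefXn cardsCs finset.setCK card_ord.
have Jn : (#|J| <= n)%N by rewrite -[X in (_ <= X)%N]card_ord max_card.
have -> : (n - j == n - #|J|)%N = (#|J| == j) by lia.
case: eqP => [<-|_]; last by rewrite mulr0.
by rewrite mulr1 prodrN.
Qed.

(* Unlike [Sk], which goes through eigenvalues, this is polynomial in the
   entries of A, hence locally Lipschitz and defined for every matrix. *)
Definition esym_mx (R : comNzRingType) n (j : nat) (A : 'M[R]_n) : R :=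
  (-1) ^+ j * (char_poly A)`_(n - j).

Lemma char_poly_similar (F : fieldType) n (P A B : 'M[F]_n) : P \in unitmx ->
  P *m A = B *m P -> char_poly A = char_poly B.
Proof.
move=> Pu PA.
have P0 : \det (map_mx polyC P) != 0.
  by rewrite det_map_mx polyC_eq0 -unitfE -unitmxE.
apply: (mulfI P0); rewrite /char_poly -det_mulmx mulrC -det_mulmx; congr (\det _).
by rewrite /char_poly_mx mulmxBr mulmxBl -!map_mxM PA scalar_mxC.
Qed.

Variable R : realType.

(** Complexification: a real symmetric matrix is Hermitian over [R[i]], where the spectral theorem
    gives a real diagonal form. The factorisation of the characteristic polynomial descends because
    the embedding is injective on polynomials. *)
Lemma sym_has_spectrum n (A : 'M[R]_n) : A^T = A -> exists l, is_spectrum A l.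
Proof.
move=> AT; pose toC := real_complex R.
pose Ac : 'M[R[i]]_n := map_mx toC A.
have Asym : Ac \is symmetricmx.
  apply/is_hermitianmxP; rewrite expr0 scale1r map_mx_id; last by [].
  by rewrite /Ac map_trmx AT.
have Areal : Ac \is a mxOver Num.real.
  apply/mxOverP => i j; rewrite mxE /toC.
  by apply/Creal_ImP; rewrite -complexIm.
have Aherm := realsym_hermsym Asym Areal.
have /orthomx_spectralP Aeq := hermitian_normalmx Aherm.
have dreal := hermitian_spectral_diag_real Aherm.
pose d := spectral_diag Ac.
exists (\row_i complex.Re (d 0 i)).
have cpA : char_poly Ac = char_poly (diag_mx d).
  apply: (@char_poly_similar _ _ (spectralmx Ac)); first exact: spectral_unit.
  by rewrite {2}Aeq !mulmxA mulmxV ?spectral_unit// mul1mx.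
apply: (@map_poly_inj _ _ (real_complex R)).
rewrite map_char_poly -/toC -/Ac cpA char_poly_trig; last exact: diag_mx_is_trig.
rewrite rmorph_prod /=; apply: eq_bigr => i _.
rewrite !mxE eqxx mulr1n rmorphB /= map_polyX map_polyC /=; congr (_ - _%:P).
move/mxOverP : dreal => /(_ 0 i); rewrite -/d => /Creal_ImP /=.
by rewrite -complexIm; case: (d 0 i) => a b /= -[->].
Qed.

(** The choice hidden in [eigs] is harmless: by Vieta's formula any spectrum yields the same
    coefficient of the characteristic polynomial. *)
Lemma Sk_esym n j (A : 'M[R]_n) : A^T = A -> (j <= n)%N -> Sk j A = esym_mx j A.
Proof.
move=> /sym_has_spectrum[l Al] jn.
have : is_spectrum A (eigs A) by exact: (@xgetPex _ 0 [set l | is_spectrum A l] (ex_intro _ l Al)).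
rewrite /is_spectrum /esym_mx => ->.
by rewrite coef_prod_XsubC// mulrA -exprMn mulrNN mulr1 expr1n mul1r.
Qed.

Lemma esym_mx0 n (A : 'M[R]_n) : esym_mx 0 A = 1.
Proof.
rewrite /esym_mx expr0 mul1r subn0.
have /monicP := char_poly_monic A.
by rewrite /lead_coef size_char_poly.
Qed.

Lemma esym_mxZ n j (c : R) (A : 'M[R]_n) : c != 0 -> (j <= n)%N ->
  esym_mx j (c *: A) = c ^+ j * esym_mx j A.
Proof.
move=> c0 jn.
(* Substitution of X/c: det(X - cA) = c^n det(X/c - A). *)
have cM : char_poly_mx (c *: A) =
    c%:P *: map_mx (comp_poly (c^-1 *: 'X)) (char_poly_mx A).
  apply/matrixP => a b; rewrite !mxE rmorphB /= rmorphMn /= comp_polyX comp_polyC.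
  rewrite mulrBr mulrnAr -!mul_polyC mulrA -polyCM mulfV// mul1r.
  by rewrite polyCM.
have -> : esym_mx j (c *: A) = (-1) ^+ j *
    (c ^+ n *: ((char_poly A) \Po (c^-1 *: 'X)))`_(n - j).
  rewrite /esym_mx {1}/char_poly cM detZ det_map_mx -rmorphXn /= mul_polyC.
  by [].
rewrite coefZ comp_polyE coef_sum.
rewrite /esym_mx; under eq_bigr do rewrite coefZ exprZn coefZ coefXn.
have nn : (n - j < size (char_poly A))%N by rewrite size_char_poly ltnS leq_subr.
rewrite (bigD1 (Ordinal nn)) //= eqxx mulr1 big1 ?addr0; last first.
  move=> i; rewrite -val_eqE /= eq_sym => /negbTE ->.
  by rewrite !mulr0.
rewrite [RHS]mulrCA; congr (_ * _).
rewrite mulrCA mulrC; congr (_ * _).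
by rewrite -{1}(subnKC jn) exprD exprVn mulfK// expf_neq0.
Qed.

(** The bordered matrix [N 1 t] has M + t u v as Schur complement, while t enters its first row
    only, and affinely. Multilinearity of the determinant in that row does the rest, over any
    commutative ring, hence also for matrices of polynomials. *)
Lemma det_rank_one (K : comNzRingType) n (M : 'M[K]_n) (u : 'cV[K]_n) (v : 'rV[K]_n) (s : K) :
  \det (M + s *: (u *m v)) = \det M + s * (\det (M + u *m v) - \det M).
Proof.
pose N (t t' : K) : 'M[K]_(1 + n) := block_mx t%:M (t' *: (- v)) u M.
have N1 t : \det (N 1 t) = \det (M + t *: (u *m v)).
  have : N 1 t = block_mx 1%:M 0 u 1%:M *m block_mx 1%:M (t *: - v) 0 (M + t *: (u *m v)).
    rewrite mulmx_block !mul1mx !mulmx1 !mul0mx !addr0 ?mulmx0 ?addr0.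
    by rewrite /N scalerN mulmxN -scalemxAr addrCA addNr addr0.
  by move=> ->; rewrite det_mulmx det_lblock det_ublock !det1 !mul1r.
have Nlin t : \det (N 1 t) = (1 - t) * \det (N 1 0) + t * \det (N 1 1).
  have ltv t' : row (@lshift 1 n 0) (N 1 t') = row_mx 1%:M (t' *: - v).
    by rewrite /N /block_mx rowKu; apply/rowP => j; rewrite mxE.
  have lt' t' : row' (@lshift 1 n 0) (N 1 t') = row' (@lshift 1 n 0) (N 1 0).
    apply/matrixP => a c; rewrite !mxE; case: splitP => // x /= xa.
    by move: (ltn_ord x); rewrite -xa.
  apply: (@determinant_multilinear _ _ _ _ _ (@lshift 1 n 0)); rewrite ?lt' //.
  rewrite !ltv !scale_row_mx add_row_mx !scale0r !scaler0 add0r scale1r.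
  by rewrite -scalerDl subrK scale1r.
rewrite -N1 Nlin !N1 scale0r addr0 scale1r; ring.
Qed.


Lemma char_poly_mxDrank1 n (A : 'M[R]_n) (p : 'rV[R]_n) s :
  char_poly_mx (A + s *: (p^T *m p)) = char_poly_mx A +
   (- s)%:P *: (map_mx polyC p^T *m map_mx polyC p).
Proof.
rewrite /char_poly_mx map_mxD /= opprD addrA; congr (_ + _).
by rewrite -map_mxM map_mxZ /= polyCN scaleNr.
Qed.

Lemma esym_mx_rank1 n j (A : 'M[R]_n) (p : 'rV[R]_n) s :
  esym_mx j (A + s *: (p^T *m p)) =
  esym_mx j A + s * (esym_mx j (A + p^T *m p) - esym_mx j A).
Proof.
have cpE s' : char_poly (A + s' *: (p^T *m p)) = char_poly A + (- s')%:P *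
   (\det (char_poly_mx A + map_mx polyC p^T *m map_mx polyC p) - char_poly A).
  by rewrite {1}/char_poly char_poly_mxDrank1 det_rank_one.
have := cpE 1; rewrite scale1r /esym_mx => ->; rewrite cpE.
rewrite !(coefD, coefN, coefCM); ring.
Qed.

(** Adding the projection onto a unit kernel vector moves one eigenvalue from 0 to 1. With N = p^T p
    one has A N = 0, so (X - A)(X - N) = X (X - A - N); taking determinants and cancelling X^n
    leaves (X - 1) chi_A = X chi_(A+N). *)
Lemma esym_mx_rank1_ker n j (A : 'M[R]_n) (p : 'rV[R]_n) : (j < n)%N ->
  A *m p^T = 0 -> p *m p^T = 1%:M ->
  esym_mx j.+1 (A + p^T *m p) = esym_mx j.+1 A + esym_mx j A.
Proof.
move=> jn Ap pp.
set N := p^T *m p.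
have eN : char_poly_mx A *m char_poly_mx N = 'X *: char_poly_mx (A + N).
  rewrite /char_poly_mx mulmxBl !mulmxBr -map_mxM /N mulmxA Ap mul0mx map_mx0 subr0.
  rewrite -scalar_mxM mul_scalar_mx map_mxD scalerBr scalerDr.
  by rewrite scale_scalar_mx mul_mx_scalar opprD [RHS]addrA addrAC.
have cN : 'X * char_poly N = ('X - 1) * 'X^n.
  pose v := map_mx polyC p; pose u : 'cV_n := map_mx polyC p^T.
  have vu : v *m u = 1%:M by rewrite -map_mxM pp map_mx1.
  have d1 : \det (block_mx 1%:M v u 'X%:M) = char_poly N.
    have -> : block_mx 1%:M v u 'X%:M =
        block_mx 1%:M 0 u 1%:M *m block_mx 1%:M v 0 (char_poly_mx N).
      rewrite mulmx_block !mul1mx !mulmx1 !mul0mx !addr0.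
      by rewrite /char_poly_mx map_mxM addrC subrK.
    by rewrite det_mulmx det_lblock det_ublock !det1 !mul1r.
  have : block_mx 1%:M v u 'X%:M *m block_mx 'X%:M 0 (- u) 1%:M =
     block_mx ('X - 1)%:M v 0 'X%:M.
    rewrite mulmx_block !mul1mx !mulmx1 !mulmx0 !add0r !mulmxN vu.
    by rewrite mul_mx_scalar mul_scalar_mx subrr rmorphB.
  move/(congr1 determinant); rewrite det_mulmx d1 det_lblock det_ublock det1.
  by rewrite !det_scalar mulr1 mulrC => ->.
have /eqP : 'X^n * (('X - 1) * char_poly A) = 'X^n * ('X * char_poly (A + N)).
  move/(congr1 determinant): eN; rewrite det_mulmx detZ -/(char_poly _).
  rewrite -[\det (char_poly_mx N)]/(char_poly N) -[\det (char_poly_mx (A + N))]/(char_poly _).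
  move=> eN; rewrite [RHS]mulrCA -eN [RHS]mulrCA cN; ring.
rewrite (inj_eq (mulfI _)) ?monic_neq0 ?monicXn// => /eqP /(congr1 (coefp (n - j))).
rewrite /= mulrBl mul1r coefB !coefXM subn_eq0 leqNgt jn /=.
have -> : (n - j).-1 = (n - j.+1)%N by rewrite subnS.
rewrite /esym_mx => <-; rewrite exprS; ring.
Qed.

End ElementarySymmetric.

(** * Local Lipschitz bounds and the rank-one asymptotics *)

Lemma affine_slope_arith (R : realFieldType) (K delta eta s a d e : R) : 0 < eta -> 0 <= s ->
  `|a| <= K -> `|d| <= K * delta -> `|e| <= K * (2 * delta) -> 3 * K * delta <= eta / 2 ->
  2 * K / eta + 1 <= s -> `|a + s * (e - d)| <= eta * s.
Proof.
move=> eta0 s0 aK dK eK small large.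
have h1 : `|e - d| <= eta / 2 by apply: le_trans (ler_normB _ _) _; lra.
have h2 : 2 * K <= s * eta by rewrite -ler_pdivrMr//; lra.
have h3 : s * `|e - d| <= s * (eta / 2) by rewrite ler_wpM2l.
by apply: le_trans (ler_normD _ _) _; rewrite normrM (ger0_norm s0); lra.
Qed.

Section LocallyLipschitz.
Variable R : realType.

Lemma mx_entry_le m n (A : 'M[R]_(m, n)) i j : `|A i j| <= `|A|.
Proof.
rewrite [leRHS]/Num.Def.normr /= mx_normrE; apply/bigmax_geP; right => /=.
by exists (i, j).
Qed.

Lemma mx_norm_le m n (A : 'M[R]_(m, n)) c : 0 <= c ->
  (forall i j, `|A i j| <= c) -> `|A| <= c.
Proof.
move=> c0 Ac; rewrite [leLHS]/Num.Def.normr /= mx_normrE; apply/bigmax_leP.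
by split=> // -[i j] _; exact: Ac.
Qed.

(** The bound on values is carried along with the Lipschitz bound because stability under products
    needs both. *)
Definition loc_lip n (Q : 'M[R]_n -> R) := forall C : R, exists2 K : R, 0 <= K &
  forall A B : 'M[R]_n, `|A| <= C -> `|B| <= C -> `|Q A| <= K /\ `|Q A - Q B| <= K * `|A - B|.

Lemma loc_lip_cst n c : @loc_lip n (fun=> c).
Proof.
move=> C; exists `|c| => // A B _ _; split=> //.
by rewrite subrr normr0 mulr_ge0.
Qed.

Lemma loc_lip_coord n i j : @loc_lip n (fun A => A i j).
Proof.
move=> C; exists (Num.max C 1); first by rewrite le_max ler01 orbT.
move=> A B AC BC; split; first by rewrite le_max (le_trans (mx_entry_le A i j)).

apply: (@le_trans _ _ `|A - B|); last by rewrite ler_peMl// le_max lexx orbT.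
by apply: le_trans (mx_entry_le (A - B) i j); rewrite !mxE.
Qed.

Lemma loc_lipD n (P Q : 'M[R]_n -> R) : loc_lip P -> loc_lip Q ->
  loc_lip (fun A => P A + Q A).
Proof.
move=> hP hQ C; have [K K0 hK] := hP C; have [L L0 hL] := hQ C.
exists (K + L); first by rewrite addr_ge0.
move=> A B AC BC; have [a b] := hK _ _ AC BC; have [c d] := hL _ _ AC BC.
split; first by apply: le_trans (ler_normD _ _) _; exact: lerD.
rewrite (_ : _ - _ = (P A - P B) + (Q A - Q B)); last by ring.
by apply: le_trans (ler_normD _ _) _; rewrite mulrDl lerD.
Qed.

Lemma loc_lipM n (P Q : 'M[R]_n -> R) : loc_lip P -> loc_lip Q ->
  loc_lip (fun A => P A * Q A).
Proof.
move=> hP hQ C; have [K K0 hK] := hP C; have [L L0 hL] := hQ C.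
exists (K * L + K * L); first by rewrite addr_ge0// mulr_ge0.
move=> A B AC BC; have [a b] := hK _ _ AC BC; have [c d] := hL _ _ AC BC.
have [e _] := hK _ _ BC AC.
split; first by rewrite normrM ler_wpDr ?mulr_ge0// ler_pM.
rewrite (_ : _ - _ = P B * (Q A - Q B) + (P A - P B) * Q A); last by ring.
apply: le_trans (ler_normD _ _) _; rewrite [leRHS]mulrDl !normrM lerD//.
  by rewrite -mulrA ler_pM.
by rewrite mulrAC ler_pM.
Qed.

Lemma loc_lip_sum n (I : Type) (r : seq I) (P : pred I) (Q : I -> 'M[R]_n -> R) :
  (forall i, loc_lip (Q i)) -> loc_lip (fun A => \sum_(i <- r | P i) Q i A).
Proof.
move=> hQ; elim: r => [|i r IH].
  by under eq_fun do rewrite big_nil; exact: loc_lip_cst.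
under eq_fun do rewrite big_cons.
by case: (P i) => //; exact: loc_lipD.
Qed.

Lemma loc_lip_coef_prod n (I : Type) (r : seq I) (Q : I -> 'M[R]_n -> {poly R}) :
  (forall i k, loc_lip (fun A => (Q i A)`_k)) ->
  forall k, loc_lip (fun A => (\prod_(i <- r) Q i A)`_k).
Proof.
move=> hQ; elim: r => [|i r IH] k.
  by under eq_fun do rewrite big_nil; exact: loc_lip_cst.
under eq_fun do rewrite big_cons coefM.
by apply: loc_lip_sum => j; exact: loc_lipM.
Qed.

Lemma loc_lip_esym n j : @loc_lip n (esym_mx j).
Proof.
apply: loc_lipM; first exact: loc_lip_cst.
under eq_fun do rewrite /char_poly /determinant coef_sum.
apply: loc_lip_sum => s.
have sgn (b : bool) (Q : 'M[R]_n -> {poly R}) k : loc_lip (fun A => (Q A)`_k) ->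
    loc_lip (fun A => ((-1) ^+ b * Q A)`_k).
  move=> hQ; case: b; rewrite ?expr1 ?expr0; last first.
    by under eq_fun do rewrite mul1r.
  by under eq_fun do rewrite mulN1r coefN -mulN1r; apply: loc_lipM; first exact: loc_lip_cst.
apply: sgn.
apply: loc_lip_coef_prod => i k.
under eq_fun do rewrite !mxE coefB coefC.
apply: loc_lipD; first exact: loc_lip_cst.
under eq_fun do rewrite -mulN1r; apply: loc_lipM; first exact: loc_lip_cst.
by case: eqP => _; [exact: loc_lip_coord|exact: loc_lip_cst].
Qed.

Lemma loc_lip_esym_unif n C : exists2 K : R, 0 <= K & forall j, (j <= n)%N ->
  forall A B : 'M[R]_n, `|A| <= C -> `|B| <= C ->
  `|esym_mx j A| <= K /\ `|esym_mx j A - esym_mx j B| <= K * `|A - B|.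
Proof.
have : forall j, exists K : R, 0 <= K /\ forall A B : 'M[R]_n, `|A| <= C -> `|B| <= C ->
    `|esym_mx j A| <= K /\ `|esym_mx j A - esym_mx j B| <= K * `|A - B|.
  by move=> j; have [K K0 hK] := @loc_lip_esym n j C; exists K.
move=> /choice[K hK]; exists (\sum_(j < n.+1) K j).
  by apply: sumr_ge0 => j _; case: (hK j).
move=> j jn A B AC BC.
have KS : K j <= \sum_(j < n.+1) K j.
  rewrite (bigD1 (Ordinal (jn : (j < n.+1)%N))) //= lerDl.
  by apply: sumr_ge0 => i _; case: (hK i).
have [_ /(_ _ _ AC BC)[a b]] := hK j; split; first exact: le_trans a KS.
by apply: le_trans b _; rewrite ler_wpM2r.
Qed.

(* In the application s = h'' / |h'| tends to infinity at the boundary: only the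
   coefficient of s in the affine function [esym_mx_rank1] matters. *)
Lemma esym_mx_rank1_asymptotics n (C eta : R) : 0 < eta -> exists2 delta : R, 0 < delta &
  exists2 s0 : R, 0 < s0 & forall (A A' : 'M[R]_n) (nu p : 'rV[R]_n) (s : R) j,
  `|A| <= C -> A *m nu^T = 0 -> nu *m nu^T = 1%:M ->
  `|A' - A| <= delta -> `|p^T *m p - nu^T *m nu| <= delta -> s0 <= s ->
  (j < n)%N ->
  `|esym_mx j.+1 (A' + s *: (p^T *m p)) - s * esym_mx j A| <= eta * s.
Proof.
move=> eta0.
(* Radius |C| + 3 covers A' + p^T p, whose two terms have norm at most |C| + 1 and 2. Below, [delta]
   makes the error 3 K delta of the slope at most eta/2, and s >= 2 K/eta + 1 makes the term without
   s at most eta s/2. *)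
have [K K0 hK] := @loc_lip_esym_unif n (`|C| + 3).
pose delta := Num.min 1 (eta / (6 * (K + 1))).
have d0 : 0 < delta by rewrite lt_min ltr01 divr_gt0// mulr_gt0// ltr_wpDl.
exists delta => //; exists (2 * K / eta + 1).
  by rewrite ltr_wpDl// divr_ge0 ?mulr_ge0// ltW.
move=> A A' nu p s j AC Anu nunu A'A pnu s0s jn.
have nun : `|nu^T *m nu| <= 1.
  have /matrixP/(_ 0 0) := nunu; rewrite !mxE eqxx mulr1n => nn.
  have ni i : `|nu 0 i| <= 1.
    rewrite -(@ler_pXn2r _ 2)// ?nnegrE// expr1n real_normK ?num_real// -nn.
    rewrite (bigD1 i)//= mxE -expr2 lerDl; apply: sumr_ge0 => k _.
    by rewrite mxE -expr2 sqr_ge0.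
  apply: mx_norm_le => // i k; rewrite !mxE big_ord1 !mxE normrM.
  by rewrite -[leRHS]mulr1 ler_pM.
have d1 : delta <= 1 by rewrite ge_min lexx.
have dK : 3 * K * delta <= eta / 2.
  have : delta <= eta / (6 * (K + 1)) by rewrite ge_min lexx orbT.
  rewrite ler_pdivlMr; last by rewrite mulr_gt0// ltr_wpDl.
  move=> h; nra.
have AC' := le_trans AC (ler_norm C).
have A'C : `|A'| <= `|C| + 1.
  rewrite -(subrK A A') addrC; apply: le_trans (ler_normD _ _) _.
  by rewrite lerD// (le_trans A'A).
have pC : `|p^T *m p| <= 2.
  rewrite -(subrK (nu^T *m nu) (p^T *m p)); apply: le_trans (ler_normD _ _) _.
  by rewrite -[2]/(1 + 1) lerD// (le_trans pnu).
have -> : esym_mx j A = esym_mx j.+1 (A + nu^T *m nu) - esym_mx j.+1 A.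
  by rewrite esym_mx_rank1_ker // addrC addKr.
rewrite esym_mx_rank1.
have [] := hK j.+1 jn A' A; [lra|lra|move=> h1 h2].
have [] := hK j.+1 jn (A' + p^T *m p) (A + nu^T *m nu).
- by apply: le_trans (ler_normD _ _) _; lra.
- by apply: le_trans (ler_normD _ _) _; lra.
move=> h3 h4.
have h5 : `|(A' + p^T *m p) - (A + nu^T *m nu)| <= 2 * delta.
  rewrite (_ : _ - _ = (A' - A) + (p^T *m p - nu^T *m nu)); last by rewrite opprD addrACA.
  by apply: le_trans (ler_normD _ _) _; rewrite mulr_natl mulr2n lerD.
move: h1 h2 h4.
set a1 := esym_mx _ A'; set a2 := esym_mx _ A; set a3 := esym_mx _ (A' + _).
set a4 := esym_mx _ (A + _) => h1 h2 h4.
have s0 : 0 <= s by apply: le_trans s0s; rewrite addr_ge0// divr_ge0 ?mulr_ge0// ltW.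
have h6 : `|a1 - a2| <= K * delta by apply: le_trans h2 _; rewrite ler_wpM2l.
have h7 : `|a3 - a4| <= K * (2 * delta) by apply: le_trans h4 _; rewrite ler_wpM2l.
rewrite (_ : _ - _ = a1 + s * ((a3 - a4) - (a1 - a2))); last by ring.
exact: affine_slope_arith eta0 s0 h1 h6 h7 dK s0s.
Qed.

End LocallyLipschitz.

(** * Euclidean calculus *)

Section Euclid.
Variables (R : realType) (n : nat).
Local Notation V := 'rV[R]_n.
Implicit Types (x y z : V) (A : 'M[R]_n).

Lemma dotrC x y : dotr x y = dotr y x.
Proof. by apply: eq_bigr => i _; rewrite mulrC. Qed.

Lemma dotrDl x y z : dotr (x + y) z = dotr x z + dotr y z.
Proof. by rewrite -big_split; apply: eq_bigr => i _; rewrite mxE mulrDl. Qed.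

Lemma dotrZl (c : R) x z : dotr (c *: x) z = c * dotr x z.
Proof. by rewrite mulr_sumr; apply: eq_bigr => i _; rewrite mxE mulrA. Qed.

Lemma dotrNl x z : dotr (- x) z = - dotr x z.
Proof. by rewrite -scaleN1r dotrZl mulN1r. Qed.

Lemma dotrBl x y z : dotr (x - y) z = dotr x z - dotr y z.
Proof. by rewrite dotrDl dotrNl. Qed.

Lemma dotrDr x y z : dotr x (y + z) = dotr x y + dotr x z.
Proof. by rewrite dotrC dotrDl !(dotrC x). Qed.

Lemma dotrZr (c : R) x z : dotr x (c *: z) = c * dotr x z.
Proof. by rewrite dotrC dotrZl (dotrC x). Qed.

Lemma dotrNr x z : dotr x (- z) = - dotr x z.
Proof. by rewrite dotrC dotrNl (dotrC x). Qed.

Lemma dotrBr x y z : dotr x (y - z) = dotr x y - dotr x z.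
Proof. by rewrite dotrDr dotrNr. Qed.

Lemma dotr0l x : dotr 0 x = 0.
Proof. by rewrite -(scale0r 0) dotrZl mul0r. Qed.

Lemma dotr0r x : dotr x 0 = 0.
Proof. by rewrite dotrC dotr0l. Qed.

Lemma dotr_ge0 x : 0 <= dotr x x.
Proof. by apply: sumr_ge0 => i _; rewrite -expr2 sqr_ge0. Qed.

Lemma dotr_sqr x : dotr x x = enorm x ^+ 2.
Proof. by rewrite sqr_sqrtr// dotr_ge0. Qed.

Lemma enorm_ge0 x : 0 <= enorm x.
Proof. exact: sqrtr_ge0. Qed.

Lemma enorm0 : enorm (0 : V) = 0.
Proof. by rewrite /enorm dotr0l sqrtr0. Qed.

Lemma entry_le_enorm x i : `|x ord0 i| <= enorm x.
Proof.
rewrite -(@ler_pXn2r _ 2)// ?nnegrE ?enorm_ge0//.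
rewrite -dotr_sqr real_normK ?num_real// /dotr (bigD1 i)//= -expr2 lerDl.
by apply: sumr_ge0 => k _; rewrite -expr2 sqr_ge0.
Qed.

Lemma enorm_eq0 x : enorm x = 0 -> x = 0.
Proof.
move=> x0; apply/rowP => i; rewrite mxE; apply/eqP; rewrite -normr_le0 -x0.
exact: entry_le_enorm.
Qed.

Lemma enorm_gt0 x : x != 0 -> 0 < enorm x.
Proof.
by move=> x0; rewrite lt_def enorm_ge0 andbT; apply: contra_neq x0; exact: enorm_eq0.
Qed.

Lemma enormZ (c : R) x : enorm (c *: x) = `|c| * enorm x.
Proof.
by rewrite /enorm dotrZl dotrZr mulrA -expr2 sqrtrM ?sqr_ge0// sqrtr_sqr.
Qed.

Lemma enormN x : enorm (- x) = enorm x.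
Proof. by rewrite -scaleN1r enormZ normrN normr1 mul1r. Qed.

Lemma enormC x y : enorm (x - y) = enorm (y - x).
Proof. by rewrite -enormN opprB. Qed.

Lemma cauchy_schwarz x y : `|dotr x y| <= enorm x * enorm y.
Proof.
have [->|y0] := eqVneq y 0; first by rewrite dotr0r normr0 mulr_ge0 ?enorm_ge0.
have yp := enorm_gt0 y0.
have := dotr_ge0 (enorm y ^+ 2 *: x - dotr x y *: y).
rewrite !(dotrDl, dotrDr, dotrNl, dotrNr, dotrZl, dotrZr) (dotrC y x) !dotr_sqr.
set a := dotr x y; set b := enorm y; set c := enorm x => h.
rewrite -(@ler_pXn2r _ 2)// ?nnegrE ?mulr_ge0 ?enorm_ge0//.
rewrite real_normK ?num_real// exprMn.
have b2 : 0 < b ^+ 2 by rewrite exprn_gt0.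
rewrite -(ler_pM2l b2); nra.
Qed.

Lemma dotr_le x y : dotr x y <= enorm x * enorm y.
Proof. exact: le_trans (ler_norm _) (cauchy_schwarz _ _). Qed.

Lemma enormD x y : enorm (x + y) <= enorm x + enorm y.
Proof.
rewrite -(@ler_pXn2r _ 2)// ?nnegrE ?addr_ge0 ?enorm_ge0//.
rewrite -dotr_sqr dotrDl !dotrDr (dotrC y x) sqrrD -!dotr_sqr.
have := dotr_le x y; lra.
Qed.

Lemma enormB_triangle z x y : enorm (x - y) <= enorm (x - z) + enorm (z - y).
Proof. by apply: le_trans (enormD _ _); rewrite addrA subrK. Qed.

Lemma enorm_evec (i : 'I_n) : enorm (evec R i) = 1.
Proof.
rewrite /enorm /dotr (bigD1 i)//= big1 ?addr0; last first.
  by move=> k /negbTE ki; rewrite /evec !mxE ki mul0r.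
by rewrite /evec !mxE !eqxx mulr1 sqrtr1.
Qed.

Lemma dotr_evec x i : dotr x (evec R i) = x ord0 i.
Proof.
rewrite /dotr (bigD1 i)//= big1 ?addr0; last first.
  by move=> k /negbTE ki; rewrite /evec !mxE ki mulr0.
by rewrite /evec !mxE !eqxx mulr1.
Qed.

Lemma rV_evec_sum x : x = \sum_i x ord0 i *: evec R i.
Proof.
apply/rowP => j; rewrite summxE (bigD1 j)//= big1 ?addr0; last first.
  by move=> k kj; rewrite /evec !mxE eq_sym (negbTE kj) mulr0.
by rewrite /evec !mxE !eqxx mulr1.
Qed.

Lemma mx_norm_le_enorm x : `|x| <= enorm x.
Proof.
by apply: mx_norm_le => [|i j]; rewrite ?enorm_ge0// ord1 entry_le_enorm.
Qed.

Lemma enorm_le_mx_norm x : enorm x <= n%:R * `|x|.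
Proof.
rewrite {1}(rV_evec_sum x).
have : forall r : seq 'I_n, enorm (\sum_(i <- r) x ord0 i *: evec R i) <= (size r)%:R * `|x|.
  elim=> [|i r IH]; first by rewrite big_nil enorm0 mul0r.
  rewrite big_cons; apply: le_trans (enormD _ _) _.
  rewrite /= -natr1 mulrDl mul1r addrC lerD//.
  by rewrite enormZ enorm_evec mulr1 mx_entry_le.
by move=> /(_ (index_enum _)); rewrite /index_enum -enumT size_enum_ord.
Qed.

(** The topology on row vectors comes from the sup norm; since the two norms are equivalent with
    constant n, every later epsilon-delta argument can use Euclidean balls. *)
Lemma nbhs_enormP x (P : set V) :
  nbhs x P <-> exists2 r : R, 0 < r & forall y, enorm (y - x) < r -> P y.
Proof.
split.
  move/nbhs_ballP => [r /= r0 xr]; exists r => // y yr; apply: xr.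
  rewrite -ball_normE /= distrC; exact: le_lt_trans (mx_norm_le_enorm _) yr.
move=> [r r0 xr]; apply/nbhs_ballP; exists (r / n.+1%:R) => /=.
  by rewrite divr_gt0// ltr0n.
move=> y; rewrite -ball_normE /= distrC => xy; apply: xr.
apply: le_lt_trans (enorm_le_mx_norm _) _.
have : n.+1%:R * `|y - x| < r by rewrite mulrC -ltr_pdivlMr// ltr0n.
by apply: le_lt_trans; rewrite ler_wpM2r// ler_nat.
Qed.

Lemma open_enormP (O : set V) : open O <->
  forall x, O x -> exists2 r : R, 0 < r & forall y, enorm (y - x) < r -> O y.
Proof.
rewrite openE; split=> [Oo x /Oo|h x /h]; first by move/nbhs_enormP.
by move=> hx; apply/nbhs_enormP.
Qed.

Lemma continuous_enormP (f : V -> R) x : {for x, continuous f} <->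
  forall e : R, 0 < e -> exists2 r : R, 0 < r & forall y, enorm (y - x) < r -> `|f y - f x| < e.
Proof.
split.
  move=> /cvgrPdist_lt h e e0; have /nbhs_enormP[r r0 hr] := h _ e0.
  by exists r => // y /hr; rewrite distrC.
move=> h; rewrite /prop_for /continuous_at; apply/(@cvgrPdist_lt _ _ _ (nbhs x)) => e e0; have [r r0 hr] := h _ e0.
by apply/nbhs_enormP; exists r => // y /hr; rewrite distrC.
Qed.

Lemma open_enorm_ball r : open [set y : V | enorm y < r].
Proof.
apply/open_enormP => x /= xr; exists (r - enorm x); first by rewrite subr_gt0.
move=> y; rewrite ltrBrDr => h; apply: le_lt_trans h.
by rewrite -{1}(subrK x y) enormD.
Qed.

Definition bform A x y := dotr (x *m A) y.
Definition qform A x := bform A x x.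

Lemma bformDl A x y z : bform A (x + y) z = bform A x z + bform A y z.
Proof. by rewrite /bform mulmxDl dotrDl. Qed.
Lemma bformZl A c x z : bform A (c *: x) z = c * bform A x z.
Proof. by rewrite /bform -scalemxAl dotrZl. Qed.
Lemma bformDr A x y z : bform A x (y + z) = bform A x y + bform A x z.
Proof. exact: dotrDr. Qed.
Lemma bformZr A c x z : bform A x (c *: z) = c * bform A x z.
Proof. exact: dotrZr. Qed.
Lemma bformC A x y : A^T = A -> bform A x y = bform A y x.
Proof.
move=> AT; have bE u w : bform A u w = (u *m A *m w^T) 0 0.
  by rewrite /bform /dotr mxE; apply: eq_bigr => i _; rewrite !mxE.
by rewrite !bE -[y *m A *m x^T]trmxK [RHS]mxE !trmx_mul trmxK AT mulmxA.
Qed.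

Lemma bform_evec A i j : bform A (evec R i) (evec R j) = A i j.
Proof.
by rewrite /bform dotr_evec /evec -rowE mxE.
Qed.

Lemma enorm_mulmx A x : enorm (x *m A) <= n%:R ^+ 2 * `|A| * enorm x.
Proof.
apply: le_trans (enorm_le_mx_norm _) _; rewrite expr2 -!mulrA ler_wpM2l//.
apply: mx_norm_le => [|i j]; first by rewrite !mulr_ge0// enorm_ge0.
rewrite mxE; apply: le_trans (ler_norm_sum _ _ _) _.
have -> : n%:R * (`|A| * enorm x) = \sum_(k < n) `|A| * enorm x.
  by rewrite sumr_const card_ord mulr_natl.
apply: ler_sum => k _; rewrite normrM mulrC ler_pM// ?mx_entry_le//.
by rewrite ord1 entry_le_enorm.
Qed.

Lemma bform_bound A x y : `|bform A x y| <= n%:R ^+ 2 * `|A| * enorm x * enorm y.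
Proof.
apply: le_trans (cauchy_schwarz _ _) _.
by rewrite ler_wpM2r ?enorm_ge0// enorm_mulmx.
Qed.

Lemma qform_bound A x : `|qform A x| <= n%:R ^+ 2 * `|A| * enorm x ^+ 2.
Proof. by apply: le_trans (bform_bound _ _ _) _; rewrite expr2 mulrA. Qed.

End Euclid.

(** * Directional derivatives, Taylor expansion and symmetry of the Hessian *)

Lemma mixed_difference_sym (V : zmodType) (a b c d : V) : a - b - c + d = a - c - b + d.
Proof. by rewrite [a - b - c]addrAC. Qed.

Lemma is_derive_derive1 (R : realType) (g : R -> R) (t : R) :
  derivable g t 1 -> is_derive t 1 g (derive1 g t).
Proof. by move=> dg; rewrite derive1E; exact: derivableP. Qed.

Section DirectionalCalculus.
Variables (R : realType) (n : nat).
Local Notation V := 'rV[R]_n.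
Implicit Types (x y z v w : V) (f g : V -> R).

Lemma addrDK3 (U : zmodType) (x a b : U) : x + a + b - x = a + b.
Proof. by rewrite -[x + a + b]addrA [x + (a + b)]addrC addrK. Qed.

Lemma MVT_closed (f df : R -> R) (a b : R) : a <= b ->
  (forall t, a <= t <= b -> is_derive t 1 f (df t)) ->
  exists2 c, a <= c <= b & f b - f a = df c * (b - a).
Proof.
move=> ab fd; have [||c cab ->] := @MVT_segment R f df a b ab.
- by move=> t; rewrite in_itv /= => /andP[/ltW ? /ltW ?]; apply: fd; apply/andP.
- by apply: derivable_within_continuous => t; rewrite in_itv /= => /fd[].
- by exists c.
Qed.

Lemma is_derive_line f y v t (D : R) :
  is_derive (y + t *: v) v f D <-> is_derive t 1 (fun s : R => f (y + s *: v)) D.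
Proof.
have E : (fun h : R => h^-1 *: ((f \o shift (y + t *: v)) (h *: v) - f (y + t *: v))) =
   (fun h : R => h^-1 *: (((fun s : R => f (y + s *: v)) \o shift t) (h *: (1 : R)) - f (y + t *: v))).
  apply/funext => h /=; congr (_ *: (f _ - _)).
  by rewrite scalerDl addrCA [h *: (1 : R)]mulr1.
split=> -[h1 h2]; apply: DeriveDef.
- by move: h1; rewrite /derivable E.
- by rewrite -h2 /derive E.
- by move: h1; rewrite /derivable -E.
- by rewrite -h2 /derive -E.
Qed.

Lemma is_derive_epsP f x v (D : R) : is_derive x v f D <->
  forall e : R, 0 < e -> exists2 d : R, 0 < d & forall h : R, h != 0 -> `|h| < d ->
   `|h^-1 * (f (x + h *: v) - f x) - D| < e.
Proof.
split.
  move=> [h1 h2] e e0.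
  have : (fun h : R => h^-1 *: ((f \o shift x) (h *: v) - f x)) @ 0^' --> D.
    by rewrite -h2; exact: h1.
  move=> /cvgrPdist_lt/(_ _ e0); rewrite near_withinE => /nbhs_ballP[d /= d0 hd].
  exists d => // h h0 hd'; have := hd h; rewrite /ball /= sub0r normrN => /(_ hd' h0).
  by rewrite distrC [h *: v + x]addrC.
move=> H.
have c : (fun h : R => h^-1 *: ((f \o shift x) (h *: v) - f x)) @ 0^' --> D.
  apply/cvgrPdist_lt => e /H[d d0 hd]; rewrite near_withinE; apply/nbhs_ballP.
  exists d => //= h; rewrite /ball /= sub0r normrN => hd' h0.
  by rewrite distrC /= [h *: v + x]addrC; exact: hd.
apply: DeriveDef; first by apply/cvg_ex; exists D.
exact: cvg_lim c.
Qed.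

Lemma is_deriveZv f x v (c D : R) : is_derive x v f D -> is_derive x (c *: v) f (c * D).
Proof.
have -> : x = x + 0 *: v by rewrite scale0r addr0.
move=> /is_derive_line H.
have -> : x + 0 *: v = x + 0 *: (c *: v) by rewrite !scale0r.
apply/is_derive_line.
have -> : (fun s => f (x + s *: (c *: v))) = (fun s => f (x + s *: v)) \o (fun s => c * s).
  by apply/funext => s /=; rewrite scalerA mulrC.
rewrite mulrC; apply: is_derive1_comp; first by rewrite mulr0.
by have := is_deriveZ c (is_derive_id (0 : R) 1); rewrite [c *: 1]mulr1.
Qed.

Lemma MVT_line f y v (df : V -> R) :
  (forall t : R, 0 <= t <= 1 -> is_derive (y + t *: v) v f (df (y + t *: v))) ->
  exists2 t : R, 0 <= t <= 1 & f (y + v) - f y = df (y + t *: v).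
Proof.
move=> H; have [|t t01 Et] := @MVT_closed (fun s => f (y + s *: v)) (fun s => df (y + s *: v)) 0 1 ler01.
  by move=> t /H/is_derive_line.
by exists t => //; move: Et; rewrite scale1r scale0r addr0 subr0 mulr1.
Qed.

(** Induction over the coordinates: the increment along the next coordinate is a mean value of its
    partial derivative at a point close to x, and continuity replaces that value by the one at x. *)
Lemma is_derive_partials f x (r : R) : 0 < r ->
  (forall i y, enorm (y - x) < r -> derivable f y (evec R i)) ->
  (forall i, {for x, continuous (partial i f)}) ->
  forall v, is_derive x v f (\sum_i v ord0 i * partial i f x).
Proof.
move=> r0 fd fc v.
have H : forall s : seq 'I_n, is_derive x (\sum_(i <- s) v ord0 i *: evec R i) f
    (\sum_(i <- s) v ord0 i * partial i f x).
  elim=> [|i s IH]; first by rewrite !big_nil; exact: is_derive0.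
  rewrite !big_cons; set w := \sum_(i <- s) _ in IH *; set L := \sum_(i <- s) _ in IH *.
  set c := v ord0 i.
  apply/is_derive_epsP => e e0.
  have e2 : 0 < e / 2 by rewrite divr_gt0.
  move/is_derive_epsP : IH => /(_ _ e2)[d d0 hd].
  have [|rho rho0 hrho] := (continuous_enormP _ _).1 (fc i) (e / (2 * (`|c| + 1))).
    by rewrite divr_gt0// mulr_gt0// ltr_wpDl.
  pose N := enorm w + `|c| + 1.
  have N0 : 0 < N by rewrite ltr_wpDl// addr_ge0// enorm_ge0.
  exists (Num.min d (Num.min r rho / N)).
    by rewrite lt_min d0 divr_gt0// lt_min r0.
  move=> h h0; rewrite lt_min => /andP[hd1 hd2].
  have bnd t : 0 <= t <= 1 ->
      (enorm (x + h *: w + t *: (h *: (c *: evec R i)) - x) < r) &&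
      (enorm (x + h *: w + t *: (h *: (c *: evec R i)) - x) < rho).
    move=> t01; rewrite -lt_min.
    apply: (@le_lt_trans _ _ (`|h| * N)); last by rewrite -ltr_pdivlMr.
    rewrite addrDK3; apply: le_trans (enormD _ _) _.
    rewrite !enormZ enorm_evec mulr1 /N.
    have tn : `|t| <= 1 by case/andP: t01 => t0 t1; rewrite ger0_norm.
    have := normr_ge0 h; have := enorm_ge0 w.
    have : `|t| * (`|h| * `|c|) <= 1 * (`|h| * `|c|) by rewrite ler_wpM2r// mulr_ge0.
    nra.
  have [|t t01 Et] := @MVT_line f (x + h *: w) (h *: (c *: evec R i)) (fun y => h * (c * partial i f y)).
    move=> t t01; do 2 apply: is_deriveZv; apply: derivableP; apply: fd.
    by case/andP: (bnd _ t01).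
  have Ec : `|c * partial i f (x + h *: w + t *: (h *: (c *: evec R i))) - c * partial i f x| <= e / 2.
    rewrite -mulrBr normrM.
    have /ltW : `|partial i f (x + h *: w + t *: (h *: (c *: evec R i))) - partial i f x| < e / (2 * (`|c| + 1)).
      apply: hrho.
      by case/andP: (bnd _ t01).
    rewrite ler_pdivlMr ?mulr_gt0 ?ltr_wpDl// => a1.
    have := normr_ge0 (partial i f (x + h *: w + t *: (h *: (c *: evec R i))) - partial i f x).
    move=> a2; nra.
  have := hd _ h0 hd1.
  have -> : x + h *: (c *: evec R i + w) = x + h *: w + h *: (c *: evec R i).
    by rewrite scalerDr addrA addrAC.
  move: Et => /(canRL (subrK _)) ->.
  set P := partial i f _ in Ec *; set Q := partial i f x in Ec *.
  set F := f (x + h *: w).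
  have -> : h^-1 * (h * (c * P) + F - f x) - (c * Q + L) =
     (c * P - c * Q) + (h^-1 * (F - f x) - L) by field.
  by move=> a1; apply: le_lt_trans (ler_normD _ _) _; lra.
have := H (index_enum _); rewrite -rV_evec_sum; exact.
Qed.


(** Three nested mean value theorems on subintervals of [0, 1]; the factor 1/6 of the sharp
    remainder is given away. *)
Lemma taylor2_01 (p p1 p2 p3 : R -> R) (B : R) :
  (forall t : R, 0 <= t <= 1 -> is_derive t 1 p (p1 t)) ->
  (forall t : R, 0 <= t <= 1 -> is_derive t 1 p1 (p2 t)) ->
  (forall t : R, 0 <= t <= 1 -> is_derive t 1 p2 (p3 t)) ->
  (forall t : R, 0 <= t <= 1 -> `|p3 t| <= B) ->
  `|p 1 - p 0 - p1 0 - 2^-1 * p2 0| <= B.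
Proof.
move=> H H1 H2 H3.
have d1 (t : R) : is_derive t (1 : R) (fun t => t * p1 0 + 2^-1 * t ^+ 2 * p2 0) (p1 0 + t * p2 0).
  have d2 : is_derive t (1 : R) (p1 0 \*: (@id R) + (2^-1 * p2 0) \*: ((@id R) ^+ 2)) (p1 0 *: (1 : R) + (2^-1 * p2 0) *: ((2%:R * id t ^+ 2.-1) *: (1 : R))).
    by apply: is_deriveD.
  have E : (fun t => t * p1 0 + 2^-1 * t ^+ 2 * p2 0) = p1 0 \*: (@id R) + (2^-1 * p2 0) \*: ((@id R) ^+ 2).
    by rewrite [in RHS]expr2; apply/funext => s; rewrite !fctE /= /GRing.scale /=; ring.
  by rewrite E; apply: is_derive_eq d2 _; rewrite /GRing.scale /=; field.
have [|t /andP[t0 t1]] := @MVT_closed (p - (fun t => t * p1 0 + 2^-1 * t ^+ 2 * p2 0))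
  (fun t => p1 t - (p1 0 + t * p2 0)) 0 1 ler01.
  by move=> t t01; apply: is_deriveB (H t t01) (d1 t).
rewrite subr0 mulr1 !fctE expr1n mulr1 mul1r mul0r expr0n /= mulr0 mul0r addr0 subr0.
move=> E0; have {E0} -> : p 1 - p 0 - p1 0 - 2^-1 * p2 0 = p1 t - (p1 0 + t * p2 0).
  by rewrite -E0; ring.
have d3 (s : R) : is_derive s (1 : R) (fun t => t * p2 0) (p2 0).
  have := is_deriveZ (p2 0) (is_derive_id s (1 : R)).
  have -> : (fun t => t * p2 0) = p2 0 \*: @id R by apply/funext => w; rewrite /= mulrC.
  by rewrite [_ *: 1]mulr1.
have [|s /andP[s0 st]] := @MVT_closed (p1 - (fun t => t * p2 0)) (fun t => p2 t - p2 0) 0 t t0.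
  move=> s /andP[s0 st]; apply: is_deriveB (d3 s); apply: H1.
  by rewrite s0 (le_trans st).
rewrite subr0 !fctE mul0r subr0 => E.
have [|q /andP[q0 qs] Eq] := @MVT_closed p2 p3 0 s s0.
  by move=> q /andP[q0 qs]; apply: H2; rewrite q0 (le_trans qs)// (le_trans st).
have -> : p1 t - (p1 0 + t * p2 0) = p3 q * s * t.
  by rewrite opprD addrA addrAC E Eq subr0.
rewrite -mulrA normrM (ger0_norm (mulr_ge0 s0 t0)).
have q1 : `|p3 q| <= B by apply: H3; rewrite q0 (le_trans qs)// (le_trans st).
have B0 : 0 <= B by apply: le_trans q1.
rewrite -[leRHS]mulr1 ler_pM ?mulr_ge0// -[leRHS]mulr1 ler_pM//.
exact: le_trans t1.
Qed.

Lemma Ck_on_directional m (A : set V) f s y v : open A -> Ck_on m A f ->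
  (size s < m)%N -> A y ->
  is_derive y v (pd s f) (\sum_i v ord0 i * pd (i :: s) f y).
Proof.
move=> Ao [fd fc] sm Ay.
have [r r0 hr] := (open_enormP _).1 Ao _ Ay.
apply: (is_derive_partials r0).
  by move=> i z zy; apply: fd => //; exact: hr.
by move=> i; apply: (fc (i :: s)).
Qed.

Lemma ler_norm_lincomb (z : V) (a : 'I_n -> R) B : (forall i, `|a i| <= B) ->
  `|\sum_i z ord0 i * a i| <= n%:R * B * enorm z.
Proof.
move=> aB; apply: le_trans (ler_norm_sum _ _ _) _.
have -> : n%:R * B * enorm z = \sum_(i < n) enorm z * B.
  by rewrite sumr_const card_ord -mulr_natl; ring.
by apply: ler_sum => i _; rewrite normrM ler_pM// entry_le_enorm.
Qed.

Lemma enorm_convex (y z : V) (r t : R) : 0 <= t <= 1 -> enorm y < r -> enorm (y + z) < r ->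
  enorm (y + t *: z) < r.
Proof.
move=> /andP[t0 t1] yr yzr.
have -> : y + t *: z = (1 - t) *: y + t *: (y + z).
  by rewrite scalerDr addrA -scalerDl subrK scale1r.
apply: le_lt_trans (enormD _ _) _; rewrite !enormZ ger0_norm ?subr_ge0// ger0_norm//.
have [->|t0'] := eqVneq t 0; first by rewrite subr0 mul1r mul0r addr0.
have tp : 0 < t by rewrite lt_def t0'.
have : t * enorm (y + z) < t * r by rewrite ltr_pM2l.
have : (1 - t) * enorm y <= (1 - t) * r by rewrite ler_wpM2l ?subr_ge0// ltW.
lra.
Qed.

Definition grad f y : V := \row_i partial i f y.

(** C does not depend on the base point y; this is what later gives one contact radius for all
    boundary points seen by a chart. *)
Lemma taylor2 f (r K : R) : Ck_on 3 [set y | enorm y < r] f ->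
  (forall s, size s = 3%N -> forall x, enorm x < r -> `|pd s f x| <= K) ->
  exists2 C, 0 <= C & forall y z, enorm y < r -> enorm (y + z) < r ->
  `|f (y + z) - f y - dotr (grad f y) z - 2^-1 * qform (hess f y) z| <= C * enorm z ^+ 3.
Proof.
move=> fC fK; exists (n%:R * (n%:R * (n%:R * `|K|))); first by rewrite !mulr_ge0.
move=> y z yr yzr.
have Br := @open_enorm_ball R n r.
have yt (t : R) : 0 <= t <= 1 -> enorm (y + t *: z) < r by move=> h; exact: enorm_convex.
pose D1 p := \sum_i z ord0 i * pd [:: i] f p.
pose D2 p := \sum_i z ord0 i * (\sum_j z ord0 j * pd [:: j; i] f p).
pose D3 p := \sum_i z ord0 i * (\sum_j z ord0 j * (\sum_k z ord0 k * pd [:: k; j; i] f p)).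
have dsum (g g' : 'I_n -> V -> R) p : (forall i, is_derive p z (g i) (g' i p)) ->
    is_derive p z (fun q => \sum_i z ord0 i * g i q) (\sum_i z ord0 i * g' i p).
  move=> gd.
  have -> : (fun q => \sum_i z ord0 i * g i q) = \sum_i (z ord0 i \*: g i).
    by apply/funext => q; rewrite fct_sumE.
  by apply: is_derive_sum => i; exact: is_deriveZ.
have := @taylor2_01 (fun t => f (y + t *: z)) (fun t => D1 (y + t *: z)) (fun t => D2 (y + t *: z))
  (fun t => D3 (y + t *: z)) (n%:R * (n%:R * (n%:R * `|K|)) * enorm z ^+ 3).
rewrite scale1r scale0r addr0 => H.
have -> : dotr (grad f y) z = D1 y.
  by apply: eq_bigr => i _; rewrite mxE mulrC.
have -> : qform (hess f y) z = D2 y.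
  apply: eq_bigr => i _; rewrite mxE mulrC; congr (_ * _).
  by apply: eq_bigr => j _; rewrite mxE.
apply: H => t t01.
- apply/is_derive_line; exact: (@Ck_on_directional 3 _ f [::] _ z Br fC _ (yt _ t01)).
- apply/is_derive_line; apply: (dsum _ (fun i q => \sum_j z ord0 j * pd [:: j; i] f q)) => i.
  exact: (@Ck_on_directional 3 _ f [:: i] _ z Br fC _ (yt _ t01)).
- apply/is_derive_line.
  apply: (dsum _ (fun i q => \sum_j z ord0 j * (\sum_k z ord0 k * pd [:: k; j; i] f q))) => i.
  apply: (dsum _ (fun j q => \sum_k z ord0 k * pd [:: k; j; i] f q)) => j.
  exact: (@Ck_on_directional 3 _ f [:: j; i] _ z Br fC _ (yt _ t01)).
rewrite (_ : _ * _ ^+ 3 = n%:R * (n%:R * (n%:R * `|K| * enorm z) * enorm z) * enorm z); last by ring.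
do 3 apply: ler_norm_lincomb => ?.
by apply: le_trans (ler_norm K); apply: fK => //; exact: yt.
Qed.

(** Mean value theorem in direction i, then in direction j. Exchanging i and j leaves the second
    difference unchanged, so both mixed derivatives agree at points arbitrarily close to x;
    [schwarz] then needs their continuity only. *)
Lemma double_difference (A : set V) f x i j (h : R) : open A -> Ck_on 2 A f -> 0 < h ->
  (forall y, enorm (y - x) <= 2 * h -> A y) ->
  exists2 p, enorm (p - x) <= 2 * h &
  f (x + h *: evec R i + h *: evec R j) - f (x + h *: evec R i) - f (x + h *: evec R j) + f x
   = h ^+ 2 * partial j (partial i f) p.
Proof.
move=> Ao [fd fc] h0 hA.
have hz : `|h| = h by rewrite gtr0_norm.
have near1 (s t : R) : 0 <= s <= 1 -> 0 <= t <= 1 ->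
    enorm (x + s *: (h *: evec R i) + t *: (h *: evec R j) - x) <= 2 * h.
  move=> /andP[s0 s1] /andP[t0 t1]; rewrite addrDK3; apply: le_trans (enormD _ _) _.
  rewrite !enormZ !enorm_evec !mulr1 hz !ger0_norm//; nra.
pose F y := f (y + h *: evec R j) - f y.
have shift_der y w v D : is_derive (y + w) v f D -> is_derive y v (fun y => f (y + w)) D.
  move=> /is_derive_epsP H; apply/is_derive_epsP => e /H[d d0 hd]; exists d => // k k0 kd.
  by rewrite addrAC; exact: hd.
have [|t t01 Et] := @MVT_line F x (h *: evec R i) (fun y => h * (partial i f (y + h *: evec R j) - partial i f y)).
  move=> t t01; apply: is_deriveZv; apply: is_deriveB.
    apply: shift_der; apply: derivableP; apply: (fd [::]) => //; apply: hA.
    by have := near1 t 1 t01; rewrite scale1r lexx ler01; apply.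
  apply: derivableP; apply: (fd [::]) => //; apply: hA.
  by have := near1 t 0 t01; rewrite lexx ler01 scale0r addr0; apply.
have [|s s01 Es] := @MVT_line (partial i f) (x + t *: (h *: evec R i)) (h *: evec R j) (fun y => h * partial j (partial i f) y).
  move=> s s01; apply: is_deriveZv; apply: derivableP.
  by apply: (fd [:: i]) => //; apply: hA; exact: near1.
exists (x + t *: (h *: evec R i) + s *: (h *: evec R j)); first exact: near1.
move: Et; rewrite /F Es mulrA -expr2 => <-; ring.
Qed.

Lemma ler_dist_split (a b c e : R) : `|a - b| < e / 2 -> `|a - c| < e / 2 -> `|c - b| <= e.
Proof.
move=> a1 a2; have -> : c - b = (a - b) - (a - c) by ring.
by apply: le_trans (ler_normB _ _) _; lra.
Qed.

Lemma schwarz (A : set V) f x : open A -> Ck_on 2 A f -> A x -> (hess f x)^T = hess f x.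
Proof.
move=> Ao fC Ax; apply/matrixP => i j; rewrite !mxE.
apply/eqP; rewrite -subr_eq0 -normr_le0; apply/ler_addgt0Pl => e e0; rewrite addr0.
have [r r0 hr] := (open_enormP _).1 Ao _ Ax.
have e2 : 0 < e / 2 by rewrite divr_gt0.
have [_ fc] := fC.
have [r1 r10 h1] := (continuous_enormP _ _).1 (fc [:: j; i] isT x Ax) _ e2.
have [r2 r20 h2] := (continuous_enormP _ _).1 (fc [:: i; j] isT x Ax) _ e2.
pose h := Num.min r (Num.min r1 r2) / 4.
have m0 : 0 < Num.min r (Num.min r1 r2) by rewrite !lt_min r0 r10.
have h0 : 0 < h by rewrite divr_gt0.
have : 2 * h < Num.min r (Num.min r1 r2) by rewrite /h; lra.
rewrite !lt_min => /andP[hr0 /andP[hr1 hr2]].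
have hA y : enorm (y - x) <= 2 * h -> A y by move=> yx; apply: hr; apply: le_lt_trans yx _.
have [p px Ep] := @double_difference A f x i j h Ao fC h0 hA.
have [q qx Eq] := @double_difference A f x j i h Ao fC h0 hA.
have pq : partial j (partial i f) p = partial i (partial j f) q.
  have hn : h ^+ 2 != 0 by rewrite expf_neq0// gt_eqF.
  apply: (mulfI hn); rewrite -Ep -Eq [x + _ + _]addrAC; exact: mixed_difference_sym.
have := h1 _ (le_lt_trans px hr1); have := h2 _ (le_lt_trans qx hr2) => /=.
rewrite pq => a1 a2.
exact: ler_dist_split a1 a2.
Qed.

End DirectionalCalculus.

(** * Osculating quadrics of the boundary *)

Section Osculation.
Variables (R : realType) (n : nat).
Local Notation V := 'rV[R]_n.
Implicit Types (x y z nu : V) (A : 'M[R]_n) (O : set V).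

(* Near xb the domain lies, up to eta (|z|^2 + |<z, nu>|), on the inner side of
   the paraboloid <z, nu> = <z A, z> / 2.  This contact determines nu and A, so
   the same data are read off from any chart around xb. *)
Definition osculates O xb nu A (eta r : R) : Prop := forall z, enorm z < r ->
  (eta * (enorm z ^+ 2 + `|dotr z nu|) < dotr z nu - 2^-1 * qform A z -> O (xb + z)) /\
  (O (xb + z) -> - (eta * (enorm z ^+ 2 + `|dotr z nu|)) < dotr z nu - 2^-1 * qform A z).

Definition osculating O xb nu A : Prop :=
  forall eta : R, 0 < eta -> exists2 r : R, 0 < r & osculates O xb nu A eta r.

Lemma qformZ A (t : R) z : qform A (t *: z) = t ^+ 2 * qform A z.
Proof. by rewrite /qform bformZl bformZr expr2 mulrA. Qed.

Lemma qformD A x y : A^T = A -> qform A (x + y) = qform A x + 2 * bform A x y + qform A y.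
Proof.
by move=> AT; rewrite /qform bformDl !bformDr (bformC y x AT); ring.
Qed.

(** For a displacement of slope c against one normal and -c against another, the linear terms beat
    the quadratic ones when t is small: one contact condition puts the point inside, the other
    outside. The factor 1/4 is the tolerance eta of both applications. *)
Lemma osc_slope_arith (c w q1 q2 t : R) : 0 < c -> 0 < w -> 0 < t ->
  t * (w + `|q1| + `|q2|) < c ->
  4^-1 * (t ^+ 2 * w + t * c) < t * c - 2^-1 * (t ^+ 2 * q1) /\
  - (t * c) - 2^-1 * (t ^+ 2 * q2) <= - (4^-1 * (t ^+ 2 * w + t * c)).
Proof.
move=> c0 w0 t0 h.
have a1 := ler_norm q1; have a2 : - q2 <= `|q2| by rewrite -normrN ler_norm.
have b1 := normr_ge0 q1; have b2 := normr_ge0 q2.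
have h1 : t * (t * (w + `|q1| + `|q2|)) < t * c by rewrite ltr_pM2l.
have t2 : 0 < t ^+ 2 by rewrite exprn_gt0.
have c1 : t ^+ 2 * q1 <= t ^+ 2 * `|q1| by rewrite ler_wpM2l// ltW.
have c2 : t ^+ 2 * - q2 <= t ^+ 2 * `|q2| by rewrite ler_wpM2l// ltW.
have d1 : 0 <= t ^+ 2 * `|q1| by rewrite mulr_ge0// ltW.
have d2 : 0 <= t ^+ 2 * `|q2| by rewrite mulr_ge0// ltW.
have d3 : 0 <= t ^+ 2 * w by rewrite mulr_ge0// ltW.
have e1 : t * (t * (w + `|q1| + `|q2|)) = t ^+ 2 * w + t ^+ 2 * `|q1| + t ^+ 2 * `|q2| by ring.
rewrite e1 in h1.
have tc : 0 < t * c by rewrite mulr_gt0.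
split; lra.
Qed.

Lemma enorm_sub_sqr nu1 nu2 : enorm nu1 = 1 -> enorm nu2 = 1 ->
  enorm (nu1 - nu2) ^+ 2 = 2 - 2 * dotr nu1 nu2.
Proof.
move=> u1 u2; rewrite -dotr_sqr dotrBl !dotrBr !dotr_sqr u1 u2 (dotrC nu2); ring.
Qed.

(** The test points are xb + t (nu1 - nu2), of slope c against [nu1] and -c against [nu2], where c =
    1 - <nu1, nu2> is positive because 2c = |nu1 - nu2|^2. *)
Lemma osculates_normal_unique O xb nu1 nu2 A1 A2 :
  enorm nu1 = 1 -> enorm nu2 = 1 ->
  osculating O xb nu1 A1 ->
  osculating O xb nu2 A2 ->
  nu1 = nu2.
Proof.
move=> u1 u2 h1 h2; apply/eqP; apply: contraT => n12.
pose z := nu1 - nu2.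
have z0 : 0 < enorm z by apply: enorm_gt0; rewrite subr_eq0.
have e4 : 0 < 4^-1 :> R by rewrite invr_gt0.
have [r1 r10 o1] := h1 _ e4; have [r2 r20 o2] := h2 _ e4.
pose c := 1 - dotr nu1 nu2.
have zz : enorm z ^+ 2 = 2 * c by rewrite enorm_sub_sqr// /c; ring.
have c0 : 0 < c by rewrite -(pmulr_rgt0 _ (ltr0n R 2)) -zz exprn_gt0.
have z1 : dotr z nu1 = c by rewrite dotrBl dotr_sqr u1 expr1n (dotrC nu2).
have z2 : dotr z nu2 = - c by rewrite dotrBl dotr_sqr u2 expr1n opprB.
pose w := enorm z ^+ 2 + `|qform A1 z| + `|qform A2 z|.
have w0 : 0 < w by rewrite /w -addrA ltr_pwDl// ?exprn_gt0// addr_ge0.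
pose t := Num.min (c / w) (Num.min r1 r2 / enorm z) / 2.
have m0 : 0 < Num.min (c / w) (Num.min r1 r2 / enorm z).
  by rewrite lt_min !divr_gt0// lt_min r10.
have t0 : 0 < t by rewrite divr_gt0.
have : t < Num.min (c / w) (Num.min r1 r2 / enorm z) by rewrite ltr_pdivrMr// mulr_natr mulr2n ltrDl.
rewrite lt_min => /andP[]; rewrite !ltr_pdivlMr// lt_min => tw /andP[tr1 tr2].
have tz : enorm (t *: z) = t * enorm z by rewrite enormZ gtr0_norm.
have w2 : 0 < enorm z ^+ 2 by rewrite exprn_gt0.
have [H1 H2] := osc_slope_arith c0 w2 t0 tw.
have tzr1 : enorm (t *: z) < r1 by rewrite tz.
have tzr2 : enorm (t *: z) < r2 by rewrite tz.
have [a1 _] := o1 _ tzr1; have [_ a2] := o2 _ tzr2.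
move: a1 a2; rewrite tz !dotrZl z1 z2 !qformZ mulrN normrN exprMn.
rewrite gtr0_norm ?mulr_gt0//.
move=> a1 a2; have /a2 := a1 H1.
by rewrite ltNge H2.
Qed.

Lemma osc_curv_arith (N a g t : R) : 0 < g -> 0 < N -> 0 < t -> t <= 1 ->
  forall e2, t ^+ 2 * e2 + t ^+ 4 * a ^+ 2 + t ^+ 2 * `|a| < t ^+ 2 * N ->
  g / N * (t ^+ 2 * e2 + t ^+ 4 * a ^+ 2 + t ^+ 2 * `|a|) < t ^+ 2 * g.
Proof.
move=> g0 N0 t0 t1 e2; rewrite -(ltr_pM2l (divr_gt0 g0 N0)) => /lt_le_trans; apply.
by rewrite mulrCA divfK// gt_eqF.
Qed.

(** If [A2] exceeded [A1] on e, the curve xb + t e + t^2 a nu, with a midway between the two halved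
    forms, would run between the two paraboloids at height t^2 g from each: inside by [A1], outside
    by [A2]. N bounds the contact tolerance along the curve divided by t^2, so eta = g/N is small
    enough. *)
Lemma osculates_qform_le O xb nu A1 A2 e :
  enorm nu = 1 -> A1^T = A1 -> A2^T = A2 -> nu *m A1 = 0 -> nu *m A2 = 0 ->
  osculating O xb nu A1 ->
  osculating O xb nu A2 ->
  dotr e nu = 0 -> qform A2 e <= qform A1 e.
Proof.
move=> u A1T A2T nA1 nA2 h1 h2 enu; rewrite leNgt; apply/negP => lt12.
pose a := (qform A1 e + qform A2 e) / 4.
pose g := (qform A2 e - qform A1 e) / 4.
have g0 : 0 < g by rewrite divr_gt0// subr_gt0.
pose N := enorm e ^+ 2 + a ^+ 2 + `|a| + 1.
have N0 : 0 < N by rewrite ltr_wpDl// !addr_ge0// sqr_ge0.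
have gN : 0 < g / N by rewrite divr_gt0.
have [r1 r10 o1] := h1 _ gN; have [r2 r20 o2] := h2 _ gN.
pose m := enorm e + `|a| + 1.
have m0 : 0 < m by rewrite ltr_wpDl// addr_ge0// enorm_ge0.
pose t := Num.min 1 (Num.min r1 r2 / m) / 2.
have mm0 : 0 < Num.min 1 (Num.min r1 r2 / m) by rewrite lt_min ltr01 divr_gt0// lt_min r10.
have t0 : 0 < t by rewrite divr_gt0.
have : t < Num.min 1 (Num.min r1 r2 / m) by rewrite ltr_pdivrMr// mulr_natr mulr2n ltrDl.
rewrite lt_min ltr_pdivlMr// lt_min => /andP[/ltW t1 /andP[tr1 tr2]].
pose z := t *: e + (t ^+ 2 * a) *: nu.
have znu : dotr z nu = t ^+ 2 * a.
  by rewrite dotrDl !dotrZl enu dotr_sqr u expr1n mulr0 add0r mulr1.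
have zz : enorm z ^+ 2 = t ^+ 2 * enorm e ^+ 2 + t ^+ 4 * a ^+ 2.
  rewrite -!dotr_sqr !(dotrDl, dotrDr, dotrZl, dotrZr) (dotrC nu e) enu.
  rewrite [dotr nu nu]dotr_sqr u; ring.
have zm : enorm z <= t * m.
  apply: le_trans (enormD _ _) _; rewrite !enormZ u mulr1 [`|t ^+ 2 * a|]normrM.
  rewrite (gtr0_norm t0) (gtr0_norm (exprn_gt0 2 t0)) /m !mulrDr mulr1 -addrA lerD2l.
  by rewrite (ler_wpDr (ltW t0))// ler_wpM2r// expr2 ler_piMl// ltW.
have qz A : A^T = A -> nu *m A = 0 -> qform A z = t ^+ 2 * qform A e.
  move=> AT nA; rewrite qformD// qformZ bformC// {2 3}/qform !bformZl /bform nA !dotr0l.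
  by rewrite !mulr0 !addr0.
have bnd : t ^+ 2 * enorm e ^+ 2 + t ^+ 4 * a ^+ 2 + t ^+ 2 * `|a| < t ^+ 2 * N.
  have t2 : 0 < t ^+ 2 by rewrite exprn_gt0.
  rewrite /N !mulrDr mulr1 ltr_pwDr// lerD2r lerD2l ler_wpM2r ?sqr_ge0//.
  by rewrite -[4%N]/(2 + 2)%N exprD ler_piMl ?(ltW t2)// expr_le1// ltW.
have H := osc_curv_arith g0 N0 t0 t1 bnd.
have [b1 _] := o1 z (le_lt_trans zm tr1).
have [_ b2] := o2 z (le_lt_trans zm tr2).
have na : `|t ^+ 2 * a| = t ^+ 2 * `|a| by rewrite normrM gtr0_norm// exprn_gt0.
move: b1 b2; rewrite znu zz !qz// na.
have -> : t ^+ 2 * a - 2^-1 * (t ^+ 2 * qform A1 e) = t ^+ 2 * g.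
  by rewrite /a /g; field.
have -> : t ^+ 2 * a - 2^-1 * (t ^+ 2 * qform A2 e) = - (t ^+ 2 * g).
  by rewrite /a /g; field.
by move=> b1 b2; have := b2 (b1 H); rewrite ltrN2 ltNge ltW.
Qed.

Lemma qform_inj A1 A2 : A1^T = A1 -> A2^T = A2 -> (forall z, qform A1 z = qform A2 z) -> A1 = A2.
Proof.
move=> A1T A2T H; apply/matrixP => i j; rewrite -!bform_evec.
have := H (evec R i + evec R j); rewrite !qformD// !H => /addIr /addrI.
by apply: mulfI; rewrite pnatr_eq0.
Qed.

(** Contact sees A on the tangent space only, since mixed and normal terms are absorbed by eta |<z,
    nu>|; the normalisation nu A = 0 fixes the rest. *)
Lemma osculates_unique O xb nu1 nu2 A1 A2 :
  enorm nu1 = 1 -> enorm nu2 = 1 -> A1^T = A1 -> A2^T = A2 -> nu1 *m A1 = 0 -> nu2 *m A2 = 0 ->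
  osculating O xb nu1 A1 ->
  osculating O xb nu2 A2 ->
  nu1 = nu2 /\ A1 = A2.
Proof.
move=> u1 u2 A1T A2T n1 n2 h1 h2.
have e12 := osculates_normal_unique u1 u2 h1 h2; subst nu2; split=> //.
apply: qform_inj => // z.
have zE : z = (z - dotr z nu1 *: nu1) + dotr z nu1 *: nu1 by rewrite subrK.
have e0 : dotr (z - dotr z nu1 *: nu1) nu1 = 0.
  by rewrite dotrBl dotrZl dotr_sqr u1 expr1n mulr1 subrr.
have qE A : A^T = A -> nu1 *m A = 0 -> qform A z = qform A (z - dotr z nu1 *: nu1).
  move=> AT nA; rewrite {1}zE qformD// qformZ bformC// {2 3}/qform bformZl /bform nA !dotr0l.
  by rewrite !mulr0 !addr0.
rewrite !qE//; apply/eqP; rewrite eq_le; apply/andP; split.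
  exact: (osculates_qform_le u1 A2T A1T n2 n1 h2 h1 e0).
exact: (osculates_qform_le u1 A1T A2T n1 n2 h1 h2 e0).
Qed.

End Osculation.

(** * Contact data read off a chart at nearby boundary points *)

Section Charts.
Variables (R : realType) (n : nat).
Local Notation V := 'rV[R]_n.
Implicit Types (x y z nu : V) (A B : 'M[R]_n) (O : set V) (f g : V -> R).

Lemma bdryP O x : open O -> bdry O x <->
  ~ O x /\ forall e : R, 0 < e -> exists2 y, O y & enorm (y - x) < e.
Proof.
move=> Oo; rewrite /bdry; have /interior_id -> := Oo.
split=> [[cl nO]|[nO cl]]; split=> //.
  move=> e e0; have : nbhs x [set y | enorm (y - x) < e] by apply/nbhs_enormP; exists e.
  by move/cl => [y [Oy /= yx]]; exists y.
move=> U /nbhs_enormP[e e0 he]; have [y Oy yx] := cl _ e0.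
by exists y; split=> //; exact: he.
Qed.

Lemma dotr_mulmxl x y (M : 'M[R]_n) : dotr (x *m M) y = dotr x (y *m M^T).
Proof.
have dE u w : dotr u w = (u *m w^T) 0 0 by rewrite mxE; apply: eq_bigr => i _; rewrite mxE.
by rewrite !dE trmx_mul trmxK mulmxA.
Qed.

Lemma partial_shift_invariant f nu i : (forall y (t : R), f (y + t *: nu) = f y) ->
  forall y (t : R), partial i f (y + t *: nu) = partial i f y.
Proof.
move=> inv y t.
pose q w := fun h : R => h^-1 *: ((f \o shift w) (h *: evec R i) - f w).
rewrite -[LHS]/(lim (q (y + t *: nu) @ 0^')) -[RHS]/(lim (q y @ 0^')).
by have -> : q (y + t *: nu) = q y by apply/funext => h; rewrite /q /= addrA !inv.
Qed.

Lemma partial_sum_invariant (r : R) f nu s y :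
  (forall y (t : R), pd s f (y + t *: nu) = pd s f y) ->
  (size s < 3)%N -> Ck_on 3 [set y | enorm y < r] f -> enorm y < r ->
  \sum_i nu ord0 i * pd (i :: s) f y = 0.
Proof.
move=> inv s3 fC yr.
have [_ <-] := @Ck_on_directional _ _ 3 _ f s y nu (@open_enorm_ball R n r) fC s3 yr.
have : is_derive y nu (pd s f) 0.
  rewrite -[y]addr0 -(scale0r nu); apply/is_derive_line.
  by under eq_fun do rewrite inv; exact: is_derive_cst.
by case.
Qed.

(* Unit normal and curvature matrix at the boundary point over y, computed in a
   chart centred at another boundary point. *)
Definition chart_normal nu g y : V := (enorm (nu - grad g y))^-1 *: (nu - grad g y).

Definition orth_proj nu : 'M[R]_n := 1%:M - nu^T *m nu.

Definition chart_curv nu g y : 'M[R]_n :=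
  orth_proj (chart_normal nu g y) *m ((enorm (nu - grad g y))^-1 *: hess g y) *m
  orth_proj (chart_normal nu g y).

Lemma row_mul_tr x y : x *m y^T = (dotr x y)%:M :> 'M[R]_1.
Proof.
apply/matrixP => i j; rewrite !ord1 !mxE eqxx mulr1n.
by apply: eq_bigr => k _; rewrite mxE.
Qed.

Lemma mul_orth_proj z nu : z *m orth_proj nu = z - dotr z nu *: nu.
Proof.
by rewrite /orth_proj mulmxBr mulmx1 mulmxA row_mul_tr mul_scalar_mx.
Qed.

Lemma orth_proj_sym nu : (orth_proj nu)^T = orth_proj nu.
Proof. by rewrite /orth_proj linearB /= trmx1 trmx_mul trmxK. Qed.

Lemma qform_orth_proj nu B z :
  qform (orth_proj nu *m B *m orth_proj nu) z = qform B (z - dotr z nu *: nu).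
Proof.
by rewrite /qform /bform mulmxA [LHS]dotr_mulmxl orth_proj_sym mulmxA !mul_orth_proj.
Qed.

(** Dropping the normal part of z costs a multiple of |z| |<z, nu>|; this error is the reason for
    the term |<z, nu>| in the tolerance of [osculates]. *)
Lemma qform_orth_proj_error nu B z : enorm nu = 1 -> B^T = B ->
  `|qform B (z - dotr z nu *: nu) - qform B z| <=
  3 * (n%:R ^+ 2 * `|B|) * enorm z * `|dotr z nu|.
Proof.
move=> nu1 BT; set s := dotr z nu.
have sz : `|s| <= enorm z by have := cauchy_schwarz z nu; rewrite nu1 mulr1.
rewrite -scaleNr qformD// qformZ sqrrN bformZr.
have -> : qform B z + 2 * (- s * bform B z nu) + s ^+ 2 * qform B nu - qform B z
   = - (2 * s * bform B z nu) + s ^+ 2 * qform B nu by ring.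
have b1 := bform_bound B z nu; have b2 := qform_bound B nu.
rewrite nu1 expr1n mulr1 in b2; rewrite nu1 mulr1 in b1.
set K := n%:R ^+ 2 * `|B| in b1 b2 *.
apply: le_trans (ler_normD _ _) _; rewrite normrN !normrM [`|2|]ger0_norm//.
have K0 : 0 <= K by rewrite mulr_ge0.
have h1 : `|s| * `|bform B z nu| <= `|s| * (K * enorm z) by rewrite ler_wpM2l.
have h2 : `|s| * (`|s| * `|qform B nu|) <= `|s| * (enorm z * K) by rewrite ler_wpM2l// ler_pM.
move: (`|s|) (`|bform _ _ _|) (`|qform _ _|) (enorm z) (K) h1 h2 => a b c d k.
by clear; lra.
Qed.

Lemma no_crossing_half (a b c d : R) :
  `|a - b| < (b - d) / 2 -> `|c - d| < (b - d) / 2 -> a < c -> False.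
Proof. by rewrite !ltr_norml => /andP[? ?] /andP[? ?] ?; lra. Qed.

Lemma half_le_two_thirds (a c d e : R) : a <= 3 * c * d * e -> 0 <= c * d * e ->
  2^-1 * a <= 2 * c * d * e.
Proof. by lra. Qed.

Lemma osculation_from_bounds (P : Prop) (G D S : R) : - S <= G - D -> G - D <= S ->
  (P <-> 0 < G) -> (S < D -> P) /\ (P -> - S < D).
Proof.
by move=> h1 h2 PG; split=> [h|/PG h]; [apply/PG; lra|lra].
Qed.

Section OneChart.
Variables (O : set V) (xs nus : V) (gs : V -> R) (rs : R).
Hypothesis H : bdry_chart O xs nus gs rs.

Let rs0 : 0 < rs. Proof. by case: H => -[]. Qed.
Let unit_nus : enorm nus = 1. Proof. by case: H => -[]. Qed.
Let gsC : Ck_on 3 [set y | enorm y < rs] gs. Proof. by case: H => _ _ _ []. Qed.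
Let inv : forall y (t : R), gs (y + t *: nus) = gs y. Proof. by case: H. Qed.

Let gsC2 : Ck_on 2 [set y | enorm y < rs] gs.
Proof. by case: gsC => a b; split=> s h; [apply: a; exact: ltnW|apply: b; exact: leqW]. Qed.

(** Invariance of the chart function along [nus] makes its gradient orthogonal to [nus]. As a
    consequence nus - grad gs has length at least 1 and can be normalised safely. *)
Lemma chart_grad_normal y : enorm y < rs -> dotr (nus - grad gs y) nus = 1.
Proof.
move=> yr; rewrite dotrBl dotr_sqr unit_nus expr1n.
rewrite dotrC; under [dotr _ (grad _ _)]eq_bigr do rewrite mxE.
by rewrite (@partial_sum_invariant rs gs nus [::])// subr0.
Qed.

Lemma chart_hess_normal y : enorm y < rs -> nus *m hess gs y = 0.
Proof.
move=> yr; apply/rowP => j; rewrite !mxE; under eq_bigr do rewrite mxE.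
by apply: (@partial_sum_invariant rs gs nus [:: j]) => //; exact: partial_shift_invariant.
Qed.

Lemma chart_hess_sym y : enorm y < rs -> (hess gs y)^T = hess gs y.
Proof. by move=> yr; apply: schwarz gsC2 yr; exact: open_enorm_ball. Qed.

Lemma chart_gradnorm_ge1 y : enorm y < rs -> 1 <= enorm (nus - grad gs y).
Proof.
move=> yr; rewrite -(chart_grad_normal yr).
by apply: le_trans (dotr_le _ _) _; rewrite unit_nus mulr1.
Qed.

Lemma chart_normal_unit y : enorm y < rs -> enorm (chart_normal nus gs y) = 1.
Proof.
move=> yr; have N1 := lt_le_trans ltr01 (chart_gradnorm_ge1 yr).
by rewrite enormZ gtr0_norm ?invr_gt0// mulVf// gt_eqF.
Qed.

Lemma chart_curv_sym y : enorm y < rs -> (chart_curv nus gs y)^T = chart_curv nus gs y.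
Proof.
move=> yr; rewrite /chart_curv !trmx_mul orth_proj_sym linearZ /= chart_hess_sym//.
by rewrite mulmxA.
Qed.

Lemma chart_curv_normal y : enorm y < rs ->
  chart_normal nus gs y *m chart_curv nus gs y = 0.
Proof.
move=> yr; have e : chart_normal nus gs y *m orth_proj (chart_normal nus gs y) = 0.
  by rewrite mul_orth_proj dotr_sqr chart_normal_unit// expr1n scale1r subrr.
by rewrite /chart_curv !mulmxA e !mul0mx.
Qed.

Let grad0 : grad gs 0 = 0.
Proof. by apply/rowP => i; rewrite !mxE; case: H => _ _ []. Qed.

Lemma chart_normal0 : chart_normal nus gs 0 = nus.
Proof. by rewrite /chart_normal grad0 subr0 unit_nus invr1 scale1r. Qed.

Lemma chart_curv0 : chart_curv nus gs 0 = hess gs 0.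
Proof.
have z0 : enorm (0 : V) < rs by rewrite enorm0.
rewrite /chart_curv chart_normal0 grad0 subr0 unit_nus invr1 scale1r.
have hn : hess gs 0 *m nus^T = 0.
  by apply: trmx_inj; rewrite trmx_mul trmxK chart_hess_sym// chart_hess_normal// trmx0.
rewrite /orth_proj mulmxBl mul1mx -mulmxA chart_hess_normal// mulmx0 subr0.
by rewrite mulmxBr mulmx1 mulmxA hn mul0mx subr0.
Qed.

(** A strict inequality one way puts the point into O; the other way it persists nearby by
    continuity, so that the point would not be a limit of points of O. *)
Lemma chart_bdry_value y : open O -> bdry O (xs + y) -> enorm y < rs -> gs y = dotr y nus.
Proof.
move=> Oo /(bdryP _ Oo)[nO cl] yr.
have [_ _ _ _ chart] := H.
have yE : xs + y - xs = y by rewrite addrC addKr.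
apply/eqP; rewrite eq_le; apply/andP; split; last first.
  rewrite leNgt; apply/negP => lt; apply: nO; apply/chart; by rewrite yE.
rewrite leNgt; apply/negP => lt.
have gc : {for y, continuous gs} by case: gsC => _ c; exact: (c [::]).
have e0 : 0 < (gs y - dotr y nus) / 2 by rewrite divr_gt0// subr_gt0.
have [r r0 hr] := (continuous_enormP _ _).1 gc _ e0.
pose e := Num.min r (Num.min (rs - enorm y) ((gs y - dotr y nus) / 2)).
have ep : 0 < e by rewrite !lt_min r0 subr_gt0 yr.
have [p Op] := cl _ ep; rewrite !lt_min => /andP[pr /andP[prs pe]].
have pq : enorm (p - xs) < rs.
  have -> : p - xs = (p - (xs + y)) + y by rewrite opprD addrA subrK.
  by apply: le_lt_trans (enormD _ _) _; rewrite -ltrBrDr.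
move/(chart _ pq) : Op.
have q1 : `|gs (p - xs) - gs y| < (gs y - dotr y nus) / 2.
  by apply: hr; rewrite -addrA -opprD.
have q2 : `|dotr (p - xs) nus - dotr y nus| < (gs y - dotr y nus) / 2.
  rewrite -dotrBl; apply: le_lt_trans (cauchy_schwarz _ _) _.
  by rewrite unit_nus mulr1 -addrA -opprD.
exact: no_crossing_half q1 q2.
Qed.

Lemma hess_bounded : exists2 K : R, 0 <= K & forall y, enorm y < rs -> `|hess gs y| <= K.
Proof.
have [_ _ _ [_ [bd _]] _] := H.
have /choice[K hK] : forall ij : 'I_n * 'I_n, exists K : R, forall x, enorm x < rs -> `|pd [:: ij.1; ij.2] gs x| <= K.
  by move=> [i j]; have [K hK] := bd [:: i; j] isT; exists K.
exists (\sum_ij `|K ij|); first exact: sumr_ge0.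
move=> y yr; apply: mx_norm_le => [|i j]; first exact: sumr_ge0.
rewrite mxE (bigD1 (i, j))//=; apply: ler_wpDr; first exact: sumr_ge0.
by apply: le_trans (ler_norm _); exact: (hK (i, j)).
Qed.

Lemma chart_expansion : exists2 C : R, 0 <= C & forall y z, open O -> bdry O (xs + y) ->
  enorm y < rs -> enorm (y + z) < rs ->
  `|(dotr (y + z) nus - gs (y + z)) / enorm (nus - grad gs y)
   - (dotr z (chart_normal nus gs y) - 2^-1 * qform (chart_curv nus gs y) z)|
  <= C * enorm z * (enorm z ^+ 2 + `|dotr z (chart_normal nus gs y)|).
Proof.
have [_ _ _ [_ [bd _]] _] := H.
have [K hK] : exists K : R, forall s : seq 'I_n, size s = 3%N -> forall x, enorm x < rs -> `|pd s gs x| <= K.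
  have /choice[K hK] : forall s : 3.-tuple 'I_n, exists K : R, forall x, enorm x < rs -> `|pd s gs x| <= K.
    by move=> s; apply: bd; rewrite size_tuple.
  exists (\sum_s `|K s|) => s s3 x xr.
  have ss : size s == 3%N by rewrite s3.
  apply: le_trans (hK (Tuple ss) x xr) _.
  by rewrite (bigD1 (Tuple ss))//=; apply: ler_wpDr; [exact: sumr_ge0|exact: ler_norm].
have [C C0 hC] := taylor2 gsC hK.
have [L L0 hL] := hess_bounded.
exists (C + 2 * (n%:R ^+ 2 * L)); first by rewrite addr_ge0// !mulr_ge0.
move=> y z Oo byd yr yzr.
have gy := chart_bdry_value Oo byd yr.
have N1 := chart_gradnorm_ge1 yr.
set N := enorm (nus - grad gs y) in N1 *.
have N0 : 0 < N by exact: lt_le_trans N1.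
set nu := chart_normal nus gs y.
have nu1 : enorm nu = 1 by exact: chart_normal_unit.
have Ni : N^-1 <= 1 by rewrite invf_le1.
have Ni0 : 0 < N^-1 by rewrite invr_gt0.
pose B := N^-1 *: hess gs y.
have BT : B^T = B by rewrite linearZ /= chart_hess_sym.
have BL : `|B| <= L.
  rewrite normrZ gtr0_norm//; apply: le_trans (hL _ yr).
  by rewrite ler_piMl.
have qB : qform B z = N^-1 * qform (hess gs y) z.
  by rewrite /qform /bform -scalemxAr dotrZl.
have zn : dotr z nu = N^-1 * (dotr z nus - dotr (grad gs y) z).
  by rewrite /nu /chart_normal dotrZr dotrBr (dotrC z (grad _ _)).
rewrite {1}/chart_curv qform_orth_proj -/N -/B -/nu.
have e1 := qform_orth_proj_error z nu1 BT.
have e2 := hC _ _ yr yzr.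
have e3 : `|2^-1 * (qform B (z - dotr z nu *: nu) - qform B z)| <= 2 * (n%:R ^+ 2 * L) * enorm z * `|dotr z nu|.
  rewrite normrM ger0_norm; last by rewrite invr_ge0.
  have : 3 * (n%:R ^+ 2 * `|B|) * enorm z * `|dotr z nu| <= 3 * (n%:R ^+ 2 * L) * enorm z * `|dotr z nu|.
    by rewrite !ler_wpM2r ?enorm_ge0// ler_wpM2l// ler_wpM2l// sqr_ge0.
  have : 0 <= (n%:R ^+ 2 * L) * enorm z * `|dotr z nu| by rewrite !mulr_ge0 ?sqr_ge0 ?enorm_ge0.
  by move=> h2 h1; apply: half_le_two_thirds => //; exact: le_trans e1 h1.
pose E := gs (y + z) - gs y - dotr (grad gs y) z - 2^-1 * qform (hess gs y) z.
have -> : (dotr (y + z) nus - gs (y + z)) / N - (dotr z nu - 2^-1 * qform B (z - dotr z nu *: nu))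
   = - (N^-1 * E) + 2^-1 * (qform B (z - dotr z nu *: nu) - qform B z).
  by rewrite zn qB dotrDl -gy /E; ring.
apply: le_trans (ler_normD _ _) _; rewrite normrN normrM (gtr0_norm Ni0).
have e4 : N^-1 * `|E| <= C * enorm z ^+ 3.
  by apply: le_trans e2; rewrite ler_piMl.
apply: le_trans (lerD e4 e3) _.
have z0 := enorm_ge0 z; have d0 := normr_ge0 (dotr z nu).
have nL : 0 <= n%:R ^+ 2 * L by rewrite mulr_ge0 ?sqr_ge0.
move: (`|dotr z nu|) (enorm z) (n%:R ^+ 2 * L) z0 d0 nL => a b c b0 a0 c0.
have -> : (C + 2 * c) * b * (b ^+ 2 + a) = C * b ^+ 3 + 2 * c * b * a + (C * b * a + 2 * c * b ^+ 3) by ring.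
by rewrite lerDl addr_ge0// !mulr_ge0// exprn_ge0.
Qed.

(** One radius serves every boundary point in the half-size chart ball: the constant of
    [chart_expansion] is independent of y, and its error carries an extra factor |z|, kept below
    eta/(C + 1). *)
Lemma chart_osculates (eta : R) : 0 < eta -> open O ->
  exists2 r : R, 0 < r & forall y, bdry O (xs + y) -> enorm y < rs / 2 ->
    osculates O (xs + y) (chart_normal nus gs y) (chart_curv nus gs y) eta r.
Proof.
move=> eta0 Oo; have [C C0 hC] := chart_expansion.
have C1 : 0 < C + 1 by rewrite ltr_wpDl.
exists (Num.min (rs / 2) (eta / (C + 1))); first by rewrite lt_min !divr_gt0.
move=> y byd yr z; rewrite lt_min => /andP[zr]; rewrite (ltr_pdivlMr _ _ C1) => ze.
have yzr : enorm (y + z) < rs by apply: le_lt_trans (enormD _ _) _; rewrite [rs]splitr ltrD.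
have yr' : enorm y < rs by apply: lt_trans yr _; rewrite ltr_pdivrMr// mulr_natr mulr2n ltrDl.
have N0 : 0 < enorm (nus - grad gs y) by exact: lt_le_trans (chart_gradnorm_ge1 yr').
have := hC y z Oo byd yr' yzr.
set S := enorm z ^+ 2 + _; set D := _ - 2^-1 * _; set G := dotr (y + z) nus - _.
have S0 : 0 <= S by rewrite addr_ge0// sqr_ge0.
have CS : C * enorm z * S <= eta * S.
  rewrite ler_wpM2r//; apply: le_trans (ltW ze); rewrite mulrC ler_wpM2l ?enorm_ge0//.
  by rewrite lerDl.
move=> /le_trans/(_ CS); rewrite ler_norml => /andP[h1 h2].
have OG : O (xs + y + z) <-> 0 < G / enorm (nus - grad gs y).
  rewrite pmulr_lgt0 ?invr_gt0// /G subr_gt0.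
  have [_ _ _ _ /(_ (xs + y + z))] := H.
  have -> : xs + y + z - xs = y + z by rewrite addrDK3.
  by apply.
exact: osculation_from_bounds h1 h2 OG.
Qed.

End OneChart.
End Charts.

(** * Continuity and chart independence of the curvature matrix *)

Section CurvatureContinuity.
Variables (R : realType) (n : nat).
Local Notation V := 'rV[R]_n.
Implicit Types (x y z nu : V) (O : set V) (f g : V -> R).

Lemma continuous_atM (h1 h2 : V -> R) x : continuous_at x h1 -> continuous_at x h2 ->
  continuous_at x (fun y => h1 y * h2 y).
Proof. by move=> c1 c2; exact: (cvgM c1 c2). Qed.

Lemma continuous_at_sum (I : Type) (r : seq I) (P : pred I) (h : I -> V -> R) x :
  (forall i, continuous_at x (h i)) ->
  continuous_at x (fun y => \sum_(i <- r | P i) h i y).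
Proof.
move=> hc; elim: r => [|i r IH].
  by under eq_fun do rewrite big_nil; exact: cst_continuous.
under eq_fun do rewrite big_cons; case: (P i) => //.
exact: (cvgD (hc i) IH).
Qed.

Lemma chart_curv_continuous O xs nus gs (rs : R) : bdry_chart O xs nus gs rs ->
  forall e : R, 0 < e -> exists2 rho : R, 0 < rho &
    forall y, enorm y < rho -> `|chart_curv nus gs y - chart_curv nus gs 0| <= e.
Proof.
move=> H e e0.
have [[rs0 un] _ _ [[_ cC] _] _] := H.
have z0 : [set y : V | enorm y < rs] 0 by rewrite /= enorm0.
have N0 : enorm (nus - grad gs 0) != 0.
  by rewrite gt_eqF// (lt_le_trans ltr01)// (chart_gradnorm_ge1 H).
have cp i : continuous_at (0 : V) (fun y : V => (nus - grad gs y) ord0 i).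
  have -> : (fun y => (nus - grad gs y) ord0 i) = (fun y => nus ord0 i - pd [:: i] gs y).
    by apply/funext => y; rewrite !mxE.
  exact: (cvgB (@cst_continuous _ _ _ _) (cC [:: i] isT _ z0)).
have cN : continuous_at (0 : V) (fun y : V => enorm (nus - grad gs y)).
  apply: (@continuous_comp _ _ _ (fun y => dotr (nus - grad gs y) (nus - grad gs y)) (@Num.sqrt R)); last exact: sqrt_continuous.
  by apply: continuous_at_sum => i; exact: (cvgM (cp i) (cp i)).
have cNi : continuous_at (0 : V) (fun y : V => (enorm (nus - grad gs y))^-1) by exact: (cvgV N0 cN).
have cn i : continuous_at (0 : V) (fun y : V => chart_normal nus gs y ord0 i).
  have -> : (fun y => chart_normal nus gs y ord0 i) = (fun y => (enorm (nus - grad gs y))^-1 * (nus - grad gs y) ord0 i).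
    by apply/funext => y; rewrite mxE.
  exact: (cvgM cNi (cp i)).
have cP i j : continuous_at (0 : V) (fun y : V => orth_proj (chart_normal nus gs y) i j).
  have -> : (fun y => orth_proj (chart_normal nus gs y) i j) =
      (fun y => (1%:M : 'M[R]_n) i j - chart_normal nus gs y ord0 i * chart_normal nus gs y ord0 j).
    by apply/funext => y; rewrite [LHS]mxE; congr (_ + _); rewrite [LHS]mxE [X in - X]mxE big_ord1 mxE.
  exact: (cvgB (@cst_continuous _ _ _ _) (cvgM (cn i) (cn j))).
have cA i j : continuous_at (0 : V) (fun y : V => chart_curv nus gs y i j).
  have -> : (fun y : V => chart_curv nus gs y i j) = (fun y => \sum_k (\sum_l
      orth_proj (chart_normal nus gs y) i l * ((enorm (nus - grad gs y))^-1 * pd [:: l; k] gs y)) *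
      orth_proj (chart_normal nus gs y) k j).
    apply/funext => y; rewrite [LHS]mxE; apply: eq_bigr => k _; congr (_ * _).
    by rewrite mxE; apply: eq_bigr => l _; congr (_ * _); rewrite !mxE.
  apply: continuous_at_sum => k.
  apply: continuous_atM; last exact: cP.
  apply: continuous_at_sum => l.
  exact: (cvgM (cP i l) (cvgM cNi (cC [:: l; k] isT _ z0))).
have /choice[r hr] : forall ij : 'I_n * 'I_n, exists r : R, 0 < r /\
    forall y, enorm y < r -> `|chart_curv nus gs y ij.1 ij.2 - chart_curv nus gs 0 ij.1 ij.2| < e.
  move=> [i j]; have [r r0 h] := (continuous_enormP _ _).1 (cA i j) _ e0.
  by exists r; split=> // y yr; apply: h; rewrite subr0.
exists (\big[Num.min/1]_ij r ij).
  by apply: lt_bigmin => // ij _; case: (hr ij).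
move=> y yr; apply: mx_norm_le => [|i j]; first exact: ltW.
have yij : enorm y < r (i, j) by apply: lt_le_trans yr _; exact: bigmin_le_cond.
by have [_ /(_ y yij)/ltW] := hr (i, j); rewrite [X in _ -> `|X| <= _]mxE [in X in _ -> `|_ + X| <= _]mxE.
Qed.

Lemma chart_osculating O xs nus gs rs : open O -> bdry O xs -> bdry_chart O xs nus gs rs ->
  osculating O xs nus (hess gs 0).
Proof.
move=> Oo bx H eta eta0; have [r r0 h] := chart_osculates H eta0 Oo; exists r => //.
have rs0 : 0 < rs by case: H => -[].
have := h 0; rewrite addr0 enorm0 divr_gt0// (chart_normal0 H) (chart_curv0 H).
by apply.
Qed.

(** Two unrelated charts describe the same domain near xs + y, hence have the same contact data
    there. A statement about all charts at all nearby points is thereby reduced to one fixed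
    chart. *)
Lemma chart_transfer O xs nus gs rs y nu g r : open O -> bdry_chart O xs nus gs rs ->
  enorm y < rs / 2 -> bdry O (xs + y) -> bdry_chart O (xs + y) nu g r ->
  nu = chart_normal nus gs y /\ hess g 0 = chart_curv nus gs y.
Proof.
move=> Oo H yr by_ H'.
have rs0 : 0 < rs by case: H => -[].
have yr' : enorm y < rs by apply: lt_trans yr _; rewrite ltr_pdivrMr// mulr_natr mulr2n ltrDl.
have r0 : 0 < r by case: H' => -[].
have z0 : enorm (0 : V) < r by rewrite enorm0.
apply: (@osculates_unique _ _ O (xs + y)).
- by case: H' => -[].
- exact: (chart_normal_unit H yr').
- exact: (chart_hess_sym H' z0).
- exact: (chart_curv_sym H yr').
- exact: (chart_hess_normal H' z0).
- exact: (chart_curv_normal H yr').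
- exact: chart_osculating H'.
- by move=> eta eta0; have [q q0 h] := chart_osculates H eta0 Oo; exists q => //; exact: h.
Qed.

(** Compactness in near-covering form, with the radius running along [0^'+]: monotonicity of Q in
    the radius plays the part of taking the minimum over a finite subcover. *)
Lemma compact_uniform (K : set V) (Q : R -> V -> Prop) : compact K ->
  (forall r s y, 0 < r -> r <= s -> Q s y -> Q r y) ->
  (forall x, K x -> exists2 rho : R, 0 < rho & exists2 r : R, 0 < r &
     forall y, K y -> enorm (y - x) < rho -> Q r y) ->
  exists2 r : R, 0 < r & forall y, K y -> Q r y.
Proof.
move=> /compact_near_coveringP cK mono loc.
have := cK R (0^'+) (fun r y => K y -> Q r y) _.
case.
  move=> x Kx; have [rho rho0 [r r0 h]] := loc _ Kx.
  exists ([set y | enorm (y - x) < rho], [set s | 0 < s <= r]) => /=.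
    split; first by apply/nbhs_enormP; exists rho.
    exists r => //= s; rewrite /ball /= sub0r normrN => sr s0.
    by rewrite s0 ltW// (le_lt_trans (ler_norm _)).
  move=> [y s] /= [yx /andP[s0 sr]] Ky.
  exact: mono sr (h _ Ky yx).
move=> d /= d0 h; exists (d / 2); first by rewrite divr_gt0.
move=> y Ky; apply: (h (d / 2)) => //; last by rewrite divr_gt0.
by rewrite /ball /= sub0r normrN gtr0_norm ?divr_gt0// ltr_pdivrMr// mulr_natr mulr2n ltrDl.
Qed.

End CurvatureContinuity.

(** * The distance to the boundary *)

Section BoundaryDistance.
Variables (R : realType) (n : nat).
Local Notation V := 'rV[R]_n.
Implicit Types (x y z nu : V) (g : V -> R).

(** The exit point is at the supremum T of the parameters up to which the segment stays in O. It is
    not in O: openness would push T further if T < 1, and T = 1 would put z into O. Points just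
    before T show that it is in the closure. *)
Lemma segment_meets_bdry (O : set V) y z : open O -> O y -> ~ O z ->
  exists2 t : R, 0 <= t <= 1 & bdry O (y + t *: (z - y)).
Proof.
move=> Oo Oy nOz.
have pE t s : enorm (y + s *: (z - y) - (y + t *: (z - y))) = `|s - t| * enorm (z - y).
  by rewrite opprD addrACA subrr add0r -scalerBl enormZ.
pose S := [set t : R | 0 <= t <= 1 /\ forall s, 0 <= s <= t -> O (y + s *: (z - y))].
have S0 : S 0.
  split; first by rewrite lexx ler01.
  by move=> s /le_anti <-; rewrite scale0r addr0.
have Sub : has_sup S.
  by split; [exists 0|exists 1 => t [/andP[]]].
pose T := sup S.
have T0 : 0 <= T by apply: ub_le_sup => //; case: Sub.
have T1 : T <= 1 by apply: ge_sup; [exists 0|move=> t [/andP[]]].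
have below s : 0 <= s -> s < T -> O (y + s *: (z - y)).
  move=> s0 sT; have [t [t01 ht] st] := sup_gt (ex_intro _ 0 S0) sT.
  by apply: ht; rewrite s0 ltW.
have D0 : 0 < enorm (z - y) + 1 by rewrite ltr_wpDl// enorm_ge0.
exists T; rewrite ?T0//; apply/(bdryP _ Oo).
have nOT : ~ O (y + T *: (z - y)).
  move=> OT; have [r r0 hr] := (open_enormP _).1 Oo _ OT.
  pose e := r / (enorm (z - y) + 1).
  have e0 : 0 < e by rewrite divr_gt0.
  have near s : `|s - T| < e -> O (y + s *: (z - y)).
    move=> sT; apply: hr; rewrite pE.
    apply: (@le_lt_trans _ _ (`|s - T| * (enorm (z - y) + 1))).
      by rewrite ler_wpM2l// lerDl.
    by rewrite -ltr_pdivlMr.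
  have [T1'|T1'] := ltP T 1; last first.
    have T1E : T = 1 by apply/eqP; rewrite eq_le T1.
    by apply: nOz; move: OT; rewrite T1E scale1r addrC subrK.
  pose U := Num.min 1 (T + e / 2).
  have TU : T < U by rewrite lt_min T1' ltrDl divr_gt0.
  have UT : U <= T + e / 2 by rewrite ge_min lexx orbT.
  suff : S U by move/(ub_le_sup Sub.2); rewrite leNgt -/T TU.
  split; first by rewrite (le_trans T0 (ltW TU))/= ge_min lexx.
  move=> s /andP[s0 sU]; have [/below|Ts] := ltP s T; first exact.
  apply: near; rewrite ger0_norm ?subr_ge0//.
  apply: (@le_lt_trans _ _ (e / 2)).
    by rewrite lerBlDl (le_trans sU).
  by rewrite ltr_pdivrMr// mulr_natr mulr2n ltrDl.
split=> // e e0; have [T0'|T0'] := eqVneq T 0.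
  by exfalso; apply: nOT; rewrite T0' scale0r addr0.
have Tp : 0 < T by rewrite lt_def T0'.
pose s := Num.max 0 (T - e / (enorm (z - y) + 1)).
have sT : s < T by rewrite gt_max Tp ltrBlDr ltrDl divr_gt0.
exists (y + s *: (z - y)); first by apply: below => //; rewrite le_max lexx.
rewrite pE distrC ger0_norm ?subr_ge0 ?ltW//.
apply: (@lt_le_trans _ _ ((T - s) * (enorm (z - y) + 1))).
  by rewrite ltr_pM2l ?subr_gt0// ltrDl.
rewrite -ler_pdivlMr// lerBlDl -lerBlDr.
by rewrite /s le_max lexx orbT.
Qed.

Lemma ler_between (a b c : R) : c <= b + a -> b <= c + a -> (- a <= b - c) && (b - c <= a).
Proof. by move=> h1 h2; apply/andP; split; lra. Qed.

Variable O : set V.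
Hypothesis HO : bounded_domain O.

Let Oo : open O. Proof. by case: HO. Qed.

Lemma bdry_compact : compact (bdry O).
Proof.
apply: bounded_closed_compact.
  have [_ _ _ [K OK]] := HO.
  exists (K + 1); split; first exact: num_real.
  move=> M KM x /(bdryP _ Oo)[_ cl]; have [y Oy yx] := cl 1 ltr01.
  apply: le_trans (mx_norm_le_enorm _) _; apply: le_trans (ltW KM).
  rewrite -(subrK y x); apply: le_trans (enormD _ _) _.
  by rewrite addrC lerD ?OK// enormC ltW.
rewrite /bdry setDE; apply: closedI; first exact: closed_closure.
apply: open_closedC; exact: open_interior.
Qed.

Lemma bdry_neq0 : (0 < n)%N -> bdry O !=set0.
Proof.
move=> n0; have [_ _ [x Ox] [K OK]] := HO.
have nO : ~ O ((K + 1) *: evec R (Ordinal n0)).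
  move=> /OK; rewrite enormZ enorm_evec mulr1 => h.
  have := ler_norm (K + 1); move/le_trans/(_ h).
  by rewrite leNgt ltrDl ltr01.
by have [t _ bt] := segment_meets_bdry Oo Ox nO; exists (x + t *: ((K + 1) *: evec R (Ordinal n0) - x)).
Qed.

Lemma dist_bd_le x y : bdry O y -> dist_bd O x <= enorm (x - y).
Proof.
move=> by_; apply: ge_inf; last by exists y.
by exists 0 => _ [z _ <-]; exact: enorm_ge0.
Qed.

Hypothesis n0 : (0 < n)%N.

Lemma dist_bd_attained x : exists2 y, bdry O y & dist_bd O x = enorm (x - y).
Proof.
have [|y yb ymin] := @EVT_min_rV R n (fun y => enorm (x - y)) (bdry O) (bdry_neq0 n0) bdry_compact.
  apply: continuous_subspaceT => y; apply/continuous_enormP => e e0; exists e => // w wy.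
  apply: le_lt_trans wy; rewrite ler_norml.
  have h1 := enormB_triangle w x y; have h2 := enormB_triangle y x w.
  by apply: ler_between => //; rewrite (enormC w).
exists y; first by rewrite inE in yb.
apply/eqP; rewrite eq_le dist_bd_le ?andbT//=; last by rewrite inE in yb.
apply: lb_le_inf.
  by have [w wb] := bdry_neq0 n0; exists (enorm (x - w)); exists w.
by move=> _ [w wb <-]; apply: ymin; rewrite inE.
Qed.

Lemma dist_bd_lip x y : dist_bd O x <= dist_bd O y + enorm (x - y).
Proof.
have [w wb ->] := dist_bd_attained y.
apply: le_trans (dist_bd_le x wb) _; rewrite [leRHS]addrC; exact: enormB_triangle.
Qed.

Lemma dist_bd_gt0 x : O x -> 0 < dist_bd O x.
Proof.
move=> Ox; have [y /(bdryP _ Oo)[nOy _] ->] := dist_bd_attained x.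
by apply: enorm_gt0; rewrite subr_eq0; apply: contra_notN nOy => /eqP <-.
Qed.

Lemma dist_bd_ball x y : O x -> enorm (y - x) < dist_bd O x -> O y.
Proof.
move=> Ox yx; apply: contrapT => nOy.
have [t /andP[t0 t1] bt] := segment_meets_bdry Oo Ox nOy.
have := dist_bd_le x bt; rewrite opprD addrA subrr add0r.
rewrite enormN enormZ ger0_norm// leNgt => /negP; apply.
by apply: le_lt_trans yx; rewrite ler_piMl// enorm_ge0.
Qed.

Lemma dist_bd_outside x y : O x -> ~ O y -> dist_bd O x <= enorm (y - x).
Proof. by move=> Ox nOy; rewrite leNgt; apply/negP => h; apply: nOy; exact: dist_bd_ball h. Qed.

Lemma dist_bd_continuous x : {for x, continuous (dist_bd O)}.
Proof.
apply/continuous_enormP => e e0; exists e => // y yx; apply: le_lt_trans yx.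
rewrite ler_norml; apply: ler_between; last exact: dist_bd_lip.
by rewrite enormC dist_bd_lip.
Qed.

Lemma enorm_lincomb_sqr (w e : V) (t d : R) : enorm (t *: w - d *: e) ^+ 2 =
  t ^+ 2 * enorm w ^+ 2 - 2 * t * d * dotr w e + d ^+ 2 * enorm e ^+ 2.
Proof.
rewrite -!dotr_sqr !(dotrBl, dotrBr, dotrZl, dotrZr) (dotrC e w); ring.
Qed.

Lemma chord_arith (t c d : R) : 0 < t -> 0 < c -> t < d ->
  t ^+ 2 * (2 * c) - 2 * t * d * c + d ^+ 2 * 1 < d ^+ 2.
Proof. by move=> t0 c0 td; have := mulr_gt0 t0 c0; nra. Qed.

(** The ball around x that reaches xb lies in O. If its radial direction e differed from nu, the
    points xb + t (e - nu) would be in that ball for small t, while their slope -c against nu puts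
    them outside O by contact at xb. *)
Lemma nearest_point_normal x xb nu g r : O x -> bdry O xb -> dist_bd O x = enorm (x - xb) ->
  bdry_chart O xb nu g r -> x = xb + dist_bd O x *: nu.
Proof.
move=> Ox bx dx H; set d := dist_bd O x in dx *.
have d0 : 0 < d by exact: dist_bd_gt0.
have nu1 : enorm nu = 1 by case: H => -[].
apply/eqP; apply: contraT => ne.
pose e := d^-1 *: (x - xb).
have e1 : enorm e = 1 by rewrite enormZ gtr0_norm ?invr_gt0// -dx mulVf// gt_eqF.
have xE : x - xb = d *: e by rewrite scalerA mulfV ?scale1r// gt_eqF.
have ene : e != nu.
  by apply: contra ne => /eqP <-; rewrite -xE addrC subrK.
pose w := e - nu; pose c := 1 - dotr e nu.
have w0 : 0 < enorm w by apply: enorm_gt0; rewrite subr_eq0.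
have ww : enorm w ^+ 2 = 2 * c by rewrite enorm_sub_sqr// /c; ring.
have c0 : 0 < c by rewrite -(pmulr_rgt0 _ (ltr0n R 2)) -ww exprn_gt0.
have wnu : dotr w nu = - c by rewrite dotrBl dotr_sqr nu1 expr1n opprB.
have we : dotr w e = c by rewrite dotrBl dotr_sqr e1 expr1n (dotrC nu).
have e4 : 0 < 4^-1 :> R by rewrite invr_gt0.
have [r1 r10 o1] := chart_osculating Oo bx H e4.
pose q := qform (hess g 0) w.
pose W := enorm w ^+ 2 + `|q| + `|q|.
have w2 : 0 < enorm w ^+ 2 by rewrite exprn_gt0.
have W0 : 0 < W by rewrite /W -addrA ltr_pwDl// addr_ge0.
have [t [t0 tW tr td]] : exists t : R, [/\ 0 < t, t * W < c, t * enorm w < r1 & t < d].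
  pose m := Num.min (c / W) (Num.min (r1 / enorm w) d).
  have m0 : 0 < m by rewrite !lt_min !divr_gt0.
  have : m / 2 < m by rewrite ltr_pdivrMr// mulr_natr mulr2n ltrDl.
  rewrite {2}/m !lt_min => /andP[h1 /andP[h2 h3]]; exists (m / 2).
  by split=> //; [exact: divr_gt0|rewrite -ltr_pdivlMr|rewrite -ltr_pdivlMr].
have tw : enorm (t *: w) = t * enorm w by rewrite enormZ gtr0_norm.
have tzr : enorm (t *: w) < r1 by rewrite tw.
have Otw : O (xb + t *: w).
  apply: dist_bd_ball Ox _; rewrite -/d.
  have -> : xb + t *: w - x = t *: w - d *: e by rewrite -xE opprB addrA [xb + _]addrC.
  rewrite -(@ltr_pXn2r _ 2)// ?nnegrE ?enorm_ge0 ?ltW//.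
  rewrite enorm_lincomb_sqr we e1 ww expr1n; exact: chord_arith.
have [_ /(_ Otw)] := o1 _ tzr; rewrite tw dotrZl wnu qformZ mulrN normrN exprMn.
rewrite gtr0_norm ?mulr_gt0// -/q ltNge => /negP[].
by have [_] := osc_slope_arith c0 w2 t0 tW.
Qed.

End BoundaryDistance.

(** * Uniformity over the boundary by compactness *)

Lemma half_margin (R : realFieldType) (a b c : R) : c <= b -> - (c / 2) <= a - b -> c / 2 <= a.
Proof. by move=> *; lra. Qed.

Lemma half_ratio_bound (R : realFieldType) (K c : R) : 0 <= K -> 0 < c ->
  K * (c / (2 * (K + 1))) <= c / 2.
Proof.
move=> K0 c0; rewrite mulrA ler_pdivrMr ?mulr_gt0 ?ltr_wpDl//.
have -> : c / 2 * (2 * (K + 1)) = K * c + c by field.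
by rewrite lerDl ltW.
Qed.

Section UniformCharts.
Variables (R : realType) (n : nat).
Local Notation V := 'rV[R]_n.
Variable O : set V.
Hypotheses (HO : bounded_domain O) (Hbd : C31_boundary O).

Let Oo : open O. Proof. by case: HO. Qed.

(** It suffices to check Q on the contact data which a chart around each boundary point assigns to
    its neighbours; [chart_transfer] passes to arbitrary charts there, and compactness to the whole
    boundary. *)
Lemma charts_uniform (Q : R -> V -> V -> 'M[R]_n -> Prop) :
  (forall r s y nu A, 0 < r -> r <= s -> Q s y nu A -> Q r y nu A) ->
  (forall xs nus gs rs, bdry O xs -> bdry_chart O xs nus gs rs ->
    exists2 rho : R, 0 < rho & exists2 r : R, 0 < r & forall y, enorm y < rho -> enorm y < rs / 2 ->
      bdry O (xs + y) -> Q r (xs + y) (chart_normal nus gs y) (chart_curv nus gs y)) ->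
  exists2 r : R, 0 < r & forall xb nu g r', bdry O xb -> bdry_chart O xb nu g r' ->
    Q r xb nu (hess g 0).
Proof.
move=> mono loc.
have [||r r0 h] := @compact_uniform R n (bdry O)
  (fun r y => forall nu g r', bdry_chart O y nu g r' -> Q r y nu (hess g 0)) (bdry_compact HO).
- by move=> r s y r0 rs h nu g r' H; apply: mono r0 rs _; exact: h H.
- move=> xs bx; have [nus [gs [rs H]]] := Hbd bx.
  have [rho rho0 [r r0 h]] := loc _ _ _ _ bx H.
  have rs0 : 0 < rs by case: H => -[].
  exists (Num.min rho (rs / 2)); first by rewrite lt_min rho0 divr_gt0.
  exists r => // y by_; rewrite lt_min => /andP[y1 y2] nu g r' H'.
  have yE : xs + (y - xs) = y by rewrite addrC subrK.
  have := h _ y1 y2; rewrite yE => /(_ by_).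
  have := @chart_transfer _ _ O xs nus gs rs (y - xs) nu g r' Oo H y2.
  by rewrite yE => /(_ by_ H')[-> ->].
by exists r => // xb nu g r' bx; exact: h.
Qed.

Lemma uniform_osculates (eta : R) : 0 < eta ->
  exists2 r : R, 0 < r & forall xb nu g r', bdry O xb -> bdry_chart O xb nu g r' ->
    osculates O xb nu (hess g 0) eta r.
Proof.
move=> eta0; apply: (charts_uniform (Q := fun r y nu A => osculates O y nu A eta r)).
  by move=> r s y nu A r0 rs h z zr; apply: h; exact: lt_le_trans rs.
move=> xs nus gs rs bx H.
have [r r0 h] := chart_osculates H eta0 Oo.
by exists 1 => //; exists r => // y _ y2 by_; exact: h.
Qed.

Lemma uniform_hess_bound : exists2 C : R, 0 < C &
  forall xb nu g r', bdry O xb -> bdry_chart O xb nu g r' -> `|hess g 0| <= C.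
Proof.
(* Writing the bound as the inverse of r makes the property inherited by smaller r. *)
have [||r r0 h] := charts_uniform (Q := fun r y nu A => `|A| <= r^-1).
- by move=> r s y nu A r0 rs /le_trans; apply; rewrite lef_pV2// posrE (lt_le_trans r0).
- move=> xs nus gs rs bx H.
  have [rho rho0 h] := chart_curv_continuous H (@ltr01 R).
  exists rho => //; exists (`|chart_curv nus gs 0| + 1)^-1.
    by rewrite invr_gt0 ltr_wpDl.
  move=> y y1 _ _; rewrite invrK -lerBlDl; apply: le_trans (h _ y1).
  exact: lerB_dist.
by exists r^-1; rewrite ?invr_gt0.
Qed.

Variable k : nat.
Hypotheses (kn : (k <= n)%N) (Hconv : strictly_convex_k k O).

Lemma curv_sigma_esym xb nu g r j : bdry_chart O xb nu g r -> (j <= n)%N ->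
  curv_sigma j g = esym_mx j (hess g 0).
Proof.
move=> H jn; apply: Sk_esym => //; apply: (chart_hess_sym H).
by rewrite enorm0; case: H => -[].
Qed.

Lemma chart_esym_gt0 xb nu g r j : bdry O xb -> bdry_chart O xb nu g r -> (j <= k)%N ->
  0 < esym_mx j (hess g 0).
Proof.
move=> bx H jk; case: j jk => [_|j jk]; first by rewrite esym_mx0.
by rewrite -(curv_sigma_esym H) ?(leq_trans jk)//; apply: Hconv bx H _ _.
Qed.

Lemma uniform_esym_gt0 : exists2 c : R, 0 < c &
  forall xb nu g r', bdry O xb -> bdry_chart O xb nu g r' ->
  forall j, (j <= k)%N -> c <= esym_mx j (hess g 0).
Proof.
(* The radius variable itself serves as the lower bound. Near a chart centre the values stay within
   c/2 of those at the centre, where c is at most their minimum. *)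
have [||r r0 h] := charts_uniform (Q := fun r y nu A => forall j, (j <= k)%N -> r <= esym_mx j A).
- by move=> r s y nu A r0 rs h j /h; exact: le_trans.
- move=> xs nus gs rs bx H.
  have [K K0 hK] := @loc_lip_esym_unif R n (`|hess gs 0| + 1).
  pose c := \big[Num.min/1]_(j < k.+1) esym_mx j (hess gs 0).
  have c0 : 0 < c.
    by apply: lt_bigmin => // j _; apply: (chart_esym_gt0 bx H); rewrite -ltnS.
  have e0 : 0 < Num.min 1 (c / (2 * (K + 1))).
    by rewrite lt_min ltr01 divr_gt0// mulr_gt0// ltr_wpDl.
  have [rho rho0 h] := chart_curv_continuous H e0.
  exists rho => //; exists (c / 2); first by rewrite divr_gt0.
  move=> y y1 _ _ j jk.
  have := h _ y1; rewrite (chart_curv0 H) le_min => /andP[a1 a2].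
  have An : `|chart_curv nus gs y| <= `|hess gs 0| + 1.
    by rewrite -lerBlDl; apply: le_trans a1; exact: lerB_dist.
  have [_] := hK j (leq_trans jk kn) _ _ An (ler_wpDr ler01 (lexx _)).
  have cj : c <= esym_mx j (hess gs 0) 
    by rewrite -[j]/(nat_of_ord (Ordinal (jk : (j < k.+1)%N))); exact: bigmin_le_cond.
  have : K * `|chart_curv nus gs y - hess gs 0| <= c / 2.
    apply: le_trans (ler_wpM2l K0 a2) _.
    exact: half_ratio_bound.
  move=> a3 /le_trans/(_ a3); rewrite ler_norml => /andP[a4 _].
  exact: half_margin cj a4.
by exists r.
Qed.

End UniformCharts.

(** * The profile phi (xi M (t)) *)

Section MonotonePrimitive.
Variables (R : realType) (g : R -> R) (T : R).
Hypotheses (g_pos : forall t : R, 0 < t < T -> 0 < g t)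
  (g_mono : forall s t : R, 0 < s -> s <= t -> t < T -> g s <= g t)
  (g_cont : forall t : R, 0 < t < T -> {for t, continuous g}).
Local Notation mu := (@lebesgue_measure R).

Let prim (t : R) := fine (\int[mu]_(s in `]0%R, t]) (g s)%:E)%E.

Lemma primitive_measurable (t : R) : t < T -> measurable_fun `]0, t] g.
Proof.
move=> tT; apply: (@measurable_funS _ _ _ _ `]0, T[) => //.
  by move=> s /=; rewrite !in_itv /= => /andP[-> /le_lt_trans]; apply.
apply: measurable_realfun.open_continuous_measurable_fun => //.
by move=> s; rewrite inE /= in_itv /= => /g_cont.
Qed.

(** A positive nondecreasing g is bounded by g t on ]0, t], which settles the endpoint 0. *)
Lemma primitive_integrable (t : R) : t < T -> mu.-integrable `]0, t] (EFin \o g).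
Proof.
move=> tT; apply: measurable_bounded_integrable => //.
- by rewrite /= lebesgue_measure_itv /=; case: ifP => _; rewrite ?ltry.
- exact: primitive_measurable.
- exists (g t); split; first exact: num_real.
  move=> M gM s /=; rewrite in_itv /= => /andP[s0 st].
  rewrite ger0_norm; first by apply: le_trans (ltW gM); exact: g_mono.
  by rewrite ltW// g_pos// s0 (le_lt_trans st).
Qed.

Lemma primitive_derive (t : R) : 0 < t < T -> is_derive t 1 prim (g t).
Proof.
move=> /andP[t0 tT]; pose u := (t + T) / 2.
have tu : t < u by rewrite /u midf_lt.
have uT : u < T by rewrite /u midf_lt.
have [|||d1 d2] := @continuous_FTC1 R g (BRight 0) t u tu.
- exact: primitive_integrable.
- by rewrite lte_fin.
- by apply: g_cont; rewrite t0.
apply: DeriveDef; first exact: d1.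
by rewrite -derive1E; exact: d2.
Qed.

(** Applied to m, the upper bound becomes m/M >= 1/t, the source of the blow-up of h''/|h'|. *)
Lemma primitive_bounds (t : R) : 0 < t < T -> 0 < prim t <= t * g t.
Proof.
have ge0 s : s < T -> 0 <= prim s.
  move=> sT; apply: fine_ge0; apply: integral_ge0 => x /=; rewrite in_itv /= => /andP[x0 xs].
  by rewrite lee_fin ltW// g_pos// x0 (le_lt_trans xs).
move=> /andP[t0 tT]; apply/andP; split.
  have t2 : 0 < t / 2 by rewrite divr_gt0.
  have t2t : t / 2 < t by rewrite ltr_pdivrMr// mulr_natr mulr2n ltrDl.
  have [|c /andP[c0 ct]] := @MVT_closed R prim g (t / 2) t (ltW t2t).
    move=> c /andP[c0 ct]; apply: primitive_derive.
    by rewrite (lt_le_trans t2)//= (le_lt_trans ct).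
  move/(canRL (subrK _)) => ->; apply: ltr_pwDl; last exact: ge0 (lt_trans t2t tT).
  rewrite mulr_gt0 ?subr_gt0// g_pos// (lt_le_trans t2)//=; exact: le_lt_trans tT.
have -> : t * g t = fine (\int[mu]_(s in `]0%R, t]) (cst (g t)%:E) s)%E.
  rewrite integral_cst//= lebesgue_measure_itv /= lte_fin t0 -EFinB /=.
  by rewrite subr0 mulrC.
apply: fine_le.
- exact: integrable_fin_num (primitive_integrable tT).
- by rewrite integral_cst//= lebesgue_measure_itv /= lte_fin t0.
apply: ge0_le_integral => //.
- move=> x /=; rewrite in_itv /= => /andP[x0 xs].
  by rewrite lee_fin ltW// g_pos// x0 (le_lt_trans xs).
- by apply/measurable_realfun.measurable_EFinP; exact: primitive_measurable.
- by move=> x /=; rewrite in_itv /= => /andP[x0 xs]; rewrite lee_fin g_mono.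
Qed.

End MonotonePrimitive.

(** * Calculus of H, Phi, phi and of the profile *)

Lemma EFin_shift_eq0 (R : realType) (l p : R) : (p%:E = (- l)%:E - (- p)%:E)%E -> l = 0.
Proof.
rewrite -EFinB opprK => -[/eqP].
by rewrite -subr_eq subrr eq_sym oppr_eq0 => /eqP.
Qed.

Section ProfileOde.
Variables (R : realType) (k : nat) (f : R -> R).
Hypotheses (f1_pos : forall s : R, 0 < s -> 0 < f s)
  (f1_mono : forall s t : R, 0 < s -> s <= t -> f s <= f t)
  (f1_C1 : forall s : R, 0 < s -> derivable f s 1 /\ {for s, continuous (derive1 f)})
  (f2 : forall s : R, 0 < s -> (Phi_int k f s < +oo)%E).
Local Notation mu := (@lebesgue_measure R).
Local Notation H := (Hfun k f).
Local Notation phi := (varphi k f).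

Lemma f_continuous (s : R) : 0 < s -> {for s, continuous f}.
Proof. by move=> /f1_C1[/derivable1_diffP/differentiable_continuous]. Qed.

Lemma Fint_derive (s : R) : 0 < s -> is_derive s 1 (Fint f) (f s).
Proof.
move=> s0; apply: (@primitive_derive R f (s + 1)).
- by move=> t /andP[t0 _]; exact: f1_pos.
- by move=> a b a0 ab _; exact: f1_mono.
- by move=> t /andP[t0 _]; exact: f_continuous.
- by rewrite s0 ltrDl ltr01.
Qed.

Lemma Fint_gt0 (s : R) : 0 < s -> 0 < Fint f s.
Proof.
move=> s0; suff /andP[] : 0 < Fint f s <= s * f s by [].
apply: (@primitive_bounds R f (s + 1)).
- by move=> t /andP[t0 _]; exact: f1_pos.
- by move=> a b a0 ab _; exact: f1_mono.
- by move=> t /andP[t0 _]; exact: f_continuous.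
- by rewrite s0 ltrDl ltr01.
Qed.

Let K0 : 0 < k.+1%:R :> R. Proof. by rewrite ltr0n. Qed.

Lemma Hfun_gt0 (s : R) : 0 < s -> 0 < H s.
Proof. by move=> s0; rewrite powR_gt0// mulr_gt0// Fint_gt0. Qed.

Lemma Hfun_pow (s : R) : 0 < s -> H s ^+ k.+1 = k.+1%:R * Fint f s.
Proof.
move=> s0; rewrite -powR_mulrn ?ltW ?Hfun_gt0// -powRrM mulVf ?gt_eqF//.
by rewrite powRr1// ltW// mulr_gt0// Fint_gt0.
Qed.

(** This is H^(k+1) = (k+1) F differentiated; it later trades powers of h' for f(h). *)
Lemma Hfun_derive (s : R) : 0 < s -> is_derive s 1 H (f s / H s ^+ k).
Proof.
move=> s0; have Hp := Hfun_gt0 s0.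
have KF0 : 0 < k.+1%:R * Fint f s by rewrite mulr_gt0// Fint_gt0.
have d1 : is_derive s 1 (fun t => k.+1%:R * Fint f t) (k.+1%:R * f s).
  exact: (is_deriveZ k.+1%:R (Fint_derive s0)).
have := @is_derive1_comp R (@powR R ^~ (k.+1%:R)^-1) (fun t => k.+1%:R * Fint f t) s _ _
  (is_derive1_powR (k.+1%:R)^-1 KF0) d1.
have -> : (k.+1%:R)^-1 * (k.+1%:R * Fint f s) `^ ((k.+1%:R)^-1 - 1) * (k.+1%:R * f s) =
    f s / H s ^+ k; last by [].
rewrite powRB; last by rewrite (gt_eqF KF0) implybT.
rewrite powRr1 ?ltW// -Hfun_pow// -/(H s).
have Hn : H s != 0 by rewrite gt_eqF.
have -> : (H s ^+ k.+1) `^ (k.+1%:R)^-1 = H s.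
  by rewrite -powR_mulrn ?ltW// -powRrM mulfV ?gt_eqF// powRr1// ltW.
rewrite exprS; field.
by rewrite expf_neq0 // Hn gt_eqF.
Qed.

Lemma Hfun_derive1 (s : R) : 0 < s -> derive1 H s = f s / H s ^+ k.
Proof. by move=> /Hfun_derive[_ <-]; rewrite derive1E. Qed.

Lemma derivable_cont (h : R -> R) (s D : R) : is_derive s 1 h D -> {for s, continuous h}.
Proof. by case=> /derivable1_diffP/differentiable_continuous. Qed.

Lemma Hfun_continuous (s : R) : 0 < s -> {for s, continuous H}.
Proof. by move=> /Hfun_derive/derivable_cont. Qed.

Lemma Hinv_measurable (a : R) : 0 < a -> measurable_fun `[a, +oo[ (fun t => (H t)^-1).
Proof.
move=> a0; apply: (@measurable_funS _ _ _ _ `]0 : R, +oo[) => //.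
  by move=> s /=; rewrite !in_itv /= !andbT; exact: lt_le_trans.
apply: measurable_realfun.open_continuous_measurable_fun => //.
move=> s; rewrite inE /= in_itv /= andbT => s0.
by apply: cvgV; [rewrite gt_eqF// Hfun_gt0|exact: Hfun_continuous].
Qed.

Lemma Hinv_integrable (a : R) : 0 < a -> mu.-integrable `[a, +oo[ (EFin \o (fun t => (H t)^-1)).
Proof.
move=> a0; apply/integrableP; split; first by apply/measurable_realfun.measurable_EFinP; exact: Hinv_measurable.
apply: le_lt_trans (f2 a0).
rewrite le_eqVlt; apply/orP; left; apply/eqP; apply: eq_integral => t.
rewrite inE /= in_itv /= andbT => at_ /=; rewrite ger0_norm// invr_ge0 ltW// Hfun_gt0//.
exact: lt_le_trans at_.
Qed.

Lemma Phi_split (a x : R) : 0 < a -> a < x ->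
  Phi k f a = \int[mu]_(t in `[a, x]) (H t)^-1 + Phi k f x.
Proof.
move=> a0 ax; have x0 := lt_trans a0 ax.
have fin y : 0 < y -> Phi_int k f y \is a fin_num.
  by move=> y0; apply: integrable_fin_num (Hinv_integrable y0).
rewrite /Phi.
have S : `[a, +oo[%classic = `[a, x[%classic `|` `[x, +oo[%classic :> set R.
  apply/seteqP; split=> t /=; rewrite !in_itv /= !andbT; last first.
    by case=> [/andP[]//|]; exact: le_trans (ltW ax).
  by move=> at_; have [tx|tx] := ltP t x; [left; rewrite at_|right].
rewrite {1}/Phi_int S.
have /measurable_int := Hinv_integrable a0; rewrite S => mS.
rewrite ge0_integral_setU//=; last 2 first.
- move=> t th; rewrite lee_fin invr_ge0 ltW// Hfun_gt0//; move: th.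
  case=> /=; rewrite !in_itv /= ?andbT; first by case/andP=> /(lt_le_trans a0).
  exact: lt_le_trans.
- apply/disj_setPS => t /= [] ; rewrite !in_itv /= andbT => /andP[_ h1] h2.
  by move: h1; rewrite ltNge h2.
have int : mu.-integrable `[a, x] (EFin \o (fun t => (H t)^-1)).
  apply: (integrableS _ _ _ (Hinv_integrable a0)) => //.
  by move=> t /=; rewrite !in_itv /= andbT => /andP[].
rewrite integral_itv_bndo_bndc; last first.
  by apply: measurable_funS mS; [exact: measurableU|exact: subsetUl].
rewrite fineD//; first exact: integrable_fin_num int.
exact: fin.
Qed.

Lemma Phi_derive (s : R) : 0 < s -> is_derive s 1 (Phi k f) (- (H s)^-1).
Proof.
move=> s0; pose a := s / 2; have a0 : 0 < a by rewrite divr_gt0.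
have as_ : a < s by rewrite ltr_pdivrMr// mulr_natr mulr2n ltrDl.
have [|||d1 d2] := @continuous_FTC1_closed R (fun t => (H t)^-1) a s (s + 1) _ _ as_.
- by rewrite ltrDl.
- apply: (integrableS _ _ _ (Hinv_integrable a0)) => //.
  by move=> t /=; rewrite !in_itv /= andbT => /andP[].
- by apply: cvgV; [rewrite gt_eqF// Hfun_gt0|exact: Hfun_continuous].
have : is_derive s 1 (cst (Phi k f a) - (fun x => \int[mu]_(t in `[a, x]) (H t)^-1)) (0 - (H s)^-1).
  apply: is_deriveB; apply: DeriveDef; first exact: d1.
  by rewrite -derive1E; exact: d2.
rewrite sub0r; apply: near_eq_is_derive.
near=> x; rewrite !fctE (@Phi_split a x)//; last by near: x; exact: lt_nbhsr.
by rewrite addrC addKr.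
Unshelve. all: by end_near. Qed.

Lemma Phi_ge0 (s : R) : 0 < s -> 0 <= Phi k f s.
Proof.
move=> s0; apply: fine_ge0; apply: integral_ge0 => t /=; rewrite in_itv /= andbT => st.
by rewrite lee_fin invr_ge0 ltW// Hfun_gt0// (lt_le_trans s0).
Qed.

Lemma Phi_lt (a s : R) : 0 < a -> a < s -> Phi k f s < Phi k f a.
Proof.
move=> a0 as_.
have [|c /andP[ac cs]] := @MVT_closed R (Phi k f) (fun t => - (H t)^-1) a s (ltW as_).
  by move=> t /andP[at_ _]; apply: Phi_derive; exact: lt_le_trans at_.
move/(canRL (subrK _)) => ->; rewrite gtrDr mulNr oppr_lt0 mulr_gt0 ?subr_gt0//.
by rewrite invr_gt0 Hfun_gt0// (lt_le_trans a0).
Qed.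

Lemma Phi_gt0 (s : R) : 0 < s -> 0 < Phi k f s.
Proof.
move=> s0; apply: le_lt_trans (@Phi_lt s (s + 1) s0 _); last by rewrite ltrDl.
by apply: Phi_ge0; rewrite addr_gt0.
Qed.

Lemma Phi_le (a s : R) : 0 < a -> a <= s -> Phi k f s <= Phi k f a.
Proof. by move=> a0; rewrite le_eqVlt => /predU1P[->//|/(Phi_lt a0)/ltW]. Qed.

Lemma Phi_inj (a s : R) : 0 < a -> 0 < s -> Phi k f a = Phi k f s -> a = s.
Proof.
move=> a0 s0 E; have [h|h|//] := ltgtP a s.
  by have := Phi_lt a0 h; rewrite E ltxx.
by have := Phi_lt s0 h; rewrite E ltxx.
Qed.

(** Phi decreases to its infimum L. The fundamental theorem on [1, oo[ evaluates [Phi_int] at 1 as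
    Phi 1 - L, and this is also Phi 1, so L = 0. *)
Lemma Phi_small (e : R) : 0 < e -> exists2 s : R, 1 < s & Phi k f s < e.
Proof.
move=> e0; pose S := [set Phi k f s | s in [set s : R | 1 < s]].
have lb : has_inf S.
  split; first by exists (Phi k f 2); exists 2 => //=; rewrite ltr1n.
  by exists 0 => _ [s /= s1 <-]; apply: Phi_ge0; exact: lt_trans s1.
pose L := inf S.
have L0 : 0 <= L by apply: lb_le_inf lb.1 _ => _ [s /= s1 <-]; apply: Phi_ge0; exact: lt_trans s1.
have cv : (- Phi k f x) @[x --> +oo] --> - L.
  apply: cvgN; apply/cvgrPdist_lt => d d0.
  have [_ [s /= s1 <-] sL] := inf_adherent d0 lb.
  near=> x.
  have sx : s <= x by near: x; apply: nbhs_pinfty_ge; exact: num_real.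
  have s0 := lt_trans ltr01 s1.
  have Lx : L <= Phi k f x by apply: (ge_inf lb.2); exists x => //=; exact: lt_le_trans sx.
  rewrite distrC ger0_norm ?subr_ge0// ltrBlDl; exact: le_lt_trans (Phi_le s0 sx) sL.
have dP (x : R) : 0 < x -> is_derive x 1 (fun x => - Phi k f x) (H x)^-1.
  by move=> x0; rewrite -[(H x)^-1]opprK; apply: is_deriveN; exact: Phi_derive.
have E : (\int[mu]_(x in `[1%R, +oo[) ((H x)^-1)%:E = (- L)%:E - (- Phi k f 1)%:E)%E.
  apply: (@ge0_continuous_FTC2y R (fun t => (H t)^-1) (fun x => - Phi k f x) 1 (- L)) => //.
  - by move=> x x1; rewrite invr_ge0 ltW// Hfun_gt0// (lt_le_trans ltr01).
  - apply: continuous_in_subspaceT => x; rewrite inE /= in_itv /= andbT => x1.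
    have x0 := lt_le_trans ltr01 x1.
    by apply: cvgV; [rewrite gt_eqF// Hfun_gt0|exact: Hfun_continuous].
  - by move=> x x1; case: (dP x (lt_trans ltr01 x1)).
  - apply: cvg_at_right_filter; exact: (derivable_cont (dP 1 ltr01)).
  - move=> x; rewrite in_itv /= andbT => x1.
    by rewrite derive1E; case: (dP x (lt_trans ltr01 x1)).
have fin1 : Phi_int k f 1 = (Phi k f 1)%:E.
  rewrite fineK// ge0_fin_numE ?f2//; apply: integral_ge0 => t /=; rewrite in_itv /= andbT => st.
  by rewrite lee_fin invr_ge0 ltW// Hfun_gt0// (lt_le_trans ltr01).
have LE : L = 0.
  exact: EFin_shift_eq0 (etrans (esym fin1) E).
have [_ [s /= s1 <-]] := inf_adherent e0 lb.
by rewrite -/L LE add0r; exists s.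
Unshelve. all: by end_near. Qed.



Lemma power_derivative_le0 (p : nat) (x F h : R) : 0 < F -> F <= p.+1%:R * x / h ->
  x *: ((p.+1%:R * F ^+ p) *: (- h^-1)) + F ^+ p.+1 *: (1 : R) <= 0.
Proof.
move=> F0 Fh; rewrite /GRing.scale /= mulr1 exprSr.
have -> : x * (p.+1%:R * F ^+ p * - h^-1) + F ^+ p * F = F ^+ p * (F - p.+1%:R * x / h) by ring.
by rewrite mulr_ge0_le0 ?subr_le0// exprn_ge0// ltW.
Qed.

Lemma varphi_Phi (s : R) : 0 < s -> phi (Phi k f s) = s.
Proof.
move=> s0; have [] : 0 < phi (Phi k f s) /\ Phi k f (phi (Phi k f s)) = Phi k f s.
  by apply: (@xgetPex _ 0 [set s' | 0 < s' /\ Phi k f s' = Phi k f s]); exists s.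
by move=> p0; exact: Phi_inj.
Qed.

(** Phi may be bounded near 0, and outside its range [varphi] takes the default value 0. Hence the
    restriction to small T here and in everything that follows. *)
Lemma varphi_spec (T S : R) : 0 < S -> 0 < T < Phi k f S -> S < phi T /\ Phi k f (phi T) = T.
Proof.
move=> S0 /andP[T0 TS]; have [s s1 sT] := Phi_small T0.
pose s2 := Num.max s (S + 1).
have Ss : S <= s2 by rewrite le_max lerDl ler01 orbT.
have s2T : Phi k f s2 < T.
  apply: le_lt_trans sT; apply: Phi_le; first exact: lt_trans s1.
  by rewrite le_max lexx.
have [||c] := @IVT R (Phi k f) S s2 T Ss.
- apply: derivable_within_continuous => t; rewrite in_itv /= => /andP[St _].
  by case: (Phi_derive (lt_le_trans S0 St)).
- by rewrite ge_min le_max (ltW s2T) (ltW TS) orbT.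
rewrite in_itv /= => /andP[Sc _] cT.
have Sc' : S < c.
  rewrite lt_def Sc andbT; apply: contraTneq TS => E.
  by rewrite -cT E ltxx.
by rewrite -cT varphi_Phi// (lt_trans S0).
Qed.

Lemma varphi_derive (T : R) : 0 < T < Phi k f 1 -> is_derive T 1 phi (- H (phi T)).
Proof.
move=> T1; have [p1 pT] := varphi_spec ltr01 T1.
have p0 := lt_trans ltr01 p1.
have := @is_derive_inverse R (Phi k f) phi (- (H (phi T))^-1) (phi T) _ _ (Phi_derive p0) _.
rewrite pT invrN invrK; apply.
- near=> y; apply: varphi_Phi; near: y; exact: lt_nbhsr.
- near=> y; have y0 : 0 < y by near: y; exact: lt_nbhsr.
  exact: derivable_cont (Phi_derive y0).
- by rewrite oppr_eq0 invr_eq0 gt_eqF// Hfun_gt0.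
Unshelve. all: by end_near. Qed.

Variable C_f : R.
Hypothesis (HCf : 0 < C_f).
Hypothesis f3 : derive1 H s * Phi k f s @[s --> +oo] --> C_f.

Lemma f3_near (e : R) : 0 < e -> exists2 S : R, 1 <= S & forall s, S < s ->
  `|f s / H s ^+ k * Phi k f s - C_f| < e.
Proof.
move=> e0; move/cvgrPdist_lt: f3 => /(_ _ e0)[M [_ hM]].
exists (Num.max M 1); first by rewrite le_max lexx orbT.
move=> s; rewrite gt_max => /andP[/hM sM s1].
by rewrite distrC -Hfun_derive1// (lt_trans ltr01).
Qed.

(* Phi(s) H(s) <= P s for large s and some P, so s Phi(s)^P is nonincreasing. *)
Lemma varphi_ratio : exists P : nat, exists2 T0 : R, 0 < T0 & forall c T : R, 0 < c < 1 -> 0 < T < T0 ->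
  phi (c * T) <= c ^- P * phi T.
Proof.
have [S S1 hS] := f3_near (@ltr01 R).
pose S' := S + 1; have SS' : S < S' by rewrite ltrDl.
have S0' : 0 < S' by rewrite (lt_trans _ SS')// (lt_le_trans ltr01).
have S1' : 1 <= S' by rewrite (le_trans S1)// ltW.
pose B := C_f + 1.
(* D' = Phi H' - 1 is at most C_f + 1 for large s, so D grows at most linearly; P is taken with D s
   <= P s. *)
pose D (s : R) := Phi k f s * H s.
have dD (s : R) : 0 < s -> is_derive s 1 D (Phi k f s *: (f s / H s ^+ k) + H s *: (- (H s)^-1)).
  by move=> s0; apply: is_deriveM; [exact: Phi_derive|exact: Hfun_derive].
have DB (s : R) : S' <= s -> D s <= D S' + B * (s - S').
  move=> Ss.
  have [|c /andP[c1 c2]] := @MVT_closed R D (fun s => Phi k f s *: (f s / H s ^+ k) + H s *: (- (H s)^-1)) S' s Ss.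
    by move=> t /andP[h _]; apply: dD; exact: lt_le_trans h.
  move/(canRL (subrK _)) => ->; rewrite addrC lerD2l ler_wpM2r ?subr_ge0//.
  have Hc := Hfun_gt0 (lt_le_trans S0' c1).
  rewrite /GRing.scale /= mulrN mulfV ?gt_eqF// mulrC.
  have := hS c (lt_le_trans SS' c1); rewrite ltr_norml => /andP[_].
  rewrite ltrBlDr => /ltW h; rewrite lerBlDr; apply: le_trans h _.
  by rewrite /B addrC lerDl.
have [P' DP] : exists P' : nat, D S' + B <= P'.+1%:R.
  by exists (Num.truncn (D S' + B)); rewrite ltW// truncnS_gt.
pose P := P'.+1.
have D0 : 0 <= D S' by rewrite mulr_ge0 ?Phi_ge0// ltW// Hfun_gt0.
have B0 : 0 <= B by rewrite addr_ge0// ltW.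
have DPs (s : R) : S' <= s -> D s <= P%:R * s.
  move=> Ss; apply: le_trans (DB s Ss) _.
  apply: (@le_trans _ _ ((D S' + B) * s)); last by rewrite ler_wpM2r// ltW// (lt_le_trans S0').
  rewrite [leRHS]mulrDl lerD//; first by rewrite ler_peMr// (le_trans S1').
  by rewrite ler_wpM2l// gerBl ltW.
(* E' = Phi^(P-1) (Phi - P s/H) is nonpositive exactly because D s <= P s. Since Phi equals T at phi
   T and cT at phi (cT), comparing E at these points gives the ratio. *)
pose E (s : R) := s * Phi k f s ^+ P.
have dE (s : R) : 0 < s -> is_derive s 1 E (s *: ((P%:R * Phi k f s ^+ P.-1) *: (- (H s)^-1)) + Phi k f s ^+ P *: 1).
  move=> s0; have := is_deriveX P (Phi_derive s0).
  have -> : Phi k f ^+ P = (fun s => Phi k f s ^+ P).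
    by apply/funext => x; elim: (P) => [|j IH]; rewrite ?expr0// !exprS -IH.
  by move=> h; exact: (is_deriveM (is_derive_id s 1) h).
exists P; exists (Phi k f S'); first exact: Phi_gt0.
move=> c T /andP[c0 c1] /andP[T0 TS].
have cT : c * T < T by rewrite gtr_pMl.
have [s1 Ts] : S' < phi T /\ Phi k f (phi T) = T by apply: varphi_spec => //; rewrite T0.
have [s2 Ts2] : phi T < phi (c * T) /\ Phi k f (phi (c * T)) = c * T.
  by apply: varphi_spec; [exact: lt_trans s1|rewrite Ts mulr_gt0].
have : E (phi (c * T)) <= E (phi T).
  have [|x /andP[x1 x2]] := @MVT_closed R E (fun s => s *: ((P%:R * Phi k f s ^+ P.-1) *: (- (H s)^-1)) + Phi k f s ^+ P *: 1) _ _ (ltW s2).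
    by move=> t /andP[h _]; apply: dE; apply: lt_le_trans h; exact: lt_trans s1.
  move/(canRL (subrK _)) => ->; rewrite gerDr mulr_le0_ge0//; last by rewrite subr_ge0 ltW.
  have Sx : S' <= x by rewrite (le_trans (ltW s1)).
  have x0 : 0 < x by exact: lt_le_trans Sx.
  apply: power_derivative_le0; first exact: Phi_gt0.
  by rewrite ler_pdivlMr ?Hfun_gt0//; exact: DPs.
rewrite /E Ts Ts2 exprMn mulrA [leRHS]mulrC -[leRHS]mulrC ler_pM2r ?exprn_gt0//.
by rewrite -ler_pdivlMr ?exprn_gt0// [X in _ -> _ <= X]mulrC.
Qed.

Variables (delta0 : R) (m : R -> R) (C_m : R).
Hypotheses (Hdelta0 : 0 < delta0)
  (m_pos : forall t : R, 0 < t < delta0 -> 0 < m t)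
  (m_mono : forall s t : R, 0 < s -> s <= t -> t < delta0 -> m s <= m t)
  (m_C1 : forall t : R, 0 < t < delta0 -> derivable m t 1 /\ {for t, continuous (derive1 m)})
  (b2_Cm : derive1 (fun s => Mint m s / m s) t @[t --> 0^'+] --> C_m).
Local Notation M := (Mint m).

Let m_cont (t : R) : 0 < t < delta0 -> {for t, continuous m}.
Proof. by move=> /m_C1[/derivable1_diffP/differentiable_continuous]. Qed.

(** Reconciles the open interval in [Mint] with the half-open one used for primitives. *)
Lemma Mint_primitive (t : R) : t < delta0 -> M t = fine (\int[mu]_(s in `]0%R, t]) (m s)%:E)%E.
Proof.
move=> td; rewrite /Mint integral_itv_bndo_bndc//.
apply: (@measurable_funS _ _ _ _ `]0%R, t]) => //.
  by move=> s /=; rewrite !in_itv /= => /andP[-> /ltW].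
apply/measurable_realfun.measurable_EFinP; exact: (primitive_measurable m_cont).
Qed.

Lemma Mint_derive (t : R) : 0 < t < delta0 -> is_derive t 1 M (m t).
Proof.
move=> /andP[t0 td].
apply: near_eq_is_derive (primitive_derive m_pos m_mono m_cont _); last by rewrite t0.
near=> x; apply/esym/Mint_primitive; near: x; exact: lt_nbhsl.
Unshelve. all: by end_near. Qed.

Lemma Mint_bounds (t : R) : 0 < t < delta0 -> 0 < M t <= t * m t.
Proof.
move=> t0; rewrite Mint_primitive; last by case/andP: t0.
exact: (primitive_bounds m_pos m_mono m_cont).
Qed.

Lemma near_at_right0P (P : R -> Prop) : (\forall t \near 0^'+, P t) <->
  exists2 tau : R, 0 < tau & forall t, 0 < t < tau -> P t.
Proof.
split.
  move=> [d /= d0 h]; exists d => // t /andP[t0 td]; apply: h => //.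
  by rewrite /ball /= sub0r normrN gtr0_norm.
move=> [d d0 h]; exists d => //= t; rewrite /ball /= sub0r normrN => td t0.
by apply: h; rewrite t0 (le_lt_trans (ler_norm _)).
Qed.

Lemma Mint_small (T : R) : 0 < T -> exists2 tau : R, 0 < tau <= delta0 / 2 & forall t, 0 < t < tau -> 0 < M t < T.
Proof.
move=> T0; have d2 : 0 < delta0 / 2 by rewrite divr_gt0.
have d2d : delta0 / 2 < delta0 by rewrite ltr_pdivrMr// mulr_natr mulr2n ltrDl.
have md : 0 < m (delta0 / 2) by apply: m_pos; rewrite d2.
exists (Num.min (delta0 / 2) (T / m (delta0 / 2))).
  by rewrite lt_min d2 divr_gt0//= ge_min lexx.
move=> t /andP[t0]; rewrite lt_min (ltr_pdivlMr _ _ md) => /andP[td tm].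
have tdd : t < delta0 by exact: lt_trans d2d.
have /andP[M0 Mt] : 0 < M t <= t * m t by apply: Mint_bounds; rewrite t0.
rewrite M0 (le_lt_trans Mt)// (le_lt_trans _ tm)// ler_wpM2l ?(ltW t0)//.
by apply: m_mono => //; exact: ltW.
Qed.

Let p (t : R) := M t * derive1 m t / m t ^+ 2.

(** The quotient rule reads (M/m)' = 1 - p. *)
Lemma profile_p_cvg : p t @[t --> 0^'+] --> 1 - C_m.
Proof.
have : (1 - derive1 (fun s => M s / m s) t) @[t --> 0^'+] --> 1 - C_m.
  by apply: cvgB => //; exact: cvg_cst.
apply: cvg_trans; apply: near_eq_cvg; apply/near_at_right0P; exists delta0 => // t t01.
have m0 := m_pos t01.
have [dm _] := m_C1 t01.
have dmm := is_derive_derive1 dm.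
have := is_deriveM (Mint_derive t01) (is_deriveV (lt0r_neq0 m0) dmm).
rewrite /GRing.scale /= => -[_ h].
rewrite derive1E [X in 1 - X](_ : _ = M t * (- m t ^- 2 * derive1 m t) + (m t)^-1 * m t); last exact: h.
rewrite mulVf ?gt_eqF// /p; field; exact: lt0r_neq0.
Qed.

Section Xi.
Variable xi : R.
Hypothesis xi0 : 0 < xi.

Definition profile (t : R) := phi (xi * M t).
(** [profile1] and [profile2] are the first two derivatives of the profile, written out with phi' =
    - H(phi) and H' = f/H^k. *)
Definition profile1 (t : R) := - (xi * (m t * H (profile t))).
Definition profile2 (t : R) := - (xi * (derive1 m t * H (profile t) +
   m t * (f (profile t) / H (profile t) ^+ k * profile1 t))).

Let q (t : R) := xi * M t * (f (profile t) / H (profile t) ^+ k).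

Lemma profile_range (S : R) : 1 <= S -> exists2 tau : R, 0 < tau <= delta0 / 2 &
  forall t, 0 < t < tau -> [/\ 0 < xi * M t < Phi k f 1, S < profile t &
    Phi k f (profile t) = xi * M t].
Proof.
move=> S1; have S0 : 0 < S by exact: lt_le_trans S1.
have [tau tau0 h] := Mint_small (divr_gt0 (Phi_gt0 S0) xi0).
exists tau => // t /h /andP[M0]; rewrite ltr_pdivlMr// mulrC => MS.
have xM : 0 < xi * M t < Phi k f S by rewrite mulr_gt0.
have [a1 a2] := varphi_spec S0 xM; split=> //.
by rewrite mulr_gt0//=; apply: lt_le_trans MS _; exact: Phi_le.
Qed.

(** Because Phi(h) = xi M, the quantity q is H' Phi evaluated at h, and h tends to infinity as t
    tends to 0. *)
Lemma profile_q_cvg : q t @[t --> 0^'+] --> C_f.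
Proof.
apply/cvgrPdist_lt => e e0; apply/near_at_right0P.
have [S S1 hS] := f3_near e0.
have [tau /andP[tau0 _] h] := profile_range S1.
exists tau => // t /h [_ St Pt]; rewrite /q -Pt distrC mulrC; exact: hS.
Qed.

Hypothesis HCfm : 1 - C_m < C_f.
Hypothesis k0 : (0 < k)%N.

Lemma profile_derive : exists2 t0 : R, 0 < t0 <= delta0 / 2 & forall t, 0 < t < t0 ->
  [/\ 0 < profile t, is_derive t 1 profile (profile1 t),
      is_derive t 1 profile1 (profile2 t), {for t, continuous profile2} & profile1 t < 0].
Proof.
have [tau tau0 h] := profile_range (lexx 1); exists tau; first exact: tau0.
move=> t tt.
have [xM p1 PM] := h _ tt.
have td : 0 < t < delta0.
  move: tt tau0 => /andP[-> tt] /andP[_ td]; apply: lt_le_trans tt (le_trans td _).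
  by rewrite ler_pdivrMr// mulr_natr mulr2n lerDl ltW.
have p0 : 0 < profile t by exact: lt_trans p1.
have Hp := Hfun_gt0 p0; have m0 := m_pos td.
have dxM : is_derive t 1 (fun t => xi * M t) (xi * m t).
  exact: (is_deriveZ xi (Mint_derive td)).
have d1 : is_derive t 1 profile (profile1 t).
  have := @is_derive1_comp R phi (fun t => xi * M t) t _ _ (varphi_derive xM) dxM.
  by rewrite /profile1 -/(profile t) (_ : - H _ * _ = - (xi * (m t * H (profile t)))); last by rewrite /profile; ring.
have [dm cm] := m_C1 td.
have dmm := is_derive_derive1 dm.
have dHp : is_derive t 1 (fun t => H (profile t)) (f (profile t) / H (profile t) ^+ k * profile1 t).
  exact: (@is_derive1_comp R H profile t _ _ (Hfun_derive p0) d1).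
have d2 : is_derive t 1 profile1 (profile2 t).
  have := is_deriveN (is_deriveZ xi (is_deriveM dmm dHp)).
  rewrite /profile2 /GRing.scale /=.
  by rewrite [m t * _ + _]addrC [H _ * _]mulrC.
have cp := derivable_cont d1; have cHp := derivable_cont dHp.
have cf : {for t, continuous (fun t => f (profile t))}.
  by apply: continuous_comp => //; exact: f_continuous.
have Hk0 : H (profile t) ^+ k != 0 by rewrite expf_neq0// gt_eqF.
split=> //; last by rewrite oppr_lt0 !mulr_gt0.
apply: cvgN; apply: cvgM; first exact: cvg_cst.
apply: cvgD; first exact: (cvgM cm cHp).
apply: cvgM; first exact: derivable_cont dmm.
apply: cvgM; last exact: derivable_cont d2.
apply: cvgM => //; apply: cvgV => //.
exact: (cvg_comp _ _ cHp (@exprn_continuous _ k _)).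
Qed.

Lemma profile_unbounded (C : R) : exists2 tau : R, 0 < tau & forall t, 0 < t < tau -> C < profile t.
Proof.
have [|tau /andP[tau0 _] h] := @profile_range (Num.max C 1); first by rewrite le_max lexx orbT.
exists tau => // t /h[_ + _]; by rewrite gt_max => /andP[].
Qed.

Let kappa := 1 - C_f^-1 * (1 - C_m).

(** Two exact formulas, [sE] and [E] in the proof, express both quantities through p and q, so the
    errors come only from the convergence of q - p and of p/q. *)
Lemma profile_asymptotics (eta : R) : 0 < eta -> exists2 tau : R, 0 < tau & forall t, 0 < t < tau ->
  eta^-1 <= profile2 t / - profile1 t /\
  `|(- profile1 t) ^+ k * (profile2 t / - profile1 t) - xi ^+ k.+1 * kappa * (m t ^+ k.+1 * f (profile t))|
   <= eta * (m t ^+ k.+1 * f (profile t)).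
Proof.
move=> eta0.
have [t0 /andP[t00 t0d] hd] := profile_derive.
pose g := C_f - (1 - C_m); have g0 : 0 < g by rewrite subr_gt0.
have gap : \forall t \near 0^'+, g / 2 < q t - p t.
  have : q t - p t @[t --> 0^'+] --> g by apply: cvgB; [exact: profile_q_cvg|exact: profile_p_cvg].
  move/cvgr_gt; apply; by rewrite ltr_pdivrMr// mulr_natr mulr2n ltrDl.
have pq : \forall t \near 0^'+, `|(1 - C_m) / C_f - p t / q t| < eta / xi ^+ k.+1.
  have : p t / q t @[t --> 0^'+] --> (1 - C_m) / C_f.
    by apply: cvgM; [exact: profile_p_cvg|apply: cvgV; [rewrite gt_eqF|exact: profile_q_cvg]].
  by move/cvgrPdist_lt; apply; rewrite divr_gt0// exprn_gt0.
move/near_at_right0P: gap => [t1 t10 h1]; move/near_at_right0P: pq => [t2 t20 h2].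
(* With q - p > g/2 and M <= t m the ratio h''/|h'| is at least g/(2t), which exceeds 1/eta as soon
   as t < eta g/2. *)
have eg : 0 < eta * (g / 2) by rewrite mulr_gt0// divr_gt0.
exists (Num.min (Num.min t0 t1) (Num.min t2 (eta * (g / 2)))); first by rewrite !lt_min t00 t10 t20 eg.
move=> t /andP[tp]; rewrite !lt_min => /andP[/andP[tt0 tt1] /andP[tt2 tt3]].
have [|pt0 _ _ _ pt1] := hd t; first by rewrite tp.
have td : 0 < t < delta0.
  rewrite tp (lt_le_trans tt0)// (le_trans t0d)//.
  by rewrite ler_pdivrMr// mulr_natr mulr2n lerDl ltW.
have gap : g / 2 < q t - p t by apply: h1; rewrite tp.
have pq : `|(1 - C_m) / C_f - p t / q t| < eta / xi ^+ k.+1 by apply: h2; rewrite tp.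
have /andP[M0 Mt] := Mint_bounds td.
have m0 := m_pos td; have Hp := Hfun_gt0 pt0; have fp := f1_pos pt0.
have mn := lt0r_neq0 m0; have Mn := lt0r_neq0 M0; have Hn := lt0r_neq0 Hp.
have fn := lt0r_neq0 fp; have xn := lt0r_neq0 xi0.
have sE : profile2 t / - profile1 t = m t / M t * (q t - p t).
  rewrite /profile2 /q /p /profile1; field.
  by rewrite expf_neq0// xn mn Hn Mn.
split.
  rewrite sE; apply: (@le_trans _ _ (t^-1 * (g / 2))).
    rewrite -ler_pdivrMr ?divr_gt0// -invfM lef_pV2 ?posrE ?mulr_gt0 ?divr_gt0//; exact: ltW.
  apply: ler_pM; rewrite ?invr_ge0 ?(ltW tp) ?(ltW gap)//; first by rewrite ltW// divr_gt0.
  by rewrite ler_pdivlMr// mulrC ler_pdivrMr// mulrC.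
have E : (- profile1 t) ^+ k * (profile2 t / - profile1 t) - xi ^+ k.+1 * kappa * (m t ^+ k.+1 * f (profile t)) =
   xi ^+ k.+1 * ((1 - C_m) / C_f - p t / q t) * (m t ^+ k.+1 * f (profile t)).
  rewrite /kappa sE /q /p /profile1 opprK !exprMn !exprS; field.
  by rewrite expf_neq0// fn Mn xn mn gt_eqF.
have mf0 : 0 <= m t ^+ k.+1 * f (profile t) by rewrite mulr_ge0// ?exprn_ge0// ltW.
rewrite E normrM (ger0_norm mf0) ler_wpM2r// normrM ger0_norm ?exprn_ge0 ?(ltW xi0)//.
by rewrite mulrC -ler_pdivlMr ?exprn_gt0// ltW.
Qed.

End Xi.
End ProfileOde.

(** * Quadratic barriers *)

Section QuadraticBarrier.
Variables (R : realType) (n : nat).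
Local Notation V := 'rV[R]_n.
Implicit Types (x y z v w nu : V) (B : 'M[R]_n).

Lemma is_derive_quadratic (Q : V -> R) z v (D E : R) :
  (forall h : R, Q (z + h *: v) = Q z + h * D + h ^+ 2 * E) -> is_derive z v Q D.
Proof.
move=> QE; apply/is_derive_epsP => e e0; exists (e / (`|E| + 1)).
  by rewrite divr_gt0// ltr_wpDl.
move=> h h0; rewrite ltr_pdivlMr ?ltr_wpDl// => he.
have -> : h^-1 * (Q (z + h *: v) - Q z) - D = h * E by rewrite QE; field.
rewrite normrM; apply: le_lt_trans he; rewrite ler_wpM2l// lerDl; exact: ler01.
Qed.

Lemma is_derive_lin (L : V -> R) z v : (forall x y, L (x + y) = L x + L y) ->
  (forall (c : R) x, L (c *: x) = c * L x) -> is_derive z v L (L v).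
Proof.
move=> LD LZ; apply: (@is_derive_quadratic _ _ _ _ 0) => h.
by rewrite LD LZ mulr0 addr0.
Qed.

Lemma is_derive_qform B z v : B^T = B -> is_derive z v (qform B) (2 * bform B z v).
Proof.
move=> BT; apply: (@is_derive_quadratic _ _ _ _ (qform B v)) => h.
by rewrite qformD// qformZ bformZr; ring.
Qed.

Lemma lin_continuous_at (L : V -> R) C z : (forall x y, L (x + y) = L x + L y) ->
  (forall x, `|L x| <= C * enorm x) -> {for z, continuous L}.
Proof.
move=> LD LC; apply/continuous_enormP => e e0.
have C0 : 0 < `|C| + 1 by rewrite ltr_wpDl.
exists (e / (`|C| + 1)); first by rewrite divr_gt0.
move=> y; rewrite ltr_pdivlMr// mulrC => ye.
have -> : L y - L z = L (y - z) by have := LD (y - z) z; rewrite subrK => ->; rewrite addrK.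
apply: le_lt_trans (LC _) _; apply: le_lt_trans ye; rewrite ler_wpM2r ?enorm_ge0//.
by apply: le_trans (ler_norm _) _; rewrite lerDl.
Qed.

Lemma bform_continuous_at B w z : {for z, continuous (fun x => bform B x w)}.
Proof.
apply: (@lin_continuous_at _ (n%:R ^+ 2 * `|B| * enorm w)).
  by move=> x y; exact: bformDl.
by move=> x; rewrite mulrAC; exact: bform_bound.
Qed.

Lemma dotr_continuous_at w z : {for z, continuous (fun x => dotr x w)}.
Proof.
apply: (@lin_continuous_at _ (enorm w)); first by move=> x y; exact: dotrDl.
by move=> x; rewrite mulrC; exact: cauchy_schwarz.
Qed.

Lemma coord_continuous_at i z : {for z, continuous (fun x => x ord0 i)}.
Proof.
apply: (@lin_continuous_at _ 1); first by move=> x y; rewrite mxE.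
by move=> x; rewrite mul1r entry_le_enorm.
Qed.

Lemma mulmx_entry_bform B z j : (z *m B) ord0 j = bform B z (evec R j).
Proof. by rewrite /bform dotr_evec. Qed.

Lemma qform_continuous_at B z : continuous_at z (qform B).
Proof.
apply: (@continuous_at_sum _ _ _ _ _ (fun j x => (x *m B) ord0 j * x ord0 j)) => j.
apply: continuous_atM; last exact: coord_continuous_at.
rewrite (_ : (fun y => _) = (fun y => bform B y (evec R j))); first exact: bform_continuous_at.
by apply/funext => y; rewrite mulmx_entry_bform.
Qed.

Lemma row_mul_rank_ones v (a b : V) (C D : 'M[R]_n) (c s : R) :
  v *m (- (C + c *: (a^T *m b + b^T *m a + s *: D))) =
  - (v *m C + c *: (dotr v a *: b + dotr v b *: a + s *: (v *m D))).
Proof.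
rewrite mulmxN mulmxDr -scalemxAr 2!mulmxDr !mulmxA !row_mul_tr !mul_scalar_mx.
by rewrite -scalemxAr.
Qed.

Lemma trmx_rank_ones (a b : V) (C D : 'M[R]_n) (c s : R) : C^T = C -> D^T = D ->
  (- (C + c *: (a^T *m b + b^T *m a + s *: D)))^T = - (C + c *: (a^T *m b + b^T *m a + s *: D)).
Proof.
move=> CT DT; apply/matrixP => i j; rewrite !mxE !big_ord1 !mxE.
have := congr1 (fun M : 'M[R]_n => M i j) CT; rewrite mxE => ->.
have := congr1 (fun M : 'M[R]_n => M i j) DT; rewrite mxE => ->; ring.
Qed.

Variables (nu : V) (A : 'M[R]_n) (eps K : R).
Hypotheses (unit_nu : enorm nu = 1) (A_sym : A^T = A) (nuA : nu *m A = 0).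
Local Notation P := (orth_proj nu).

(* With z = y - xb and z' the tangential part of z, [qfun] is
   <z, nu> - (<z A, z> + eps |z'|^2) / 2 - K <z, nu> |z'|^2.
   It is used with eps > 0 and a large K, which forces |D qfun| <= 1 and hence
   qfun <= dist, and with eps < 0 and K = 0, where qfun >= dist inside the
   domain.  The surplus |eps| |z'|^2 / 4 gained by doubling eps controls the
   lateral boundary of a small ball. *)
Definition qmat : 'M[R]_n := A + eps *: P.
Definition qfun z : R := dotr z nu - 2^-1 * qform qmat z - K * (dotr z nu * qform P z).
Definition qgrad z : V :=
  nu - z *m qmat - K *: (qform P z *: nu + (2 * dotr z nu) *: (z *m P)).
Definition qhess z : 'M[R]_n :=
  - (qmat + (2 * K) *: ((z *m P)^T *m nu + nu^T *m (z *m P) + dotr z nu *: P)).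

Lemma qmat_sym : qmat^T = qmat.
Proof. by rewrite /qmat linearD linearZ /= A_sym orth_proj_sym. Qed.

Lemma nu_orth_proj : nu *m P = 0.
Proof. by rewrite mul_orth_proj dotr_sqr unit_nu expr1n scale1r subrr. Qed.

Lemma nu_qmat : nu *m qmat = 0.
Proof. by rewrite /qmat mulmxDr nuA -scalemxAr nu_orth_proj scaler0 addr0. Qed.

Lemma qfun_derive z v : is_derive z v qfun (dotr (qgrad z) v).
Proof.
have d1 : is_derive z v (fun x => dotr x nu) (dotr v nu).
  by apply: is_derive_lin => *; rewrite ?dotrDl ?dotrZl.
have d2 := is_deriveZ 2^-1 (is_derive_qform z v qmat_sym).
have d3 := is_deriveZ K (is_deriveM d1 (is_derive_qform z v (orth_proj_sym nu))).
apply: is_derive_eq (is_deriveB (is_deriveB d1 d2) d3) _.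
rewrite /GRing.scale /= /qgrad !(dotrBl, dotrDl, dotrNl, dotrZl) /bform (dotrC nu v); by field.
Qed.

Lemma qgrad_derive z v j : is_derive z v (fun x => qgrad x ord0 j) ((v *m qhess z) ord0 j).
Proof.
have d1 : is_derive z v (fun x => dotr x nu) (dotr v nu).
  by apply: is_derive_lin => *; rewrite ?dotrDl ?dotrZl.
have d2 B : is_derive z v (fun x => (x *m B) ord0 j) ((v *m B) ord0 j).
  by apply: is_derive_lin => *; rewrite ?mulmxDl -?scalemxAl mxE.
have d3 := is_deriveM (is_derive_qform z v (orth_proj_sym nu)) (is_derive_cst (nu ord0 j) z v).
have d4 := is_deriveM (is_deriveZ 2 d1) (d2 P).
have d5 := is_deriveB (is_deriveB (is_derive_cst (nu ord0 j) z v) (d2 qmat)) (is_deriveZ K (is_deriveD d3 d4)).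
have -> : (fun x => qgrad x ord0 j) = (cst (nu ord0 j) - (fun x => (x *m qmat) ord0 j)
  - K \*: (qform P * cst (nu ord0 j) + (2 \*: (fun x => dotr x nu)) * (fun x => (x *m P) ord0 j))).
  apply/funext => x; rewrite /qgrad.
  have -> : (nu - x *m qmat - K *: (qform P x *: nu + (2 * dotr x nu) *: (x *m P))) ord0 j =
    nu ord0 j - (x *m qmat) ord0 j - K * (qform P x * nu ord0 j + (2 * dotr x nu) * (x *m P) ord0 j).
    move: (x *m qmat) (x *m P) => a b; by rewrite !mxE.
  by [].
apply: is_derive_eq d5 _.
rewrite /qhess row_mul_rank_ones.
have -> : (- (v *m qmat + (2 * K) *: (dotr v (z *m P) *: nu + dotr v nu *: (z *m P) + dotr z nu *: (v *m P)))) ord0 j =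
   - ((v *m qmat) ord0 j + (2 * K) * (dotr v (z *m P) * nu ord0 j + dotr v nu * (z *m P) ord0 j + dotr z nu * (v *m P) ord0 j)).
  by move: (v *m qmat) (z *m P) (v *m P) => a b c; rewrite !mxE.
have -> : (2 \*: (fun x => dotr x nu)) z = 2 * dotr z nu by [].
rewrite /GRing.scale /= /bform (dotrC v (z *m P)) /cst; ring.
Qed.

Lemma qfun_continuous_at z : continuous_at z qfun.
Proof.
have c1 := @dotr_continuous_at nu z; have c2 := @qform_continuous_at qmat z.
have c3 := @qform_continuous_at P z.
exact: (cvgB (cvgB c1 (cvgM (cvg_cst _) c2)) (cvgM (cvg_cst _) (cvgM c1 c3))).
Qed.

Lemma qgrad_continuous_at z j : continuous_at z (fun x => qgrad x ord0 j).
Proof.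
have -> : (fun x => qgrad x ord0 j) = (fun x =>
   nu ord0 j - bform qmat x (evec R j) - K * (qform P x * nu ord0 j + (2 * dotr x nu) * bform P x (evec R j))).
  apply/funext => x; rewrite /qgrad -!mulmx_entry_bform.
  by move: (x *m qmat) (x *m P) => a b; rewrite !mxE.
have c1 := @dotr_continuous_at nu z; have c2 := @bform_continuous_at qmat (evec R j) z.
have c3 := @qform_continuous_at P z; have c4 := @bform_continuous_at P (evec R j) z.
exact: (cvgB (cvgB (cvg_cst _) c2) (cvgM (cvg_cst _) (cvgD (cvgM c3 (cvg_cst _)) (cvgM (cvgM (cvg_cst _) c1) c4)))).
Qed.

Lemma qhess_continuous_at z i j : continuous_at z (fun x => qhess x i j).
Proof.
have -> : (fun x => qhess x i j) = (fun x =>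
   - (qmat i j + 2 * K * (bform P x (evec R i) * nu ord0 j + nu ord0 i * bform P x (evec R j) + dotr x nu * P i j))).
  apply/funext => x; rewrite /qhess -!mulmx_entry_bform.
  by move: (qmat) (x *m P) (P) => a b c; rewrite !mxE !big_ord1 !mxE.
have c1 := @dotr_continuous_at nu z; have c4 l := @bform_continuous_at P (evec R l) z.
exact: (cvgN (cvgD (cvg_cst _) (cvgM (cvg_cst _) (cvgD (cvgD (cvgM (c4 i) (cvg_cst _)) (cvgM (cvg_cst _) (c4 j))) (cvgM c1 (cvg_cst _)))))).
Qed.

Lemma qhess_sym z : (qhess z)^T = qhess z.
Proof.
by rewrite /qhess trmx_rank_ones ?qmat_sym ?orth_proj_sym.
Qed.

Section Composition.
Variables (h h1 h2 : R -> R) (t0 : R).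
Hypotheses (hd : forall t, 0 < t < t0 -> is_derive t 1 h (h1 t))
  (h1d : forall t, 0 < t < t0 -> is_derive t 1 h1 (h2 t))
  (h2c : forall t, 0 < t < t0 -> {for t, continuous h2}).
Variables (xb : V) (sg c : R) (U : set V).
Hypotheses (Uo : open U) (Ut : forall y, U y -> 0 < qfun (y - xb) + sg < t0).

(** In the application h is singular at 0; [sg] moves the level set on which the barrier is
    infinite, and c lets it touch u. *)
Definition barrier y : R := h (qfun (y - xb) + sg) + c.

Let t y : R := qfun (y - xb) + sg.

Let t_derive y v : is_derive y v t (dotr (qgrad (y - xb)) v).
Proof.
apply/is_derive_epsP => e e0.
have [d d0 hd'] := (is_derive_epsP _ _ _ _).1 (qfun_derive (y - xb) v) e e0.
exists d => // k k0 kd; have := hd' k k0 kd.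
have -> : t (y + k *: v) - t y = qfun (y - xb + k *: v) - qfun (y - xb).
  by rewrite /t [y + k *: v - xb]addrAC; ring.
by [].
Qed.

Let shift_continuous (g : V -> R) y : continuous_at (y - xb) g -> continuous_at y (fun z => g (z - xb)).
Proof.
move=> /continuous_enormP gc; apply/continuous_enormP => e /gc[r r0 hr].
by exists r => // z zy; apply: hr; rewrite opprB addrA subrK.
Qed.

Let t_continuous y : continuous_at y t.
Proof. exact: (cvgD (shift_continuous (@qfun_continuous_at _)) (cvg_cst _)). Qed.

Lemma comp_derive (g g1 : R -> R) (T : V -> R) y v D :
  is_derive (T y) 1 g (g1 (T y)) -> is_derive y v T D ->
  is_derive y v (fun z => g (T z)) (g1 (T y) * D).
Proof.
move=> dg; rewrite -[y]addr0 -(scale0r v) => /is_derive_line dT; apply/is_derive_line.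
apply: (@is_derive1_comp R g (fun s => T (y + s *: v)) 0) => //.
by rewrite scale0r addr0 in dg *.
Qed.

Let b1 i y := h1 (t y) * qgrad (y - xb) ord0 i.
Let b2 i j y := h2 (t y) * qgrad (y - xb) ord0 i * qgrad (y - xb) ord0 j + h1 (t y) * qhess (y - xb) i j.

Let barrier_d1 i y : U y -> is_derive y (evec R i) barrier (b1 i y).
Proof.
move=> Uy; have := comp_derive (hd (Ut Uy)) (t_derive y (evec R i)).
rewrite dotr_evec => d; apply: is_derive_eq (is_deriveD d (is_derive_cst c y _)) _.
by rewrite addr0.
Qed.

Let barrier_d2 i j y : U y -> is_derive y (evec R i) (b1 j) (b2 i j y).
Proof.
move=> Uy; have d1 := comp_derive (h1d (Ut Uy)) (t_derive y (evec R i)).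
have d2 : is_derive y (evec R i) (fun z => qgrad (z - xb) ord0 j) (qhess (y - xb) i j).
  apply/is_derive_epsP => e e0.
  have [d d0 hd'] := (is_derive_epsP _ _ _ _).1 (qgrad_derive (y - xb) (evec R i) j) e e0.
  exists d => // l l0 ld; have := hd' l l0 ld.
  have -> : (evec R i *m qhess (y - xb)) ord0 j = qhess (y - xb) i j by rewrite /evec -rowE mxE.
  by rewrite addrAC.
apply: is_derive_eq (is_deriveM d1 d2) _.
rewrite /GRing.scale /= dotr_evec /b2 -/(t y); ring.
Qed.

Let near_U y : U y -> \forall z \near y, U z.
Proof. by move=> Uy; exact: open_nbhs_nbhs. Qed.

Let barrier_partial i y : U y -> partial i barrier y = b1 i y.
Proof. by move=> /barrier_d1 H; case: (H i). Qed.

Let near_partial i y : U y -> \forall z \near y, b1 i z = partial i barrier z.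
Proof.
by move=> /near_U; apply: filterS => z Uz; rewrite barrier_partial.
Qed.

Let partial_d2 i j y : U y -> is_derive y (evec R i) (partial j barrier) (b2 i j y).
Proof. by move=> Uy; apply: near_eq_is_derive (near_partial j Uy) (barrier_d2 i j Uy). Qed.

Let barrier_partial2 i j y : U y -> partial i (partial j barrier) y = b2 i j y.
Proof. by move=> /partial_d2 H; case: (H i j). Qed.

Let h_cont (g g' : R -> R) y : is_derive (t y) 1 g (g' (t y)) -> continuous_at y (fun z => g (t z)).
Proof.
case=> /derivable1_diffP/differentiable_continuous gc _.
exact: (@continuous_comp _ _ _ t g y (@t_continuous y) gc).
Qed.

Let b1_continuous i y : U y -> continuous_at y (b1 i).
Proof.
move=> Uy; apply: continuous_atM; first exact: h_cont (h1d (Ut Uy)).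
exact: (@shift_continuous (fun z => qgrad z ord0 i)) (@qgrad_continuous_at _ i).
Qed.

Let b2_continuous i j y : U y -> continuous_at y (b2 i j).
Proof.
move=> Uy.
have c2 : continuous_at y (fun z => h2 (t z)) by exact: (@continuous_comp _ _ _ t h2 y (@t_continuous y) (h2c (Ut Uy))).
have c1 := h_cont (h1d (Ut Uy)).
have cq l := @shift_continuous (fun z => qgrad z ord0 l) _ (@qgrad_continuous_at (y - xb) l).
have ch := @shift_continuous (fun z => qhess z i j) _ (@qhess_continuous_at (y - xb) i j).
exact: (cvgD (cvgM (cvgM c2 (cq i)) (cq j)) (cvgM c1 ch)).
Qed.

Let continuous_near_eq (g g' : V -> R) y : (\forall z \near y, g z = g' z) ->
  continuous_at y g -> continuous_at y g'.
Proof.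
move=> gg' /continuous_enormP gc; apply/continuous_enormP => e /gc[r r0 hr].
have [s s0 hs] := (nbhs_enormP _ _).1 gg'.
exists (Num.min r s); first by rewrite lt_min r0.
move=> z; rewrite lt_min => /andP[/hr zr /hs <-].
by rewrite -hs// subrr enorm0.
Qed.

Lemma barrier_C2 : Ck_on 2 U barrier.
Proof.
split.
  move=> [|j [|//]] _ i y Uy /=; first by case: (barrier_d1 i Uy).
  by case: (partial_d2 i j Uy).
move=> [|i [|j [|//]]] _ y Uy /=.
- exact: (cvgD (h_cont (hd (Ut Uy))) (cvg_cst _)).
- by apply: (@continuous_near_eq (b1 i)); [exact: near_partial|exact: b1_continuous].
- apply: (@continuous_near_eq (b2 i j)); last exact: b2_continuous.
  by apply: filterS (near_U Uy) => z Uz; rewrite barrier_partial2.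
Qed.

Lemma barrier_hess y : U y -> hess barrier y =
  h2 (t y) *: ((qgrad (y - xb))^T *m qgrad (y - xb)) + h1 (t y) *: qhess (y - xb).
Proof.
move=> Uy; apply/matrixP => i j; rewrite mxE barrier_partial2//.
rewrite /b2; move: (qgrad (y - xb)) (qhess (y - xb)) => a b.
by rewrite !mxE big_ord1 !mxE mulrA.
Qed.

End Composition.
End QuadraticBarrier.

(** * Scalar inequalities behind the geometry of the barriers *)

Section BarrierArithmetic.
Variable R : realFieldType.
Implicit Types (a al rho eps C K eta r q : R).

Lemma sqr_le_abs a : `|a| <= 1 -> a ^+ 2 <= `|a|.
Proof.
move=> a1; rewrite -real_normK ?num_real// expr2.
by rewrite -[leRHS]mulr1 ler_wpM2l.
Qed.

(** Here and below a stands for <z, nu>, al for <z A, z> and rho for |z'|^2. Positivity of [qfun]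
    leaves X = a - al/2 > eps rho/4, so rho and |a| are bounded by multiples of X, and a small eta
    keeps the contact tolerance below X. *)
Lemma upper_inside_arith a al rho eps C K eta r : 0 < eps -> 0 <= C -> 0 <= K -> 0 <= rho ->
  0 < eta -> `|a| <= r -> r <= 1 -> K * r <= eps / 4 -> `|al| <= C * rho ->
  eta * ((1 + C) * (4 / eps) + 2) <= 2^-1 ->
  0 < a - 2^-1 * (al + eps * rho) - K * (a * rho) ->
  eta * (rho + a ^+ 2 + `|a|) < a - 2^-1 * al.
Proof.
move=> e0 C0 K0 rho0 eta0 ar r1 Kr alC etaC q0.
have a2 := sqr_le_abs (le_trans ar r1).
have Ka : - (eps / 4 * rho) <= K * (a * rho).
  rewrite mulrA -mulNr ler_wpM2r//.
  have h1 : K * `|a| <= K * r by rewrite ler_wpM2l.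
  have h2 : K * - a <= K * `|a| by rewrite ler_wpM2l// -normrN ler_norm.
  by lra.
pose X := a - 2^-1 * al; rewrite -/X.
have Xr : eps / 4 * rho < X by rewrite /X; lra.
have X0 : 0 < X by apply: le_lt_trans Xr; rewrite mulr_ge0// divr_ge0// ltW.
have aX : `|a| <= X + 2^-1 * (C * rho).
  have -> : a = X + 2^-1 * al by rewrite /X; ring.
  apply: le_trans (ler_normD _ _) _; rewrite (gtr0_norm X0) lerD2l normrM ger0_norm//.
  by rewrite ler_wpM2l.
have rX : rho <= 4 / eps * X.
  have -> : 4 / eps * X = X / (eps / 4) by field; exact: lt0r_neq0.
  by rewrite ler_pdivlMr ?divr_gt0// mulrC ltW.
have h3 : (1 + C) * rho <= (1 + C) * (4 / eps * X) by rewrite ler_wpM2l// addr_ge0.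
have h4 : rho + a ^+ 2 + `|a| <= ((1 + C) * (4 / eps) + 2) * X.
  have -> : ((1 + C) * (4 / eps) + 2) * X = (1 + C) * (4 / eps * X) + 2 * X by ring.
  by lra.
apply: (@le_lt_trans _ _ (2^-1 * X)); last by lra.
apply: (@le_trans _ _ (eta * (((1 + C) * (4 / eps) + 2) * X))); first by rewrite ler_wpM2l// ltW.
by rewrite mulrA ler_wpM2r// ltW.
Qed.

(** Mirror image of [upper_inside_arith]: were [qfun] negative, Y = al/2 - a > eps rho/2 would
    dominate the contact tolerance. *)
Lemma lower_inside_arith a al rho eps C eta : 0 < eps -> 0 <= C -> 0 <= rho ->
  0 < eta -> `|a| <= 1 -> `|al| <= C * rho ->
  eta * ((1 + C) * (4 / eps) + 2) <= 2^-1 ->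
  - (eta * (rho + a ^+ 2 + `|a|)) < a - 2^-1 * al ->
  0 <= a - 2^-1 * (al - eps * rho).
Proof.
move=> e0 C0 rho0 eta0 a1 alC etaC h; rewrite leNgt; apply/negP => q0.
have a2 := sqr_le_abs a1.
pose Y := 2^-1 * al - a.
have Yr : eps / 2 * rho < Y by rewrite /Y; lra.
have Y0 : 0 < Y by apply: le_lt_trans Yr; rewrite mulr_ge0// divr_ge0// ltW.
have aY : `|a| <= Y + 2^-1 * (C * rho).
  have -> : a = - Y + 2^-1 * al by rewrite /Y; ring.
  apply: le_trans (ler_normD _ _) _; rewrite normrN (gtr0_norm Y0) lerD2l normrM ger0_norm//.
  by rewrite ler_wpM2l.
have rY : rho <= 4 / eps * Y.
  have -> : 4 / eps * Y = Y / (eps / 4) by field; exact: lt0r_neq0.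
  rewrite ler_pdivlMr ?divr_gt0// mulrC; apply: le_trans (ltW Yr).
  by rewrite ler_wpM2r//; lra.
have h3 : (1 + C) * rho <= (1 + C) * (4 / eps * Y) by rewrite ler_wpM2l// addr_ge0.
have h4 : rho + a ^+ 2 + `|a| <= ((1 + C) * (4 / eps) + 2) * Y.
  have -> : ((1 + C) * (4 / eps) + 2) * Y = (1 + C) * (4 / eps * Y) + 2 * Y by ring.
  by lra.
have h5 : eta * (rho + a ^+ 2 + `|a|) <= 2^-1 * Y.
  apply: (@le_trans _ _ (eta * (((1 + C) * (4 / eps) + 2) * Y))); first by rewrite ler_wpM2l// ltW.
  by rewrite mulrA ler_wpM2r// ltW.
by rewrite /Y in h5 Y0; lra.
Qed.

(** a is the height at which [qfun] with parameters -eps and 0 vanishes. There a - al/2 = -eps rho/2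
    lies below the contact tolerance, so that the point is outside the domain. *)
Lemma lower_exit_arith al rho eps C eta : 0 < eps -> eps <= 1 -> 0 <= C -> 0 <= rho ->
  0 < eta -> `|al| <= C * rho -> (C + 1) * rho <= 2 -> eta * (2 + C) <= eps / 2 ->
  let a := 2^-1 * (al - eps * rho) in
  `|a| <= 2^-1 * ((C + 1) * rho) /\
  ~ (- (eta * (rho + a ^+ 2 + `|a|)) < a - 2^-1 * al).
Proof.
move=> e0 e1 C0 rho0 eta0 alC rho2 etaC a.
have aC : `|a| <= 2^-1 * ((C + 1) * rho).
  rewrite /a normrM ger0_norm// ler_wpM2l//.
  apply: le_trans (ler_normB _ _) _; rewrite mulrDl lerD// mul1r.
  by rewrite ger0_norm ?mulr_ge0 ?(ltW e0)// ler_piMl.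
split=> // h.
have a1 : `|a| <= 1 by lra.
have a2 := sqr_le_abs a1.
have h1 : rho + a ^+ 2 + `|a| <= (2 + C) * rho by lra.
have h2 : eta * (rho + a ^+ 2 + `|a|) <= eps / 2 * rho.
  apply: (@le_trans _ _ (eta * ((2 + C) * rho))); first by rewrite ler_wpM2l// ltW.
  by rewrite mulrA ler_wpM2r.
by move: h; rewrite [X in _ < X](_ : _ = - (eps / 2 * rho)); [lra|rewrite /a; ring].
Qed.

(** On the sphere |z| = r either rho >= r^2/4 and the surplus eps rho/2 suffices, or z is nearly
    normal; in that case q >= 0 excludes the outward direction, so a >= r/2 and q itself is
    large. *)
Lemma lateral_arith a rho q D eps r : 0 < eps -> eps <= 1 -> 0 < r -> r <= 1 -> 0 <= rho ->
  0 <= D -> D * r <= 2^-1 -> rho + a ^+ 2 = r ^+ 2 -> 0 <= q -> `|q - a| <= D * rho ->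
  eps * r ^+ 2 / 8 <= q + eps / 2 * rho.
Proof.
move=> e0 e1 r0 r1 rho0 D0 Dr E q0; rewrite ler_norml => /andP[h1 h2].
have [rr|rr] := leP (r ^+ 2 / 4) rho.
  have : eps / 2 * (r ^+ 2 / 4) <= eps / 2 * rho by rewrite ler_wpM2l// divr_ge0// ltW.
  by lra.
have Dq : D * rho <= r / 8.
  have : D * rho <= D * (r ^+ 2 / 4) by rewrite ler_wpM2l// ltW.
  have : (D * r) * r <= 2^-1 * r by rewrite ler_wpM2r// ltW.
  by rewrite expr2; lra.
have a0 : r / 2 <= a.
  have am : - (r / 8) <= a by lra.
  have a34 : (r / 2) ^+ 2 <= a ^+ 2 by rewrite expr_div_n; lra.
  have : r / 2 <= `|a|.
    rewrite -(@ler_pXn2r _ 2)// ?nnegrE ?divr_ge0 ?(ltW r0)// real_normK ?num_real//.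
  by case: (ger0P a) => // an h; lra.
have h3 : eps * r ^+ 2 <= r.
  rewrite expr2 mulrA -[leRHS]mul1r ler_wpM2r ?(ltW r0)// -[leRHS]mulr1.
  by rewrite ler_pM// ltW.
have : 0 <= eps / 2 * rho by rewrite mulr_ge0// divr_ge0// ltW.
by lra.
Qed.

(* The choice K = (C + 1)^2 makes -2 K rho absorb the quadratic error terms. *)
Lemma gradient_arith C K r rho e : 0 <= C -> K = (C + 1) ^+ 2 -> 0 <= r -> K * r <= 4^-1 ->
  0 <= rho -> rho <= r ^+ 2 -> e <= (C + 2 * K * r) ^+ 2 * rho ->
  (1 - K * rho) ^+ 2 + e <= 1.
Proof.
move=> C0 KE r0 Kr rho0 rhor eC.
have K1 : 0 <= K by rewrite KE sqr_ge0.
have h1 : (C + 2 * K * r) ^+ 2 <= (C + 2^-1) ^+ 2.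
  rewrite ler_pXn2r// ?nnegrE ?addr_ge0 ?mulr_ge0// lerD2l -mulrA; lra.
have h2 : (C + 2 * K * r) ^+ 2 * rho <= (C + 2^-1) ^+ 2 * rho by rewrite ler_wpM2r.
have h3 : K ^+ 2 * rho <= 4^-1 ^+ 2.
  apply: (@le_trans _ _ ((K * r) ^+ 2)); first by rewrite exprMn ler_wpM2l// sqr_ge0.
  by rewrite ler_pXn2r// ?nnegrE ?mulr_ge0// invr_ge0.
have h4 : K ^+ 2 * rho * rho <= 4^-1 ^+ 2 * rho by rewrite ler_wpM2r.
have h5 : (C + 2^-1) ^+ 2 + 4^-1 ^+ 2 <= 2 * K by rewrite KE; nra.
have h6 : ((C + 2^-1) ^+ 2 + 4^-1 ^+ 2) * rho <= 2 * K * rho by rewrite ler_wpM2r.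
have -> : (1 - K * rho) ^+ 2 = 1 - 2 * K * rho + K ^+ 2 * rho * rho by ring.
by rewrite mulrDl in h6; lra.
Qed.

End BarrierArithmetic.

(** * Gradient and Hessian bounds for the quadratic barriers *)

Lemma subr_subr_cancel (V : zmodType) (a b c : V) : a - b - c - a = - (b + c).
Proof. by rewrite addrAC [a - b - a]addrAC subrr sub0r opprD. Qed.

Lemma addr_addr_cancel (V : zmodType) (a b c d : V) : a + b + (c + d) - a = b + c + d.
Proof. by rewrite addrAC [a + b - a]addrAC subrr add0r addrA. Qed.

Lemma oppr_opp_cancel (V : zmodType) (a b c : V) : - - (a + b + c) - a = b + c.
Proof. by rewrite opprK addrAC [a + b - a]addrAC subrr add0r. Qed.

Lemma four_parts (R : comRingType) (a : R) : a + a + a * 2 = 4 * a.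
Proof. ring. Qed.

Section BarrierGeometry.
Variables (R : realType) (n : nat).
Local Notation V := 'rV[R]_n.
Implicit Types (x y z v w : V) (O : set V).
Variables (nu : V) (A : 'M[R]_n) (CA : R).
Hypotheses (unit_nu : enorm nu = 1) (A_sym : A^T = A) (nuA : nu *m A = 0)
  (A_bound : `|A| <= CA).
Local Notation P := (orth_proj nu).
Local Notation C1 := (n%:R ^+ 2 * (CA + 2)).

Lemma enorm_orth_proj z : enorm (z *m P) ^+ 2 = enorm z ^+ 2 - dotr z nu ^+ 2.
Proof.
rewrite mul_orth_proj -dotr_sqr !(dotrBl, dotrBr, dotrZl, dotrZr) (dotrC nu z) !dotr_sqr unit_nu.
by rewrite expr1n; ring.
Qed.

Lemma qform_orth_projE z : qform P z = enorm z ^+ 2 - dotr z nu ^+ 2.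
Proof.
rewrite /qform /bform mul_orth_proj dotrBl dotrZl (dotrC nu) dotr_sqr; ring.
Qed.

Lemma qform_orth_proj_ge0 z : 0 <= qform P z.
Proof. by rewrite qform_orth_projE -enorm_orth_proj sqr_ge0. Qed.

Lemma qform_tangential B z : B^T = B -> nu *m B = 0 -> qform B z = qform B (z *m P).
Proof.
move=> BT nB; rewrite mul_orth_proj; set s := dotr z nu.
have zE : z = (z - s *: nu) + s *: nu by rewrite subrK.
rewrite {1}zE qformD// qformZ bformC// {2 3}/qform bformZl /bform nB !dotr0l.
by rewrite !mulr0 !addr0.
Qed.

Lemma qform_A_bound z : `|qform A z| <= C1 * qform P z.
Proof.
rewrite qform_tangential//; apply: le_trans (qform_bound _ _) _.
rewrite enorm_orth_proj -qform_orth_projE ler_wpM2r ?qform_orth_proj_ge0//.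
by rewrite ler_wpM2l ?sqr_ge0//; apply: le_trans A_bound _; rewrite lerDl.
Qed.

Lemma enorm_sqr_pythagoras (c : R) x y : dotr y x = 0 ->
  enorm (c *: x - y) ^+ 2 = c ^+ 2 * enorm x ^+ 2 + enorm y ^+ 2.
Proof.
move=> yx; rewrite -!dotr_sqr !(dotrBl, dotrBr, dotrZl, dotrZr) (dotrC x y) yx; ring.
Qed.

Let CA0 : 0 <= CA. Proof. by apply: le_trans A_bound. Qed.
Let C10 : 0 <= C1. Proof. by rewrite mulr_ge0 ?sqr_ge0// addr_ge0. Qed.

Lemma qform_qmat eps z : qform (qmat nu A eps) z = qform A z + eps * qform P z.
Proof.
rewrite /qform /bform /qmat mulmxDr -scalemxAr.
by move: (z *m A) (z *m P) => a b; rewrite dotrDl dotrZl.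
Qed.

Lemma enorm_orth_proj_le z : enorm (z *m P) <= enorm z.
Proof.
rewrite -(@ler_pXn2r _ 2)// ?nnegrE ?enorm_ge0// enorm_orth_proj.
by rewrite gerBl sqr_ge0.
Qed.

Lemma dotr_nu_le z : `|dotr z nu| <= enorm z.
Proof. by have := cauchy_schwarz z nu; rewrite unit_nu mulr1. Qed.

Lemma mx_norm_rank1 x y : `|x^T *m y| <= enorm x * enorm y.
Proof.
apply: mx_norm_le => [|i j]; first by rewrite mulr_ge0// enorm_ge0.
by rewrite mxE big_ord1 mxE normrM ler_pM// entry_le_enorm.
Qed.

Lemma mx_norm_orth_proj : `|P| <= 2.
Proof.
apply: le_trans (ler_normB _ _) _; rewrite -[2]/(1 + 1) lerD//; last first.
  by apply: le_trans (mx_norm_rank1 _ _) _; rewrite unit_nu mulr1.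
apply: mx_norm_le => // i j; rewrite !mxE; case: eqP => _; by rewrite ?mulr1n ?mulr0n ?normr1 ?normr0.
Qed.

Lemma qmat_bound eps : `|eps| <= 1 -> `|qmat nu A eps| <= CA + 2.
Proof.
move=> e1; apply: le_trans (ler_normD _ _) _; rewrite lerD// normrZ.
by rewrite -[leRHS]mul1r ler_pM// mx_norm_orth_proj.
Qed.

Lemma enorm_mul_qmat eps z : `|eps| <= 1 -> enorm (z *m qmat nu A eps) <= C1 * enorm (z *m P).
Proof.
move=> e1.
have -> : z *m qmat nu A eps = (z *m P) *m qmat nu A eps.
  by rewrite mul_orth_proj mulmxBl -scalemxAl nu_qmat// scaler0 subr0.
apply: le_trans (enorm_mulmx _ _) _; rewrite ler_wpM2r ?enorm_ge0//.
by rewrite ler_wpM2l ?sqr_ge0// qmat_bound.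
Qed.

Lemma qgrad_le1 eps K r z : `|eps| <= 1 -> K = (C1 + 1) ^+ 2 -> 0 <= r -> K * r <= 4^-1 ->
  enorm z <= r -> enorm (qgrad nu A eps K z) <= 1.
Proof.
move=> e1 KE r0 Kr zr.
have K0 : 0 <= K by rewrite KE sqr_ge0.
set s := dotr z nu; set rho := qform P z.
(* The gradient splits orthogonally as (1 - K rho) nu - e, with |e| <= (C1 + 2 K r)|z'|; by
   Pythagoras the normal loss has to pay for |e|^2. *)
pose e := z *m qmat nu A eps + (2 * K * s) *: (z *m P).
have gE : qgrad nu A eps K z = (1 - K * rho) *: nu - e.
  rewrite /qgrad /e -/s -/rho scalerBl scale1r scalerDr !scalerA opprD opprD.
  rewrite [(2 * s)]mulrC mulrA [K * s * 2]mulrC mulrA -!addrA; congr (_ + _).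
  by rewrite addrCA.
have enu : dotr e nu = 0.
  rewrite /e dotrDl dotrZl mul_orth_proj dotrBl dotrZl dotr_sqr unit_nu expr1n mulr1.
  rewrite subrr mulr0 addr0 dotr_mulmxl (qmat_sym _ _ A_sym) nu_qmat//.
  by rewrite dotr0r.
rewrite -(@ler_pXn2r _ 2)// ?nnegrE ?enorm_ge0// expr1n gE.
have -> : enorm ((1 - K * rho) *: nu - e) ^+ 2 = (1 - K * rho) ^+ 2 + enorm e ^+ 2.
  by rewrite enorm_sqr_pythagoras// unit_nu expr1n mulr1.
have rho0 : 0 <= rho by exact: qform_orth_proj_ge0.
have rhoE : rho = enorm (z *m P) ^+ 2 by rewrite enorm_orth_proj -qform_orth_projE.
apply: (@gradient_arith _ C1 K r) => //.
  rewrite rhoE ler_pXn2r// ?nnegrE ?enorm_ge0//; apply: le_trans zr; exact: enorm_orth_proj_le.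
rewrite rhoE -exprMn ler_pXn2r// ?nnegrE ?enorm_ge0//; last first.
  by rewrite mulr_ge0 ?enorm_ge0// addr_ge0// !mulr_ge0.
apply: le_trans (enormD _ _) _; rewrite [leRHS]mulrDl; apply: lerD; first exact: enorm_mul_qmat.
rewrite enormZ ler_wpM2r ?enorm_ge0// normrM ger0_norm ?mulr_ge0//.
by rewrite ler_wpM2l ?mulr_ge0//; apply: le_trans (dotr_nu_le _) zr.
Qed.

Lemma qhess_close eps K z : `|- qhess nu A eps K z - A| <= 2 * `|eps| + 8 * `|K| * enorm z.
Proof.
rewrite /qhess /qmat oppr_opp_cancel.
apply: le_trans (ler_normD _ _) _; rewrite !normrZ; apply: lerD.
  by rewrite mulrC ler_wpM2r// mx_norm_orth_proj.
rewrite ger0_norm//.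
have -> : 8 * `|K| * enorm z = 2 * `|K| * (4 * enorm z) by ring.
rewrite ler_wpM2l ?mulr_ge0//.
have zz := enorm_orth_proj_le z.
have h1 : `|(z *m P)^T *m nu| <= enorm z by apply: le_trans (mx_norm_rank1 _ _) _; rewrite unit_nu mulr1.
have h2 : `|nu^T *m (z *m P)| <= enorm z by apply: le_trans (mx_norm_rank1 _ _) _; rewrite unit_nu mul1r.
have h3 : `|dotr z nu *: P| <= enorm z * 2 by rewrite normrZ ler_pM ?dotr_nu_le ?mx_norm_orth_proj.
apply: le_trans (ler_normD _ _) _.
apply: (@le_trans _ _ (enorm z + enorm z + enorm z * 2)); last by rewrite four_parts.
by apply: lerD => //; apply: le_trans (ler_normD _ _) _; exact: lerD.
Qed.

Lemma qgrad_close eps K z : `|eps| <= 1 -> enorm z <= 1 ->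
  enorm (qgrad nu A eps K z - nu) <= (C1 + 3 * `|K|) * enorm z.
Proof.
move=> e1 z1.
have -> : qgrad nu A eps K z - nu = - (z *m qmat nu A eps + K *: (qform P z *: nu + (2 * dotr z nu) *: (z *m P))).
  by rewrite /qgrad; move: (z *m qmat nu A eps) (K *: _) => a b; rewrite subr_subr_cancel.
rewrite enormN; apply: le_trans (enormD _ _) _; rewrite [leRHS]mulrDl; apply: lerD.
  apply: le_trans (enorm_mul_qmat _ e1) _; rewrite ler_wpM2l//; exact: enorm_orth_proj_le.
rewrite enormZ -mulrA mulrCA ler_wpM2l//.
have z0 := enorm_ge0 z.
apply: le_trans (enormD _ _) _; rewrite !enormZ unit_nu mulr1.
have h1 : `|qform P z| <= enorm z.
  rewrite ger0_norm ?qform_orth_proj_ge0// qform_orth_projE.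
  apply: (@le_trans _ _ (enorm z ^+ 2)); first by rewrite gerBl sqr_ge0.
  by rewrite expr2 ler_piMl.
have h2 : `|2 * dotr z nu| * enorm (z *m P) <= 2 * enorm z.
  rewrite normrM ger0_norm// -mulrA ler_wpM2l//.
  apply: (@le_trans _ _ (enorm z * enorm z)).
    by apply: ler_pM => //; [exact: enorm_ge0|exact: dotr_nu_le|exact: enorm_orth_proj_le].
  by rewrite ler_piMl.
apply: le_trans (lerD h1 h2) _.
by have -> : enorm z + 2 * enorm z = 3 * enorm z by ring.
Qed.

Lemma rank1_close x : enorm (x - nu) <= 1 -> `|x^T *m x - nu^T *m nu| <= 3 * enorm (x - nu).
Proof.
move=> x1; set e := x - nu.
have -> : x^T *m x - nu^T *m nu = nu^T *m e + e^T *m nu + e^T *m e.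
  have -> : x = nu + e by rewrite /e addrC subrK.
  move: e => {x1} e.
  rewrite [(nu + e)^T]linearD /= mulmxDl !mulmxDr; move: (nu^T *m nu) (nu^T *m e) (e^T *m nu) (e^T *m e) => a b c d.
  by rewrite addr_addr_cancel.
apply: le_trans (ler_normD _ _) _.
have h1 : `|nu^T *m e + e^T *m nu| <= enorm e + enorm e.
  apply: le_trans (ler_normD _ _) _; apply: lerD; apply: le_trans (mx_norm_rank1 _ _) _.
    by rewrite unit_nu mul1r.
  by rewrite unit_nu mulr1.
have h2 : `|e^T *m e| <= enorm e.
  apply: le_trans (mx_norm_rank1 _ _) _; by rewrite ler_piMl// enorm_ge0.
apply: le_trans (lerD h1 h2) _.
by have -> : 3 * enorm e = enorm e + enorm e + enorm e by ring.
Qed.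

End BarrierGeometry.


(** * Choice of radii and comparison of the barriers with the distance *)

Lemma exists_small (R : realFieldType) (a b c e : R) : 0 < a -> 0 < b -> 0 < c -> 0 < e ->
  exists2 r : R, 0 < r & [/\ r <= a, r <= b & c * r <= e].
Proof.
move=> a0 b0 c0 e0; exists (Num.min a (Num.min b (e / c))); first by rewrite !lt_min a0 b0 divr_gt0.
split; rewrite ?ge_min ?lexx ?orbT//.
by rewrite mulrC -ler_pdivlMr// !ge_min lexx !orbT.
Qed.

Lemma osc_tolerance (R : realFieldType) (eps C : R) : 0 < eps -> 0 <= C ->
  exists2 eta : R, 0 < eta & eta * ((1 + C) * (4 / eps) + 2) <= 2^-1 /\ eta * (2 + C) <= eps / 2.
Proof.
move=> e0 C0; have X0 : 0 < (1 + C) * (4 / eps) + 2.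
  by rewrite ltr_wpDl// mulr_ge0 ?addr_ge0// divr_ge0// ltW.
have h2 : (0 : R) < 2^-1 by rewrite invr_gt0.
have [eta eta0 [h _ h']] := @exists_small R (2^-1 / ((1 + C) * (4 / eps) + 2)) 1 (2 + C) (eps / 2)
  (divr_gt0 h2 X0) ltr01 (ltr_wpDr C0 (ltr0n _ 2)) (divr_gt0 e0 (ltr0n _ 2)).
exists eta => //; split; last by rewrite mulrC.
by rewrite -ler_pdivlMr.
Qed.

Lemma barrier_radii (R : realFieldType) (eps C r : R) : 0 < eps -> 2 * eps <= 1 -> 0 <= C -> 0 < r ->
  (C + 1 + (C + 1) ^+ 2) * r <= eps / 8 ->
  [/\ eps <= 1, (C + 1) ^+ 2 * r <= eps / 8, (C + 1) * r <= eps / 8 & r <= eps / 8].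
Proof.
move=> e0 e1 C0 r0 h; have h1 : 0 <= (C + 1) ^+ 2 * r by rewrite mulr_ge0 ?sqr_ge0// ltW.
have h2 : 0 <= C * r by rewrite mulr_ge0// ltW.
by rewrite mulrDl in h; split; lra.
Qed.

Section OsculatingBarriers.
Variables (R : realType) (n : nat).
Local Notation V := 'rV[R]_n.
Implicit Types (x y z v w : V).
Variables (O : set V) (HO : bounded_domain O) (n0 : (0 < n)%N).
Variables (xb nu : V) (A : 'M[R]_n) (CA eps eta r r1 : R).
Hypotheses (bx : bdry O xb) (unit_nu : enorm nu = 1) (A_sym : A^T = A) (nuA : nu *m A = 0)
  (A_bound : `|A| <= CA) (CA0 : 0 <= CA) (eps0 : 0 < eps) (eps1 : 2 * eps <= 1).
Local Notation P := (orth_proj nu).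
Local Notation C1 := (n%:R ^+ 2 * (CA + 2)).
Local Notation K := ((C1 + 1) ^+ 2).
Hypotheses (eta0 : 0 < eta) (eta1 : eta * ((1 + C1) * (4 / eps) + 2) <= 2^-1)
  (eta2 : eta * (2 + C1) <= eps / 2) (r10 : 0 < r1) (r1r : 8 * r1 <= r)
  (Dr : (C1 + 1 + K) * r1 <= eps / 8) (osc : osculates O xb nu A eta r).

Let C10 : 0 <= C1. Proof. by rewrite mulr_ge0 ?sqr_ge0// addr_ge0. Qed.
Let K1 : 1 <= K. Proof. by apply: exprn_ege1; rewrite lerDr. Qed.
Let K0 : 0 <= K. Proof. exact: le_trans K1. Qed.
Let radii : [/\ eps <= 1, K * r1 <= eps / 8, (C1 + 1) * r1 <= eps / 8 & r1 <= eps / 8].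
Proof. exact: barrier_radii. Qed.

Local Ltac slra :=
  let a := fresh in have [? ? ? ?] := radii; pose proof eps0; pose proof eps1; pose proof r10;
  pose proof r1r; pose proof C10; pose proof K1; lra.

Lemma qfunE e L z : qfun nu A e L z =
  dotr z nu - 2^-1 * (qform A z + e * qform P z) - L * (dotr z nu * qform P z).
Proof. by rewrite /qfun qform_qmat. Qed.

Lemma qfun_eps e e' L z : qfun nu A (e + e') L z = qfun nu A e L z - e' / 2 * qform P z.
Proof. by rewrite !qfunE; field. Qed.

Let enormE z : enorm z ^+ 2 = qform P z + dotr z nu ^+ 2.
Proof. by rewrite qform_orth_projE// subrK. Qed.

Let rho0 z : 0 <= qform P z. Proof. exact: qform_orth_proj_ge0. Qed.

(** Stated up to radius 2 r1 because the boundary point nearest to xb + z, for |z| <= r1, may be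
    that far from xb. *)
Lemma upper_inside z : enorm z <= 2 * r1 -> 0 < qfun nu A eps K z -> O (xb + z).
Proof.
move=> zr; rewrite qfunE => q0.
have zr' : enorm z < r by slra.
have [h _] := osc zr'; apply: h; rewrite enormE.
apply: (@upper_inside_arith _ _ _ _ eps C1 K _ (2 * r1)) => //.
- by apply: le_trans zr; exact: dotr_nu_le.
- by slra.
- by rewrite mulrCA; slra.
- exact: qform_A_bound.
Qed.

(** At the nearest boundary point [qfun] is nonpositive, as otherwise that point would be in O; and
    [qfun] is 1-Lipschitz on the ball of radius 2 r1. *)
Lemma upper_le_dist z : enorm z <= r1 -> qfun nu A eps K z <= dist_bd O (xb + z).
Proof.
move=> zr; have [y by_ dE] := dist_bd_attained HO n0 (xb + z).
have Oo : open O by case: HO.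
have nOy : ~ O y by have /(bdryP _ Oo)[] := by_.
have dz : dist_bd O (xb + z) <= enorm z.
  by have := @dist_bd_le R n O (xb + z) xb bx; rewrite [xb + z]addrC addrK.
pose z2 := y - xb.
have zz2 : xb + z - y = z - z2 by rewrite /z2 opprB addrCA addrA.
have z2r : enorm z2 <= 2 * r1.
  have -> : z2 = z - (z - z2) by rewrite opprB addrC subrK.
  by apply: le_trans (enormD _ _) _; rewrite enormN -zz2 -dE; slra.
have q2 : qfun nu A eps K z2 <= 0.
  rewrite leNgt; apply/negP => /(upper_inside z2r).
  by rewrite /z2 addrC subrK.
have [t /andP[t0 t1] Et] := @MVT_line R n (qfun nu A eps K) z2 (z - z2)
  (fun w => dotr (qgrad nu A eps K w) (z - z2)) (fun t _ => qfun_derive nu eps K A_sym _ _).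
rewrite [z2 + _]addrC subrK in Et.
have : enorm (z2 + t *: (z - z2)) <= 2 * r1.
  have -> : z2 + t *: (z - z2) = (1 - t) *: z2 + t *: z.
    by rewrite scalerBr scalerBl scale1r addrA addrAC.
  apply: le_trans (enormD _ _) _; rewrite !enormZ !ger0_norm ?subr_ge0//.
  have h1 : (1 - t) * enorm z2 <= (1 - t) * (2 * r1) by rewrite ler_wpM2l// subr_ge0.
  have h2 : t * enorm z <= t * (2 * r1) by rewrite ler_wpM2l//; slra.
  by rewrite mulrBl mul1r in h1; slra.
move=> /(@qgrad_le1 R n nu A CA unit_nu A_sym nuA A_bound eps K (2 * r1)) g1.
have {}g1 : enorm (qgrad nu A eps K (z2 + t *: (z - z2))) <= 1.
  apply: g1 => //; [by rewrite gtr0_norm//; slra|by rewrite mulr_ge0// ltW|].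
  by rewrite mulrCA; slra.
have : dotr (qgrad nu A eps K (z2 + t *: (z - z2))) (z - z2) <= dist_bd O (xb + z).
  apply: le_trans (dotr_le _ _) _; rewrite dE zz2 -[leRHS]mul1r.
  by apply: ler_wpM2r g1; exact: enorm_ge0.
by rewrite -Et; slra.
Qed.

Lemma qfun_near_normal e L z : `|e| <= 1 -> 0 <= L -> L <= K -> enorm z <= 1 ->
  `|qfun nu A e L z - dotr z nu| <= (C1 + 1 + K) * qform P z.
Proof.
move=> ee L0 LK z1; rewrite qfunE.
have -> : dotr z nu - 2^-1 * (qform A z + e * qform P z) - L * (dotr z nu * qform P z) - dotr z nu
  = - (2^-1 * (qform A z + e * qform P z) + L * (dotr z nu * qform P z)) by ring.
rewrite normrN; apply: le_trans (ler_normD _ _) _; rewrite [leRHS]mulrDl; apply: lerD.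
  rewrite normrM ger0_norm// mulrDl mul1r; apply: (@le_trans _ _ (1 * `|qform A z + e * qform P z|)).
    by rewrite ler_wpM2r// invf_le1// ler1n.
  rewrite mul1r; apply: le_trans (ler_normD _ _) _; apply: lerD; first exact: qform_A_bound.
  by rewrite normrM (ger0_norm (rho0 z)) ler_piMl.
rewrite normrM (ger0_norm L0); apply: ler_pM => //.
rewrite normrM (ger0_norm (rho0 z)) ler_piMl//.
by apply: le_trans z1; exact: dotr_nu_le.
Qed.

Let lateral q z : enorm z = r1 -> 0 <= q -> `|q - dotr z nu| <= (C1 + 1 + K) * qform P z ->
  eps * r1 ^+ 2 / 8 <= q + eps / 2 * qform P z.
Proof.
move=> zr q0 qz; apply: (@lateral_arith _ (dotr z nu) _ _ (C1 + 1 + K)) => //.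
- by slra.
- by slra.
- by rewrite addr_ge0// addr_ge0.
- by slra.
- by rewrite -zr enormE.
Qed.

Lemma upper_lateral z : enorm z = r1 -> 0 <= qfun nu A (2 * eps) K z ->
  eps * r1 ^+ 2 / 8 <= dist_bd O (xb + z).
Proof.
move=> zr q0; have zr' : enorm z <= r1 by rewrite zr.
apply: le_trans (upper_le_dist zr').
have -> : qfun nu A eps K z = qfun nu A (2 * eps) K z + eps / 2 * qform P z.
  by rewrite [2 * eps]mulr_natl mulr2n qfun_eps subrK.
apply: lateral => //; apply: qfun_near_normal => //; first by rewrite ger0_norm// mulr_ge0// ltW.
by rewrite zr; slra.
Qed.

Lemma lower_inside z : enorm z <= r1 -> O (xb + z) -> 0 <= qfun nu A (- eps) 0 z.
Proof.
move=> zr Oz; rewrite qfunE mul0r subr0 mulNr.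
have zr' : enorm z < r by slra.
have [_ h] := osc zr'; have {}h := h Oz; rewrite enormE in h.
apply: (@lower_inside_arith _ _ _ _ _ C1 eta) => //; last exact: qform_A_bound.
by apply: le_trans (dotr_nu_le unit_nu z) _; slra.
Qed.

(** With K = 0, [qfun] is <z, nu> minus a function of the tangential part. Moving from z by its
    value q against nu therefore lands exactly on the zero set, which lies outside O, so the
    distance is at most q. *)
Lemma lower_ge_dist z : enorm z <= r1 -> O (xb + z) -> dist_bd O (xb + z) <= qfun nu A (- eps) 0 z.
Proof.
move=> zr Oz; have q0 := lower_inside zr Oz.
set q := qfun _ _ _ _ _ in q0 *.
pose z' := z - q *: nu.
have aE : dotr z' nu = 2^-1 * (qform A z - eps * qform P z).
  rewrite /z' dotrBl dotrZl dotr_sqr unit_nu /q qfunE; ring.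
have projE : z' *m P = z *m P.
  by rewrite /z' mulmxBl -scalemxAl nu_orth_proj// scaler0 subr0.
have AE : qform A z' = qform A z.
  by rewrite (qform_tangential z' A_sym nuA) projE -(qform_tangential z A_sym nuA).
have PE : qform P z' = qform P z.
  by rewrite !qform_orth_projE// -!enorm_orth_proj// projE.
have rz : (C1 + 1) * qform P z <= r1.
  have h1 : qform P z <= r1 * r1.
    rewrite qform_orth_projE//; apply: (@le_trans _ _ (enorm z ^+ 2)).
      by rewrite gerBl sqr_ge0.
    by rewrite expr2 ler_pM// enorm_ge0.
  apply: (@le_trans _ _ ((C1 + 1) * (r1 * r1))); first by rewrite ler_wpM2l// addr_ge0.
  rewrite mulrA -[leRHS]mul1r ler_wpM2r ?(ltW r10)//; slra.
have [e1 _ _ _] := radii.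
have [||a1 a2] := @lower_exit_arith R (qform A z) (qform P z) eps C1 eta eps0 e1 C10 (rho0 z) eta0
  (qform_A_bound unit_nu A_sym nuA A_bound z).
- by slra.
- exact: eta2.
have nO : ~ O (xb + z').
  move=> Oz'; apply: a2.
  have z'r : enorm z' < r.
    have : `|q| <= `|dotr z nu| + `|dotr z' nu|.
      have -> : q = dotr z nu - dotr z' nu by rewrite /z' dotrBl dotrZl dotr_sqr unit_nu; ring.
      exact: ler_normB.
    have := dotr_nu_le unit_nu z; rewrite aE => h1 h2.
    apply: le_lt_trans (enormD _ _) _; rewrite enormN enormZ unit_nu mulr1; slra.
  have [_ h] := osc z'r; have {}h := h Oz'.
  by rewrite enormE PE AE aE in h.
have := dist_bd_outside HO Oz nO.
rewrite [xb + z]addrC [xb + z']addrC opprD addrACA subrr addr0 /z' addrAC subrr add0r enormN enormZ unit_nu mulr1.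
by rewrite ger0_norm.
Qed.

Lemma lower_lateral z : enorm z = r1 -> O (xb + z) -> eps * r1 ^+ 2 / 8 <= qfun nu A (- (2 * eps)) 0 z.
Proof.
move=> zr Oz; have zr' : enorm z <= r1 by rewrite zr.
have -> : qfun nu A (- (2 * eps)) 0 z = qfun nu A (- eps) 0 z + eps / 2 * qform P z.
  by rewrite [2 * eps]mulr_natl mulr2n opprD qfun_eps !mulNr opprK.
apply: lateral => //; first exact: lower_inside.
apply: qfun_near_normal => //; first by rewrite normrN gtr0_norm//; slra.
by rewrite zr; slra.
Qed.

Lemma upper_le_dist2 z : enorm z <= r1 -> qfun nu A (2 * eps) K z <= dist_bd O (xb + z).
Proof.
move=> /upper_le_dist; apply: le_trans.
by rewrite [2 * eps]mulr_natl mulr2n qfun_eps gerBl mulr_ge0// divr_ge0// ltW.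
Qed.

Lemma upper_inside2 z : enorm z <= r1 -> 0 < qfun nu A (2 * eps) K z -> O (xb + z).
Proof.
move=> zr q0; apply: upper_inside; first by slra.
apply: lt_le_trans q0 _.
by rewrite [2 * eps]mulr_natl mulr2n qfun_eps gerBl mulr_ge0// divr_ge0// ltW.
Qed.

Lemma lower_ge_dist2 z : enorm z <= r1 -> O (xb + z) ->
  dist_bd O (xb + z) <= qfun nu A (- (2 * eps)) 0 z.
Proof.
move=> zr Oz; apply: le_trans (lower_ge_dist zr Oz) _.
by rewrite [2 * eps]mulr_natl mulr2n opprD qfun_eps !mulNr opprK lerDl mulr_ge0// divr_ge0// ltW.
Qed.

Lemma lower_le z : enorm z <= r1 -> qfun nu A (- (2 * eps)) 0 z <= 2 * r1.
Proof.
move=> zr; have z1 : enorm z <= 1 by slra.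
have e2 : `|- (2 * eps)| <= 1 by rewrite normrN gtr0_norm ?mulr_gt0.
have h := le_trans (ler_norm _) (qfun_near_normal e2 (lexx 0) K0 z1).
have h1 : qform P z <= r1 * r1.
  rewrite qform_orth_projE//; apply: (@le_trans _ _ (enorm z ^+ 2)).
    by rewrite gerBl sqr_ge0.
  by rewrite expr2 ler_pM// enorm_ge0.
have h2 : (C1 + 1 + K) * qform P z <= eps / 8 * r1.
  apply: (@le_trans _ _ ((C1 + 1 + K) * (r1 * r1))).
    by rewrite ler_wpM2l// addr_ge0// addr_ge0.
  by rewrite mulrA ler_wpM2r// ltW.
have h3 : eps / 8 * r1 <= r1 by rewrite -[leRHS]mul1r ler_wpM2r ?(ltW r10)//; slra.
have h4 := le_trans (ler_norm _) (dotr_nu_le unit_nu z).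
by slra.
Qed.

Lemma osculating_barriers z : enorm z <= r1 ->
  [/\ 0 < qfun nu A (2 * eps) K z -> O (xb + z),
      qfun nu A (2 * eps) K z <= dist_bd O (xb + z),
      enorm z = r1 -> 0 <= qfun nu A (2 * eps) K z -> eps * r1 ^+ 2 / 8 <= dist_bd O (xb + z),
      O (xb + z) -> dist_bd O (xb + z) <= qfun nu A (- (2 * eps)) 0 z &
      enorm z = r1 -> O (xb + z) -> eps * r1 ^+ 2 / 8 <= qfun nu A (- (2 * eps)) 0 z] /\
  qfun nu A (- (2 * eps)) 0 z <= 2 * r1.
Proof.
move=> zr; split; last exact: lower_le.
split; [exact: upper_inside2|exact: upper_le_dist2|exact: upper_lateral|
  exact: lower_ge_dist2|exact: lower_lateral].
Qed.

End OsculatingBarriers.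

(** All corrections vanish along the normal: with [nearest_point_normal], the barrier based at the
    foot of x is evaluated at the distance of x itself. *)
Lemma qfun_normal (R : realType) n (nu : 'rV[R]_n) A e L t : enorm nu = 1 -> nu *m A = 0 ->
  qfun nu A e L (t *: nu) = t.
Proof.
move=> nu1 nA; have PE : qform (orth_proj nu) (t *: nu) = 0.
  by rewrite qformZ qform_orth_projE// dotr_sqr nu1 !expr1n subrr mulr0.
rewrite qfunE PE qformZ /qform /bform nA dotr0l dotrZl dotr_sqr nu1; ring.
Qed.

Section UniformBarriers.
Variables (R : realType) (n : nat).
Local Notation V := 'rV[R]_n.
Variable O : set V.
Hypotheses (HO : bounded_domain O) (Hbd : C31_boundary O) (n0 : (0 < n)%N).
Variable CA : R.
Hypotheses (CA0 : 0 <= CA) (hCA : forall xb nu g r', bdry O xb -> bdry_chart O xb nu g r' -> `|hess g 0| <= CA).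
Local Notation K := ((n%:R ^+ 2 * (CA + 2) + 1) ^+ 2 : R).

Lemma chart_unit xb (nu : V) g r : bdry_chart O xb nu g r -> enorm nu = 1.
Proof. by case=> -[]. Qed.

Lemma chart_hess_data xb (nu : V) g r : bdry_chart O xb nu g r ->
  (hess g 0)^T = hess g 0 /\ nu *m hess g 0 = 0.
Proof.
move=> H; have s : (hess g 0)^T = hess g 0.
  by apply: (chart_hess_sym H); rewrite enorm0; case: H => -[].
by split => //; apply: (chart_hess_normal H); rewrite enorm0; case: H => -[].
Qed.

Lemma uniform_barriers (eps rmax : R) : 0 < eps -> 2 * eps <= 1 -> 0 < rmax ->
  exists2 r1 : R, 0 < r1 <= rmax & exists2 c : R, 0 < c & forall xb nu g r' z,
    bdry O xb -> bdry_chart O xb nu g r' -> enorm z <= r1 ->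
    [/\ 0 < qfun nu (hess g 0) (2 * eps) K z -> O (xb + z),
        qfun nu (hess g 0) (2 * eps) K z <= dist_bd O (xb + z),
        enorm z = r1 -> 0 <= qfun nu (hess g 0) (2 * eps) K z -> c <= dist_bd O (xb + z),
        O (xb + z) -> dist_bd O (xb + z) <= qfun nu (hess g 0) (- (2 * eps)) 0 z &
        enorm z = r1 -> O (xb + z) -> c <= qfun nu (hess g 0) (- (2 * eps)) 0 z] /\
    qfun nu (hess g 0) (- (2 * eps)) 0 z <= 2 * r1.
Proof.
move=> eps0 eps1 rm0.
have C10 : 0 <= n%:R ^+ 2 * (CA + 2) :> R by rewrite mulr_ge0 ?sqr_ge0// addr_ge0.
have [eta eta0 [eta1 eta2]] := osc_tolerance eps0 C10.
have [r r0 hr] := uniform_osculates HO Hbd eta0.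
have D0 : 0 < n%:R ^+ 2 * (CA + 2) + 1 + K by rewrite ltr_wpDr ?sqr_ge0// ltr_wpDl.
have [r1 r10 [r1r r1m Dr]] := exists_small (divr_gt0 r0 (ltr0n _ 8)) rm0 D0 (divr_gt0 eps0 (ltr0n _ 8)).
exists r1; first by rewrite r10.
have r1r' : 8 * r1 <= r by rewrite mulrC -ler_pdivlMr.
exists (eps * r1 ^+ 2 / 8); first by rewrite divr_gt0// mulr_gt0// exprn_gt0.
move=> xb nu g r' z bx H zr.
have osc := hr _ _ _ _ bx H; have nu1 := chart_unit H; have [As nA] := chart_hess_data H.
have Ab := hCA bx H.
exact: (osculating_barriers HO n0 bx nu1 As nA Ab CA0 eps0 eps1 eta0 eta1 eta2 r10 r1r' Dr osc zr).
Qed.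

End UniformBarriers.

(** * Comparison *)

Section CompactRegions.
Variables (R : realType) (n : nat).
Local Notation V := 'rV[R]_n.
Implicit Types (x y z : V) (K : set V) (g : V -> R).

Lemma closed_superlevel g (c : R) : continuous g -> closed [set y | c <= g y].
Proof. by move=> gc; apply: (@preimage_closed _ _ g [set t | c <= t]) => //; exact: closed_ge. Qed.

Lemma closed_sublevel g (c : R) : continuous g -> closed [set y | g y <= c].
Proof. by move=> gc; apply: (@preimage_closed _ _ g [set t | t <= c]) => //; exact: closed_le. Qed.

Lemma enorm_sub_continuous x : continuous (fun y => enorm (y - x)).
Proof.
move=> y; apply/continuous_enormP => e e0; exists e => // z zy; apply: le_lt_trans zy.
rewrite ler_norml; apply: ler_between.
  by apply: le_trans (enormB_triangle z y x) _; rewrite (enormC y z) addrC.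
by rewrite [leRHS]addrC; exact: enormB_triangle.
Qed.

Lemma closed_in_ball_compact K x (r : R) : closed K -> (forall y, K y -> enorm (y - x) <= r) -> compact K.
Proof.
move=> Kc Kr; apply: bounded_closed_compact => //.
exists (r + enorm x); split; first exact: num_real.
move=> M KM y /Kr yr.
apply: le_trans (mx_norm_le_enorm _) _; apply: le_trans (ltW KM).
by rewrite -{1}(subrK x y); apply: le_trans (enormD _ _) _; rewrite lerD2r.
Qed.

Lemma max_on_compact K g : K !=set0 -> compact K -> (forall y, K y -> {for y, continuous g}) ->
  exists2 x, K x & forall y, K y -> g y <= g x.
Proof.
move=> K0 Kc gc; have [|x xK h] := @EVT_max_rV R n g K K0 Kc.
  by apply: continuous_in_subspaceT => y; rewrite inE => /gc.
by exists x; [rewrite inE in xK|move=> y Ky; apply: h; rewrite inE].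
Qed.

Lemma min_on_compact K g : K !=set0 -> compact K -> (forall y, K y -> {for y, continuous g}) ->
  exists2 x, K x & forall y, K y -> g x <= g y.
Proof.
move=> K0 Kc gc; have [|x xK h] := @EVT_min_rV R n g K K0 Kc.
  by apply: continuous_in_subspaceT => y; rewrite inE => /gc.
by exists x; [rewrite inE in xK|move=> y Ky; apply: h; rewrite inE].
Qed.

Lemma bounded_on_compact K g : compact K -> (forall y, K y -> {for y, continuous g}) ->
  exists B : R, forall y, K y -> g y <= B.
Proof.
move=> Kc gc; have [K0|/set0P/negP/negPn/eqP KE] := pselect (K !=set0); last first.
  by exists 0 => y; rewrite KE.
by have [x _ h] := max_on_compact K0 Kc gc; exists (g x).
Qed.

Lemma dist_ge_compact (O : set V) (d : R) : bounded_domain O -> (0 < n)%N -> 0 < d ->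
  compact [set x | O x /\ d <= dist_bd O x].
Proof.
move=> HO n0 d0; have [Oo _ _ [M OM]] := HO.
apply: (@closed_in_ball_compact _ 0 M); last by move=> y [/OM]; rewrite subr0.
(* A closure point outside O is a boundary point and has distance 0 < d. *)
have -> : [set x | O x /\ d <= dist_bd O x] = closure O `&` [set x | d <= dist_bd O x].
  apply/seteqP; split => x [Ox dx]; split => //; first exact: subset_closure.
  apply: contrapT => nOx.
  have bx : bdry O x by split => // /interior_subset.
  by have := dist_bd_le x bx; rewrite subrr enorm0 leNgt (lt_le_trans d0).
apply: closedI; first exact: closed_closure.
by apply: closed_superlevel => x; exact: dist_bd_continuous.
Qed.

End CompactRegions.

Section Comparison.
Variables (R : realType) (n k : nat).
Local Notation V := 'rV[R]_n.
Implicit Types (x y z : V).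
Variables (O : set V) (b u : V -> R) (f : R -> R).
Hypotheses (HO : bounded_domain O) (n0 : (0 < n)%N) (u_cont : forall x, O x -> {for x, continuous u})
  (u_pos : forall x, O x -> 0 < u x) (b_pos : forall x, O x -> 0 < b x)
  (f_mono : forall s t : R, 0 < s -> s <= t -> f s <= f t).
Variables (xb nu : V) (A : 'M[R]_n) (e L : R) (h h1 h2 : R -> R) (t0 sg r1 : R).
Hypotheses (A_sym : A^T = A)
  (hd : forall t : R, 0 < t < t0 -> is_derive t 1 h (h1 t))
  (h1d : forall t : R, 0 < t < t0 -> is_derive t 1 h1 (h2 t))
  (h2c : forall t : R, 0 < t < t0 -> {for t, continuous h2})
  (h_pos : forall t : R, 0 < t < t0 -> 0 < h t).

Let Oo : open O. Proof. by case: HO. Qed.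
Let T y := qfun nu A e L (y - xb) + sg.
Let w y := h (T y).

Definition barrier_matrix y : 'M[R]_n :=
  h2 (T y) *: ((qgrad nu A e L (y - xb))^T *m qgrad nu A e L (y - xb)) + h1 (T y) *: qhess nu A e L (y - xb).

Definition barrier_region : set V := [set y | [/\ O y, enorm (y - xb) < r1 & 0 < T y < t0]].
Hypothesis admissible : forall y, barrier_region y -> Gamma k (eigs (barrier_matrix y)).

Let T_cont : continuous T.
Proof.
move=> y; apply/continuous_enormP => d d0.
have /continuous_enormP/(_ d d0)[s s0 hs] := @qfun_continuous_at R n nu A e L (y - xb).
exists s => // z zy; have := hs (z - xb); rewrite opprB addrA subrK => /(_ zy).
have -> // : T z - T y = qfun nu A e L (z - xb) - qfun nu A e L (y - xb) by rewrite /T; ring.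
Qed.

Let near_T_lt (c : R) x : T x < c -> \forall y \near x, T y < c.
Proof. by move=> Tx; exact: (cvgr_lt (T x) (@T_cont x) c Tx). Qed.

Let near_T_gt (c : R) x : c < T x -> \forall y \near x, c < T y.
Proof. by move=> Tx; exact: (cvgr_gt (T x) (@T_cont x) c Tx). Qed.

Let near_ball x : enorm (x - xb) < r1 -> \forall y \near x, enorm (y - xb) < r1.
Proof. by move=> xr; exact: (cvgr_lt _ (@enorm_sub_continuous R n xb x) r1 xr). Qed.

Lemma barrier_region_open : open barrier_region.
Proof.
rewrite openE => x [Ox xr /andP[T0 T1]]; rewrite /interior.
near=> y; split; last (apply/andP; split); near: y;
  [exact: open_nbhs_nbhs|exact: near_ball|exact: near_T_gt|exact: near_T_lt].
Unshelve. all: by end_near. Qed.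

Let region_T y : barrier_region y -> 0 < T y < t0. Proof. by case. Qed.

Let psi c := barrier nu A e L h xb sg c.

Let psiE c y : psi c y = w y + c. Proof. by []. Qed.

Let psi_C2 c : Ck_on 2 barrier_region (psi c).
Proof. exact: (barrier_C2 A_sym hd h1d h2c c barrier_region_open region_T). Qed.

Let psi_hess c y : barrier_region y -> hess (psi c) y = barrier_matrix y.
Proof. exact: (barrier_hess A_sym hd h1d c barrier_region_open region_T). Qed.

Let psi_adm c : k_admissible k barrier_region (psi c).
Proof. by move=> y Uy; rewrite psi_hess//; exact: admissible. Qed.

(** Viscosity tests require equality at x0; shifting the barrier by the constant u x0 - w x0
    arranges this without changing the Hessian. *)
Lemma touching_sub x0 : visc_sub k O b f u -> barrier_region x0 ->
  (\forall x \near x0, u x - w x <= u x0 - w x0) -> b x0 * f (u x0) <= Sk k (barrier_matrix x0).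
Proof.
move=> sub Ux near_max; pose c := u x0 - w x0.
have pE : psi c x0 = u x0 by rewrite psiE addrC subrK.
have Ox : O x0 by case: Ux.
have := sub x0 Ox barrier_region (psi c) barrier_region_open Ux (psi_C2 c) (@psi_adm c) pE.
rewrite pE psi_hess//; apply; apply: filterS near_max => x hx.
by rewrite subrr psiE opprD addrA subr_le0.
Qed.

Lemma touching_super x0 : visc_super k O b f u -> barrier_region x0 ->
  (\forall x \near x0, u x0 - w x0 <= u x - w x) -> Sk k (barrier_matrix x0) <= b x0 * f (u x0).
Proof.
move=> super Ux near_min; pose c := u x0 - w x0.
have pE : psi c x0 = u x0 by rewrite psiE addrC subrK.
have Ox : O x0 by case: Ux.
have := super x0 Ox barrier_region (psi c) barrier_region_open Ux (psi_C2 c) (@psi_adm c) pE.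
rewrite pE psi_hess//; apply; apply: filterS near_min => x hx.
by rewrite subrr psiE opprD addrA subr_ge0.
Qed.

Let w_cont y : 0 < T y < t0 -> {for y, continuous w}.
Proof.
move=> /hd[/derivable1_diffP/differentiable_continuous hc _].
exact: (@continuous_comp _ _ _ T h y (@T_cont y) hc).
Qed.

Let v y := u y - w y.
Let v_cont y : O y -> 0 < T y < t0 -> {for y, continuous v}.
Proof. by move=> Oy Ty; apply: continuousB; [exact: u_cont|exact: w_cont]. Qed.

Let level_compact (c : R) : compact [set y | enorm (y - xb) <= r1 /\ c <= T y].
Proof.
apply: (@closed_in_ball_compact _ _ _ xb r1); last by move=> y [].
apply: closedI; first exact: (closed_sublevel (@enorm_sub_continuous R n xb)).
exact: (closed_superlevel T_cont).
Qed.

(** At a maximum of u - w above the level C the point is off the sphere, since u <= C and w > 0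
    there, and u >= w holds. Then b f(w) <= b f(u) <= S_k contradicts strictness. *)
Lemma upper_comparison (C : R) : visc_sub k O b f u -> 0 <= C ->
  (forall y, enorm (y - xb) <= r1 -> 0 <= T y -> O y /\ T y < t0) ->
  (forall y, enorm (y - xb) = r1 -> 0 <= T y -> u y <= C) ->
  (forall B : R, exists2 tau : R, 0 < tau & forall t, 0 < t < tau -> B < h t) ->
  (forall y, barrier_region y -> Sk k (barrier_matrix y) < b y * f (h (T y))) ->
  forall y, enorm (y - xb) <= r1 -> 0 < T y -> u y <= h (T y) + C.
Proof.
move=> sub C0 geo lat unb strict y0 y0r Ty0; rewrite leNgt; apply/negP => viol.
have v0 : C < v y0 by rewrite /v ltrBrDr addrC.
have [|B uB] := @bounded_on_compact R n _ u (@level_compact 0).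
  by move=> y [yr Ty]; apply: u_cont; exact: (geo _ yr Ty).1.
have [tau tau0 htau] := unb B.
(* Where 0 < T < c the barrier exceeds the bound B of u. So u - w is negative there, and the maximum
   over T >= c is a local maximum even when attained at T = c. *)
pose c := Num.min tau (T y0); have c0 : 0 < c by rewrite lt_min tau0.
pose Kc := [set y | enorm (y - xb) <= r1 /\ c <= T y].
have KT y : Kc y -> O y /\ 0 < T y < t0.
  move=> [yr cT]; have Ty : 0 < T y by exact: lt_le_trans cT.
  by have [Oy ->] := geo _ yr (ltW Ty); rewrite Ty.
have Ky0 : Kc y0 by split=> //; rewrite ge_min lexx orbT.
have [||x0 Kx0 xmax] := @max_on_compact R n Kc v _ (@level_compact c).
- by exists y0.
- by move=> y /KT[]; exact: v_cont.
have [Ox0 Tx0] := KT _ Kx0.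
have vx0 : C < v x0 by apply: lt_le_trans v0 (xmax _ Ky0).
have x0r : enorm (x0 - xb) < r1.
  rewrite lt_neqAle Kx0.1 andbT; apply/negP => /eqP xr.
  have /andP[/ltW T0 _] := Tx0.
  move: vx0; rewrite /v ltNge => /negP; apply.
  by rewrite lerBlDr (le_trans (lat _ xr T0))// lerDl ltW// h_pos.
have Ux0 : barrier_region x0 by split.
have near_max : \forall y \near x0, v y <= v x0.
  near=> y; have [yO yr /andP[Ty Ty']] : barrier_region y by near: y; apply: open_nbhs_nbhs; split; [exact: barrier_region_open|].
  have [cT|Tc] := leP c (T y); first by apply: xmax; split=> //; exact: ltW.
  apply: le_trans (le_trans C0 (ltW vx0)); rewrite /v subr_le0.
  apply: (@le_trans _ _ B); first by apply: uB; split; exact: ltW.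
  apply/ltW/htau; rewrite Ty (lt_le_trans Tc)// ge_min lexx//.
have := touching_sub sub Ux0 near_max; rewrite leNgt => /negP; apply.
apply: lt_le_trans (strict _ Ux0) _; rewrite ler_wpM2l//; first exact: ltW (b_pos Ox0).
apply: f_mono; first exact: h_pos.
have := ltW (le_lt_trans C0 vx0); by rewrite /v subr_ge0.
Unshelve. all: by end_near. Qed.

(** Now w is bounded by [h sg] while u is infinite at the boundary, so u - w is positive within
    distance d of it. A minimum below -C is thus attained at distance at least d, off the sphere,
    with u <= w. *)
Lemma lower_comparison (C : R) : visc_super k O b f u -> blows_up O u -> 0 <= C -> 0 < sg ->
  (forall t : R, sg <= t < t0 -> h t <= h sg) ->
  (forall y, enorm (y - xb) <= r1 -> O y -> sg <= T y < t0) ->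
  (forall y, enorm (y - xb) = r1 -> O y -> h (T y) <= C) ->
  (forall y, barrier_region y -> b y * f (h (T y)) < Sk k (barrier_matrix y)) ->
  forall y, enorm (y - xb) <= r1 -> O y -> h (T y) <= u y + C.
Proof.
move=> super blow C0 sg0 hmax geo lat strict y0 y0r Oy0; rewrite leNgt; apply/negP => viol.
have geo' y : enorm (y - xb) <= r1 -> O y -> 0 < T y < t0.
  by move=> yr Oy; have /andP[Ty ->] := geo _ yr Oy; rewrite (lt_le_trans sg0 Ty).
have v0 : v y0 < - C by rewrite /v ltrBlDr addrC ltrBrDr.
have [d [d0 hdist]] := blow (h sg).
have vpos y : enorm (y - xb) <= r1 -> O y -> dist_bd O y < d -> 0 < v y.
  move=> yr Oy yd; rewrite /v subr_gt0; apply: le_lt_trans (hdist _ Oy yd).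
  by apply: hmax; exact: geo.
pose Kd := [set y | enorm (y - xb) <= r1] `&` [set y | O y /\ d <= dist_bd O y].
have Kc : compact Kd.
  apply: (@closed_in_ball_compact _ _ _ xb r1); last by move=> y [].
  apply: closedI; first exact: (closed_sublevel (@enorm_sub_continuous R n xb)).
  by apply: compact_closed; [exact: norm_hausdorff|exact: dist_ge_compact].
have Ky0 : Kd y0.
  split=> //; split=> //; rewrite leNgt; apply/negP => /(vpos _ y0r Oy0).
  by rewrite ltNge (le_trans (ltW v0))// oppr_le0.
have [||x0 [x0r [Ox0 dx0]] xmin] := @min_on_compact R n Kd v _ Kc.
- by exists y0.
- by move=> y [yr [Oy _]]; apply: v_cont => //; exact: geo'.
have vx0 : v x0 < - C by apply: le_lt_trans v0; exact: xmin.
have x0r' : enorm (x0 - xb) < r1.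
  rewrite lt_neqAle x0r andbT; apply/negP => /eqP xr.
  move: vx0; rewrite /v ltNge => /negP; apply.
  rewrite lerBrDr addrC lerBlDr (le_trans (lat _ xr Ox0))// lerDr.
  by apply: ltW; exact: u_pos.
have Ux0 : barrier_region x0 by split=> //; exact: geo'.
have near_min : \forall y \near x0, v x0 <= v y.
  near=> y; have [yO yr _] : barrier_region y by near: y; apply: open_nbhs_nbhs; split; [exact: barrier_region_open|].
  have [dy|dy] := leP d (dist_bd O y); first by apply: xmin; split=> //; exact: ltW.
  apply: le_trans (ltW (vpos _ (ltW yr) yO dy)); apply: le_trans (ltW vx0) _.
  by rewrite oppr_le0.
have := touching_super super Ux0 near_min; rewrite leNgt => /negP; apply.
apply: le_lt_trans (strict _ Ux0); rewrite ler_wpM2l//; first exact: ltW (b_pos Ox0).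
apply: f_mono; first exact: u_pos.
have : v x0 <= 0 by apply: le_trans (ltW vx0) _; rewrite oppr_le0.
by rewrite /v subr_le0.
Unshelve. all: by end_near. Qed.

End Comparison.

(** * Estimates of S_k on the barriers *)

Lemma product_gap (R : realFieldType) (a L B : R) : 0 <= a -> 0 <= L -> a * L < B ->
  exists2 eta0 : R, 0 < eta0 & forall eta, 0 < eta <= eta0 -> (a + eta) * (L + eta) < B.
Proof.
move=> a0 L0 aLB; have g0 : 0 < B - a * L by rewrite subr_gt0.
have [eta0 eta00 [h1 _ h2]] := @exists_small R 1 1 (a + L + 2) ((B - a * L) / 2) ltr01 ltr01
  (ltr_wpDl (addr_ge0 a0 L0) (ltr0n _ 2)) (divr_gt0 g0 (ltr0n _ 2)).
exists eta0 => // eta /andP[e0 e1].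
have h3 : (a + L + 2) * eta <= (a + L + 2) * eta0 by rewrite ler_wpM2l// addr_ge0// addr_ge0.
have h4 : eta * eta <= eta * 1 by rewrite ler_wpM2l ?(ltW e0)//; lra.
have -> : (a + eta) * (L + eta) = a * L + (a + L) * eta + eta * eta by ring.
by rewrite mulrDl in h3; lra.
Qed.

Lemma product_gap_lower (R : realFieldType) (a L B : R) : 0 < a -> 0 < L -> B < a * L ->
  exists2 eta0 : R, 0 < eta0 & forall eta, 0 < eta <= eta0 ->
    [/\ eta < a, eta < L & B < (a - eta) * (L - eta)].
Proof.
move=> a0 L0 aLB; have g0 : 0 < a * L - B by rewrite subr_gt0.
have [eta0 eta00 [h1 h1' h2]] := @exists_small R (a / 2) (L / 2) (a + L) ((a * L - B) / 2)
  (divr_gt0 a0 (ltr0n _ 2)) (divr_gt0 L0 (ltr0n _ 2)) (addr_gt0 a0 L0) (divr_gt0 g0 (ltr0n _ 2)).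
exists eta0 => // eta /andP[e0 e1].
have h3 : (a + L) * eta <= (a + L) * eta0 by rewrite ler_wpM2l// addr_ge0// ltW.
have h4 : 0 < eta * eta by rewrite mulr_gt0.
have -> : (a - eta) * (L - eta) = a * L - (a + L) * eta + eta * eta by ring.
by split; lra.
Qed.

Lemma chained_bounds (R : realFieldType) (S X E W a eta Lo Hi : R) : 0 < eta -> eta < a -> eta < Lo -> 0 < W ->
  `|X - a * W| <= eta * W -> `|S - X * E| <= eta * X -> Lo <= E -> E <= Hi ->
  (a - eta) * (Lo - eta) * W <= S /\ S <= (a + eta) * (Hi + eta) * W.
Proof.
move=> e0 ea eLo W0; rewrite !ler_norml => /andP[x1 x2] /andP[s1 s2] LoE EHi.
have x1' : (a - eta) * W <= X by rewrite mulrBl; lra.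
have x2' : X <= (a + eta) * W by rewrite mulrDl; lra.
have X0 : 0 <= X by apply: le_trans x1'; rewrite mulr_ge0 ?subr_ge0// ltW.
have eHi : 0 <= Hi + eta by lra.
have eLo' : 0 <= Lo - eta by lra.
split.
  apply: (@le_trans _ _ (X * (Lo - eta))).
    by rewrite mulrAC ler_wpM2r.
  apply: (@le_trans _ _ (X * (E - eta))); last by rewrite mulrBr; lra.
  by rewrite ler_wpM2l// lerD2r.
apply: (@le_trans _ _ (X * (E + eta))); first by rewrite mulrDr; lra.
apply: (@le_trans _ _ (X * (Hi + eta))); first by rewrite ler_wpM2l// lerD2r.
by rewrite [leRHS]mulrAC ler_wpM2r.
Qed.

Section MatrixEstimate.
Variables (R : realType) (n : nat).
Local Notation V := 'rV[R]_n.

Lemma normal_mx_conditions (nu : V) (A : 'M[R]_n) : enorm nu = 1 -> A^T = A -> nu *m A = 0 ->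
  A *m nu^T = 0 /\ nu *m nu^T = 1%:M.
Proof.
move=> nu1 AT nA; split; last by rewrite row_mul_tr dotr_sqr nu1 expr1n.
by rewrite -[A *m nu^T]trmxK trmx_mul trmxK AT nA trmx0.
Qed.

(** Taking out the factor |h'| = -h1 leaves -B + s p^T p with s = h2/|h1|, to which
    [esym_mx_rank1_asymptotics] applies with A' = -B. *)
Lemma pencil_estimate (CA eta : R) : 0 < eta -> exists2 delta : R, 0 < delta & exists2 s0 : R, 0 < s0 &
  forall (A B : 'M[R]_n) (nu p : V) (h1 h2 : R), `|A| <= CA -> enorm nu = 1 -> A^T = A -> nu *m A = 0 ->
    B^T = B -> `|- B - A| <= delta -> `|p^T *m p - nu^T *m nu| <= delta -> h1 < 0 -> s0 <= h2 / - h1 ->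
  forall j, (j < n)%N ->
    `|Sk j.+1 (h2 *: (p^T *m p) + h1 *: B) - (- h1) ^+ j.+1 * (h2 / - h1) * esym_mx j A|
      <= eta * ((- h1) ^+ j.+1 * (h2 / - h1)).
Proof.
move=> eta0; have [delta d0 [s0 s00 H]] := @esym_mx_rank1_asymptotics R n CA eta eta0.
exists delta => //; exists s0 => // A B nu p h1 h2 AC nu1 AT nA BT Bd pd h10 hs j jn.
have [An nn] := normal_mx_conditions nu1 AT nA.
have h1n : - h1 != 0 by rewrite oppr_eq0 lt_eqF.
have h1p : 0 < (- h1) ^+ j.+1 by rewrite exprn_gt0// oppr_gt0.
have := H A (- B) nu p (h2 / - h1) j AC An nn Bd pd hs jn.
have ME : h2 *: (p^T *m p) + h1 *: B = (- h1) *: (- B + (h2 / - h1) *: (p^T *m p)).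
  by rewrite scalerDr scalerA mulrCA divff// mulr1 scalerN scaleNr opprK addrC.
have MT : (h2 *: (p^T *m p) + h1 *: B)^T = h2 *: (p^T *m p) + h1 *: B.
  by rewrite linearD !linearZ /= trmx_mul trmxK BT.
rewrite Sk_esym// ME esym_mxZ// -[(- h1) ^+ j.+1 * _ * _]mulrA -mulrBr normrM (gtr0_norm h1p).
by move=> h; rewrite [eta * ((- h1) ^+ j.+1 * _)]mulrCA ler_wpM2l// ltW.
Qed.

(** S_j of the barrier is governed by sigma_(j-1) of the curvatures, sigma_0 = 1 when j = 1. This is
    how (k-1)-convexity of the boundary produces k-admissible test functions. *)
Lemma pencil_admissible (c eta : R) k (M A : 'M[R]_n) (h1 s : R) : (k <= n)%N -> h1 < 0 -> 0 < s -> eta < c ->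
  (forall j, (j < k)%N -> c <= esym_mx j A) ->
  (forall j, (j < n)%N -> `|Sk j.+1 M - (- h1) ^+ j.+1 * s * esym_mx j A| <= eta * ((- h1) ^+ j.+1 * s)) ->
  Gamma k (eigs M).
Proof.
move=> kn h10 s0 ec hA hM [|j]// /andP[_ jk].
have := hM j (leq_trans jk kn); set X := (- h1) ^+ j.+1 * s => h.
have X0 : 0 < X by rewrite mulr_gt0// exprn_gt0// oppr_gt0.
move: h; rewrite ler_norml => /andP[h _].
have h' : X * c <= X * esym_mx j A by rewrite ler_wpM2l ?(ltW X0)// hA.
have h'' : eta * X < X * c by rewrite mulrC ltr_pM2l.
by rewrite /Sk in h; lra.
Qed.

Lemma close_frame (CA delta : R) : 0 <= CA -> 0 < delta -> exists2 eps : R, 0 < eps & 2 * eps <= 1 /\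
  exists2 r : R, 0 < r & forall (nu : V) (A : 'M[R]_n) e L z, enorm nu = 1 -> A^T = A -> nu *m A = 0 -> `|A| <= CA ->
    `|e| <= 2 * eps -> 0 <= L <= (n%:R ^+ 2 * (CA + 2) + 1) ^+ 2 -> enorm z <= r ->
    `|- qhess nu A e L z - A| <= delta /\
    `|(qgrad nu A e L z)^T *m qgrad nu A e L z - nu^T *m nu| <= delta.
Proof.
move=> CA0 d0; set C1 := n%:R ^+ 2 * (CA + 2); set K := (C1 + 1) ^+ 2.
have C10 : 0 <= C1 by rewrite mulr_ge0 ?sqr_ge0// addr_ge0.
have K0 : 0 <= K by exact: sqr_ge0.
(* The Hessian error is at most 4 eps + 8 K r <= delta/2 + delta/3, the rank-one error at most 3 (C1
   + 3 K) r <= delta. *)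
have [eps eps0 [e1 e2 _]] := @exists_small R 2^-1 (delta / 8) 1 1 (ltac:(by rewrite invr_gt0)) (divr_gt0 d0 (ltr0n _ 8)) ltr01 ltr01.
exists eps => //; split; first by lra.
have D0 : 0 < C1 + 3 * K + 8 * K + 1 by rewrite ltr_wpDl// !addr_ge0// mulr_ge0.
have [r r0 [r1 r2 r3]] := @exists_small R 1 1 (C1 + 3 * K + 8 * K + 1) (Num.min 1 (delta / 3)) ltr01 ltr01 D0
  (ltac:(by rewrite lt_min ltr01 divr_gt0)).
move: r3; rewrite le_min => /andP[r3 r4].
exists r => // nu A e L z nu1 AT nA AC ee /andP[L0 LK] zr.
have z0 := enorm_ge0 z.
have Lz : L * enorm z <= K * r by exact: ler_pM.
have C1r : 0 <= C1 * r by rewrite mulr_ge0// ltW.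
have Kr : 0 <= K * r by rewrite mulr_ge0// ltW.
have sum_mulr : C1 * r + 3 * (K * r) + 8 * (K * r) + r = (C1 + 3 * K + 8 * K + 1) * r by ring.
have r3' : C1 * r + 3 * (K * r) + 8 * (K * r) + r <= 1 by rewrite sum_mulr.
have r4' : C1 * r + 3 * (K * r) + 8 * (K * r) + r <= delta / 3 by rewrite sum_mulr.
split.
  apply: le_trans; first by apply: qhess_close.
  rewrite (ger0_norm L0) -mulrA; lra.
have e1' : `|e| <= 1 by lra.
have z1 : enorm z <= 1 by lra.
have g := @qgrad_close R n nu A CA nu1 nA AC e L z e1' z1.
have gr : (C1 + 3 * `|L|) * enorm z <= C1 * r + 3 * (K * r).
  rewrite (ger0_norm L0) mulrDl -[3 * L * _]mulrA -/C1.
  have : C1 * enorm z <= C1 * r by rewrite ler_wpM2l.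
  by lra.
have {}g := le_trans g gr.
apply: le_trans (rank1_close nu1 _) _; first by lra.
by lra.
Qed.

End MatrixEstimate.

(** * Limits at the boundary and elementary real lemmas *)

Section BoundaryLimits.
Variables (R : realType) (n : nat).
Local Notation V := 'rV[R]_n.
Implicit Types (O : set V) (g : V -> R) (c l : R).

Lemma limsup_bd_lt O g l c : limsup_bd O g = l%:E -> l < c ->
  exists2 d : R, 0 < d & forall x, O x -> dist_bd O x < d -> g x < c.
Proof.
move=> gl lc; have : (limsup_bd O g < c%:E)%E by rewrite gl lte_fin.
rewrite /limsup_bd limf_esupE => /ereal_inf_lt[_ [W [d /= d0 dW] <-] Wc].
exists d => // x Ox xd; rewrite -lte_fin; apply: le_lt_trans Wc.
by apply: ereal_sup_ubound; exists x => //; exact: dW.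
Qed.

Lemma liminf_bd_gt O g l c : liminf_bd O g = l%:E -> c < l ->
  exists2 d : R, 0 < d & forall x, O x -> dist_bd O x < d -> c < g x.
Proof.
move=> gl lc; have : (c%:E < liminf_bd O g)%E by rewrite gl lte_fin.
rewrite /liminf_bd limf_einfE => /ereal_sup_gt[_ [W [d /= d0 dW] <-] Wc].
exists d => // x Ox xd; rewrite -lte_fin; apply: lt_le_trans Wc _.
by apply: ereal_inf_lbound; exists x => //; exact: dW.
Qed.

Lemma limsup_bd_le O g l : (forall c, l < c -> exists2 d : R, 0 < d &
    forall x, O x -> dist_bd O x < d -> g x <= c) -> (limsup_bd O g <= l%:E)%E.
Proof.
move=> h; apply/lee_addgt0Pr => e e0; have [|d d0 hd] := h (l + e); first by rewrite ltrDl.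
rewrite /limsup_bd limf_esupE; apply: (@le_trans _ _ (ereal_sup ((fun x => (g x)%:E) @` [set x | O x /\ dist_bd O x < d]))).
  by apply: ereal_inf_lbound; exists [set x | O x /\ dist_bd O x < d] => //; exists d.
by apply: ge_ereal_sup => _ [x [Ox xd] <-]; rewrite -EFinD lee_fin; exact: hd.
Qed.

Lemma liminf_bd_ge O g l : (forall c, c < l -> exists2 d : R, 0 < d &
    forall x, O x -> dist_bd O x < d -> c <= g x) -> (l%:E <= liminf_bd O g)%E.
Proof.
move=> h; rewrite /liminf_bd /limf_einf leeNr; apply: limsup_bd_le => c lc.
have [|d d0 hd] := h (- c); first by rewrite ltrNl.
by exists d => // x Ox xd; rewrite lerNl; exact: hd.
Qed.

End BoundaryLimits.

Lemma bernoulli (R : realFieldType) (x : R) (P : nat) : 0 <= x <= 1 -> 1 - P%:R * x <= (1 - x) ^+ P.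
Proof.
move=> /andP[x0 x1]; elim: P => [|P IH]; first by rewrite mul0r subr0 expr0.
have x1' : 0 <= 1 - x by rewrite subr_ge0.
rewrite exprS; apply: le_trans (ler_wpM2l x1' IH).
have h : 0 <= P%:R * x * x by rewrite !mulr_ge0.
by rewrite -natr1; lra.
Qed.

Lemma power_near1 (R : realFieldType) (P : nat) (e : R) : 0 < e < 1 ->
  exists2 c : R, 0 < c < 1 & 1 - e <= c ^+ P.
Proof.
move=> /andP[e0 e1]; have P0 : (0 : R) < P.+1%:R by rewrite ltr0n.
have x0 : 0 < e / P.+1%:R by rewrite divr_gt0.
have x1 : e / P.+1%:R < 1 by rewrite ltr_pdivrMr// mul1r (lt_le_trans e1)// ler1n.
exists (1 - e / P.+1%:R); first by rewrite subr_gt0 x1 gtrBl.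
apply: le_trans (bernoulli _ _); last by rewrite !ltW.
rewrite lerD2l lerN2 mulrCA -[leRHS]mulr1 ler_wpM2l ?(ltW e0)//.
by rewrite ler_pdivrMr// mul1r ler_nat.
Qed.

Lemma root_pow (R : realType) (x : R) k : 0 < x -> (x `^ (k.+1%:R)^-1) ^+ k.+1 = x.
Proof.
move=> x0; rewrite -powR_mulrn ?powR_ge0// -powRrM mulVf ?gt_eqF//.
by rewrite powRr1// ltW.
Qed.

Lemma is_derive_continuous (R : realType) (g : R -> R) (t D : R) : is_derive t 1 g D -> {for t, continuous g}.
Proof. by case=> /derivable1_diffP/differentiable_continuous. Qed.

Lemma le_of_left_limit (R : realType) (g : R -> R) (c t : R) : 0 < t -> {for t, continuous g} ->
  (forall s : R, 0 < s < t -> c <= g (t - s)) -> c <= g t.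
Proof.
move=> t0 gc h; rewrite leNgt; apply/negP => lt.
have [d /= d0 hd] := (nbhs_ballP _ _).1 (cvgr_lt (g t) gc c lt).
have [s s0 [s1 s2 _]] := @exists_small R (t / 2) (d / 2) 1 1 (divr_gt0 t0 (ltr0n _ 2)) (divr_gt0 d0 (ltr0n _ 2)) ltr01 ltr01.
have st : s < t by lra.
have sd : s < d by lra.
have : g (t - s) < c by apply: hd; rewrite /ball /= opprB addrC subrK gtr0_norm.
by rewrite ltNge h// s0.
Qed.

Lemma le_of_right_limit (R : realType) (g : R -> R) (c t e : R) : 0 < e -> {for t, continuous g} ->
  (forall s : R, 0 < s < e -> g (t + s) <= c) -> g t <= c.
Proof.
move=> e0 gc h; rewrite leNgt; apply/negP => lt.
have [d /= d0 hd] := (nbhs_ballP _ _).1 (cvgr_gt (g t) gc c lt).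
have [s s0 [s1 s2 _]] := @exists_small R (e / 2) (d / 2) 1 1 (divr_gt0 e0 (ltr0n _ 2)) (divr_gt0 d0 (ltr0n _ 2)) ltr01 ltr01.
have se : s < e by lra.
have sd : s < d by lra.
have : c < g (t + s) by apply: hd; rewrite /ball /= opprD addrA subrr sub0r normrN gtr0_norm.
by rewrite ltNge h// s0.
Qed.

Lemma nonincreasing_of_derive (R : realType) (g g1 : R -> R) (t1 : R) :
  (forall t : R, 0 < t < t1 -> is_derive t 1 g (g1 t)) -> (forall t : R, 0 < t < t1 -> g1 t < 0) ->
  forall s t : R, 0 < s -> s <= t -> t < t1 -> g t <= g s.
Proof.
move=> gd g0 s t s0 st tt; have [|w /andP[sw wt] E] := @MVT_closed R g g1 s t st.
  by move=> w /andP[sw wt]; apply: gd; rewrite (lt_le_trans s0 sw) (le_lt_trans wt).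
have gw : g1 w < 0 by apply: g0; rewrite (lt_le_trans s0 sw) (le_lt_trans wt).
by rewrite -subr_le0 E mulr_le0_ge0 ?subr_ge0// ltW.
Qed.

(** * One-sided bounds up to an additive constant *)

Section LargeSolutions.
Variables (R : realType) (n k : nat).
Hypotheses (Hn : (2 <= n)%N) (Hk : (1 <= k <= n)%N).
Variable Omega : set 'rV[R]_n.
Hypotheses (HOmega : bounded_domain Omega) (Hbd : C31_boundary Omega)
  (Hconv : strictly_convex_k k.-1 Omega).
Variable f : R -> R.
Hypotheses (f1_pos : forall s : R, 0 < s -> 0 < f s)
  (f1_mono : forall s t : R, 0 < s -> s <= t -> f s <= f t)
  (f1_C1 : forall s : R, 0 < s -> derivable f s 1 /\ {for s, continuous (derive1 f)})
  (f2 : forall s : R, 0 < s -> (Phi_int k f s < +oo)%E).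
Variable C_f : R.
Hypotheses (HCf : 0 < C_f) (f3 : derive1 (Hfun k f) s * Phi k f s @[s --> +oo] --> C_f).
Variable b : 'rV[R]_n -> R.
Hypothesis b1_pos : forall x, Omega x -> 0 < b x.
Variables (delta0 : R) (m : R -> R) (C_m : R).
Hypotheses (Hdelta0 : 0 < delta0) (m_pos : forall t : R, 0 < t < delta0 -> 0 < m t)
  (m_mono : forall s t : R, 0 < s -> s <= t -> t < delta0 -> m s <= m t)
  (m_C1 : forall t : R, 0 < t < delta0 -> derivable m t 1 /\ {for t, continuous (derive1 m)})
  (b2_Cm : derive1 (fun s => Mint m s / m s) t @[t --> 0^'+] --> C_m)
  (HCfm : 1 - C_m < C_f).
Variable u : 'rV[R]_n -> R.
Hypotheses (Hu : visc_sol k Omega b f u) (Hu_inf : blows_up Omega u).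

Local Notation dist := (dist_bd Omega).
Local Notation kappa := (1 - C_f^-1 * (1 - C_m)).
Local Notation prof xi := (profile k f m xi).

Let n0 : (0 < n)%N. Proof. exact: leq_trans Hn. Qed.
Let k1n : (k.-1 < n)%N. Proof. by case/andP: Hk => k0 kn; rewrite prednK. Qed.
Let kE : k = k.-1.+1. Proof. by case/andP: Hk => k0 _; rewrite prednK. Qed.

Lemma kappa_gt0 : 0 < kappa.
Proof. by rewrite subr_gt0 mulrC ltr_pdivrMr// mul1r. Qed.

Let chart_curv_value xb nu g r : bdry Omega xb -> bdry_chart Omega xb nu g r ->
  curv_values k.-1 Omega (esym_mx k.-1 (hess g 0)).
Proof.
by move=> bx H; exists xb, nu, g, r; split => //; rewrite (curv_sigma_esym H (ltnW k1n)).
Qed.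

(** [sup] is an upper bound only for a set known to be bounded; the uniform bound on the chart
    Hessians provides this. *)
Lemma L0_ge xb nu g r : bdry Omega xb -> bdry_chart Omega xb nu g r ->
  esym_mx k.-1 (hess g 0) <= L0 k Omega.
Proof.
move=> bx H; apply: ub_le_sup; last exact: chart_curv_value H.
have [CA _ hCA] := uniform_hess_bound HOmega Hbd.
have [K _ hK] := @loc_lip_esym_unif R n CA.
exists K => _ [y [nu' [g' [r' [by_ H' ->]]]]]; rewrite (curv_sigma_esym H' (ltnW k1n)).
apply: le_trans (ler_norm _) _; have Ag := hCA _ _ _ _ by_ H'.
by have [] := hK _ (ltnW k1n) _ _ Ag Ag.
Qed.

Lemma l0_le xb nu g r : bdry Omega xb -> bdry_chart Omega xb nu g r ->
  l0 k Omega <= esym_mx k.-1 (hess g 0).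
Proof.
move=> bx H; apply: ge_inf; last exact: chart_curv_value H.
have [c _ hc] := uniform_esym_gt0 HOmega Hbd (ltnW k1n) Hconv.
exists c => _ [y [nu' [g' [r' [by_ H' ->]]]]]; rewrite (curv_sigma_esym H' (ltnW k1n)).
exact: hc H' _ _.
Qed.

(** Pointwise convexity does not keep an infimum away from 0; the uniform bound from compactness
    does. *)
Lemma l0_gt0 : 0 < l0 k Omega.
Proof.
have [c c0 hc] := uniform_esym_gt0 HOmega Hbd (ltnW k1n) Hconv.
apply: lt_le_trans c0 _; apply: lb_le_inf.
  have [xb bx] := bdry_neq0 HOmega n0; have [nu [g [r H]]] := Hbd bx.
  by exists (esym_mx k.-1 (hess g 0)); exact: chart_curv_value H.
move=> _ [y [nu' [g' [r' [by_ H' ->]]]]]; rewrite (curv_sigma_esym H' (ltnW k1n)).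
exact: hc H' _ _.
Qed.

Lemma l0_le_L0 : l0 k Omega <= L0 k Omega.
Proof.
have [xb bx] := bdry_neq0 HOmega n0; have [nu [g [r H]]] := Hbd bx.
exact: le_trans (l0_le bx H) (L0_ge bx H).
Qed.

(** Fixes all constants in the order of their dependence: matrix tolerances from eta, then eps and
    the frame radius, then the range of t, then r1. The pairs (2 eps, K) and (-2 eps, 0) for (e, L)
    are the upper and the lower barrier. *)
Lemma barrier_estimates (xi eta tmax : R) (a := xi ^+ k.+1 * kappa) : 0 < xi -> 0 < eta -> eta < a ->
  eta < l0 k Omega -> 0 < tmax ->
  exists t1 r1 c1 eps K : R, [/\ 0 < t1 <= tmax /\ t1 <= delta0 / 2, 0 < r1 /\ 8 * r1 <= t1, 0 < c1,
  forall t : R, 0 < t < t1 -> [/\ 0 < prof xi t, is_derive t 1 (prof xi) (profile1 k f m xi t),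
     is_derive t 1 (profile1 k f m xi) (profile2 k f m xi t), {for t, continuous (profile2 k f m xi)} &
     profile1 k f m xi t < 0] &
  forall xb nu g r' z, bdry Omega xb -> bdry_chart Omega xb nu g r' -> enorm z <= r1 ->
   ([/\ 0 < qfun nu (hess g 0) (2 * eps) K z -> Omega (xb + z),
        qfun nu (hess g 0) (2 * eps) K z <= dist (xb + z),
        enorm z = r1 -> 0 <= qfun nu (hess g 0) (2 * eps) K z -> c1 <= dist (xb + z),
        Omega (xb + z) -> dist (xb + z) <= qfun nu (hess g 0) (- (2 * eps)) 0 z &
        enorm z = r1 -> Omega (xb + z) -> c1 <= qfun nu (hess g 0) (- (2 * eps)) 0 z] /\
    qfun nu (hess g 0) (- (2 * eps)) 0 z <= 2 * r1) /\
   forall e L t, (e = 2 * eps /\ L = K) \/ (e = - (2 * eps) /\ L = 0) -> 0 < t < t1 ->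
    let B := profile2 k f m xi t *: ((qgrad nu (hess g 0) e L z)^T *m qgrad nu (hess g 0) e L z)
      + profile1 k f m xi t *: qhess nu (hess g 0) e L z in
    let W := m t ^+ k.+1 * f (prof xi t) in
    [/\ Gamma k (eigs B), (a - eta) * (l0 k Omega - eta) * W <= Sk k B &
     Sk k B <= (a + eta) * (L0 k Omega + eta) * W]].
Proof.
move=> xi0 eta0 etaa etal tmax0.
have [CA CA0 hCA] := uniform_hess_bound HOmega Hbd.
have [c c0 hc] := uniform_esym_gt0 HOmega Hbd (ltnW k1n) Hconv.
(* Admissibility requires the matrix error to stay below the smallest curvature function, which need
   not follow from eta < l0. *)
pose eta' := Num.min eta (c / 2).
have eta'0 : 0 < eta' by rewrite lt_min eta0 divr_gt0.
have eta'e : eta' <= eta by rewrite ge_min lexx.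
have eta'c : eta' < c by rewrite gt_min ltr_pdivrMr// mulr_natr mulr2n ltrDl c0 orbT.
have [delta d0 [s0 s00 pencil]] := pencil_estimate n CA eta'0.
have [eps eps0 [eps1 [r r0 close]]] := close_frame n (ltW CA0) d0.
(* Tolerance at most 1/s0 makes [profile_asymptotics] deliver h''/|h'| >= s0. *)
have eta''0 : 0 < Num.min eta s0^-1 by rewrite lt_min eta0 invr_gt0.
have [t0 /andP[t00 t0d] hprof] := profile_derive f1_pos f1_mono f1_C1 f2 Hdelta0 m_pos m_mono m_C1 xi0.
have [tau tau0 asym] := profile_asymptotics f1_pos f1_mono f1_C1 f2 HCf f3 Hdelta0 m_pos m_mono m_C1 b2_Cm xi0 HCfm eta''0.
pose t1 := Num.min tmax (Num.min t0 tau).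
have t10 : 0 < t1 by rewrite !lt_min tmax0 t00.
have t1t0 : t1 <= t0 by rewrite !ge_min lexx orbT.
have t1tau : t1 <= tau by rewrite !ge_min lexx !orbT.
have rm0 : 0 < Num.min r (t1 / 8) by rewrite lt_min r0 divr_gt0.
have [r1 /andP[r10]] := uniform_barriers HOmega Hbd n0 (ltW CA0) hCA eps0 eps1 rm0.
rewrite le_min => /andP[r1r r1t] [c1 c10 geo].
exists t1, r1, c1, eps, ((n%:R ^+ 2 * (CA + 2) + 1) ^+ 2); split.
- by split; [rewrite t10 ge_min lexx|exact: le_trans t0d].
- by split; [exact: r10|rewrite mulrC -ler_pdivlMr].
- exact: c10.
- by move=> t /andP[tp tt]; apply: hprof; rewrite tp (lt_le_trans tt).
move=> xb nu g r' z bx H zr1; split; first exact: geo H zr1.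
move=> e L t eL /andP[tp tt] B W.
have tt0 : 0 < t < t0 by rewrite tp (lt_le_trans tt).
have ttau : 0 < t < tau by rewrite tp (lt_le_trans tt).
have [pt _ _ _ p1] := hprof _ tt0; have [sE WE] := asym _ ttau.
set s := profile2 k f m xi t / - profile1 k f m xi t in sE WE.
have ss0 : s0 <= s.
  by apply: le_trans sE; rewrite -[leLHS]invrK lef_pV2 ?posrE ?invr_gt0// ge_min lexx orbT.
have sp : 0 < s by exact: lt_le_trans ss0.
have td : 0 < t < delta0.
  rewrite tp (lt_le_trans tt)// (le_trans t1t0)// (le_trans t0d)//.
  by rewrite ler_pdivrMr// mulr_natr mulr2n lerDl ltW.
have W0 : 0 < W by rewrite mulr_gt0// ?exprn_gt0 ?m_pos// f1_pos.
have nu1 := chart_unit H; have [As nA] := chart_hess_data H; have Ab := hCA _ _ _ _ bx H.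
have eabs : `|e| <= 2 * eps.
  by case: eL => -[-> _]; rewrite ?normrN gtr0_norm// mulr_gt0.
have LK : 0 <= L <= (n%:R ^+ 2 * (CA + 2) + 1) ^+ 2.
  by case: eL => -[_ ->]; rewrite ?lexx sqr_ge0.
have [hq gq] := close nu (hess g 0) e L z nu1 As nA Ab eabs LK (le_trans zr1 r1r).
have Bs : (qhess nu (hess g 0) e L z)^T = qhess nu (hess g 0) e L z by exact: qhess_sym.
have est := pencil (hess g 0) _ nu _ _ _ Ab nu1 As nA Bs hq gq p1 ss0.
rewrite -/s -/B in est.
have adm : Gamma k (eigs B).
  apply: (pencil_admissible _ p1 sp eta'c _ est); first by case/andP: Hk.
  by move=> j jk; apply: (hc _ _ _ _ bx H); rewrite -ltnS -kE.
pose X := (- profile1 k f m xi t) ^+ k * s.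
have X0 : 0 <= X by rewrite mulr_ge0 ?(ltW sp)// exprn_ge0// oppr_ge0 ltW.
have XW : `|X - a * W| <= eta * W.
  by apply: le_trans WE _; rewrite ler_wpM2r ?(ltW W0)// ge_min lexx.
have SX : `|Sk k B - X * esym_mx k.-1 (hess g 0)| <= eta * X.
  have := est _ k1n; rewrite -kE => /le_trans; apply.
  by rewrite ler_wpM2r.
have [] := chained_bounds eta0 etaa etal W0 XW SX (l0_le bx H) (L0_ge bx H).
by split.
Qed.

Let u_cont x : Omega x -> {for x, continuous u}. Proof. by case: Hu => + _ _ _; exact. Qed.
Let u_pos x : Omega x -> 0 < u x. Proof. by case: Hu => _ + _ _; exact. Qed.
Let sub : visc_sub k Omega b f u. Proof. by case: Hu. Qed.
Let super : visc_super k Omega b f u. Proof. by case: Hu. Qed.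

Lemma sup_away_bdry (d : R) : 0 < d -> exists2 C : R, 0 <= C &
  forall x, Omega x -> d <= dist x -> u x <= C.
Proof.
move=> d0; have [|B hB] := @bounded_on_compact R n _ u (dist_ge_compact HOmega n0 d0).
  by move=> x [Ox _]; exact: u_cont.
exists (Num.max 0 B); first by rewrite le_max lexx.
by move=> x Ox dx; rewrite le_max hB ?orbT.
Qed.

(* The barrier is shifted inwards by sg, so that it is infinite on qfun = sg,
   inside the domain; then sg tends to 0. *)
Lemma upper_bound (xi B : R) : 0 < xi ->
  (exists2 d : R, 0 < d & forall x, Omega x -> dist x < d -> B * m (dist x) ^+ k.+1 <= b x) ->
  xi ^+ k.+1 * kappa * L0 k Omega < B ->
  exists C : R, exists2 d : R, 0 < d & forall x, Omega x -> dist x < d -> u x <= prof xi (dist x) + C.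
Proof.
move=> xi0 [d d0 hb] xiB; set a := xi ^+ k.+1 * kappa in xiB.
have a0 : 0 < a by rewrite mulr_gt0 ?exprn_gt0// kappa_gt0.
have l00 := l0_gt0; have lL := l0_le_L0; have L00 := le_trans (ltW l00) lL.
have [eta0 eta00 heta] := product_gap (ltW a0) L00 xiB.
have [eta e0 [e1 e2 e3]] := @exists_small R eta0 (a / 2) 1 (l0 k Omega / 2) eta00 (divr_gt0 a0 (ltr0n _ 2)) ltr01 (divr_gt0 l00 (ltr0n _ 2)).
have ea : eta < a by lra.
have el : eta < l0 k Omega by lra.
have gap : (a + eta) * (L0 k Omega + eta) < B by apply: heta; rewrite e0.
have [t1 [r1 [c1 [eps [K [[/andP[t10 t1d] t1delta] [r10 r1t] c10 hp hB]]]]]] := barrier_estimates xi0 e0 ea el d0.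
have [C C0 hC] := sup_away_bdry c10.
have r1t1 : r1 < t1 by lra.
have t1del : t1 < delta0 by rewrite (le_lt_trans t1delta)// ltr_pdivrMr// mulr_natr mulr2n ltrDl.
exists C, r1 => // x Ox xr; have dx0 := dist_bd_gt0 HOmega n0 Ox.
have [xb bx dE] := dist_bd_attained HOmega n0 x.
have [nu [g [r' H]]] := Hbd bx.
have xE := nearest_point_normal HOmega n0 Ox bx dE H.
have nu1 := chart_unit H; have [As nA] := chart_hess_data H.
have pc : {for dist x, continuous (prof xi)}.
  by have [|_ /is_derive_continuous] := hp (dist x); first by rewrite dx0 (lt_trans xr).
rewrite -lerBlDr; apply: (le_of_left_limit dx0 pc) => sg /andP[sg0 sgd]; rewrite lerBlDr.
have TE : qfun nu (hess g 0) (2 * eps) K (x - xb) + (- sg) = dist x - sg.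
  by rewrite {1}xE [xb + _]addrC addrK qfun_normal.
rewrite -TE; apply: (upper_comparison (nu := nu) (A := hess g 0) (e := 2 * eps) (L := K) (sg := - sg)
  HOmega u_cont b1_pos f1_mono As _ _ _ _ _ sub C0 _ _ _ _ _ _ (t0 := t1) (r1 := r1)
  (h1 := profile1 k f m xi) (h2 := profile2 k f m xi)).
- by move=> t /hp[].
- by move=> t /hp[].
- by move=> t /hp[].
- by move=> t /hp[].
- move=> y [Oy yr Ty]; have [_ /(_ _ _ _ (or_introl (conj erefl erefl)) Ty)[]] := hB _ _ _ _ _ bx H (ltW yr).
  by [].
- move=> y yr /= Ty; have [[[i1 i2 _ _ _] _] _] := hB _ _ _ _ _ bx H yr.
  rewrite [xb + _]addrC subrK in i1 i2.
  rewrite subr_ge0 in Ty; split; first exact: i1 (lt_le_trans sg0 Ty).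
  apply: le_lt_trans (le_lt_trans (le_trans (le_trans i2 (dist_bd_le y bx)) yr) r1t1).
  by rewrite gerBl ltW.
- move=> y yr /= Ty; have yr' : enorm (y - xb) <= r1 by rewrite yr.
  have [[[i1 i2 i3 _ _] _] _] := hB _ _ _ _ _ bx H yr'.
  rewrite [xb + _]addrC subrK in i1 i3.
  rewrite subr_ge0 in Ty; have Q0 := lt_le_trans sg0 Ty.
  by apply: hC (i1 Q0) (i3 yr (ltW Q0)).
- exact: (profile_unbounded f1_pos f1_mono f1_C1 f2 Hdelta0 m_pos m_mono m_C1 xi0).
- move=> y [Oy yr Ty] /=; have [[[i1 i2 _ _ _] _] hS] := hB _ _ _ _ _ bx H (ltW yr).
  have [_ _ S2] := hS _ _ _ (or_introl (conj erefl erefl)) Ty.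
  rewrite [xb + _]addrC subrK in i2.
  apply: le_lt_trans S2 _.
  have {}Ty := Ty; rewrite -/(profile k f m xi) in Ty *.
  set t := _ + - sg in Ty *; have /andP[tp tt] := Ty.
  have td : 0 < t < delta0 by rewrite tp (lt_trans tt).
  have fp : 0 < f (prof xi t) by apply: f1_pos; have [] := hp _ Ty.
  have dy := le_lt_trans (dist_bd_le y bx) (lt_trans yr r1t1).
  have tdy : t <= dist y by apply: le_trans i2; rewrite gerBl ltW.
  (* The inward shift and qfun <= dist give t <= dist y, so the lower bound of b at dist y holds at
     t by monotonicity of m. *)
  apply: (@lt_le_trans _ _ (B * (m t ^+ k.+1 * f (prof xi t)))).
    by rewrite ltr_pM2r// mulr_gt0// exprn_gt0// m_pos.
  rewrite mulrA ler_wpM2r ?(ltW fp)//.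
  apply: le_trans (hb _ Oy _); last by rewrite (lt_le_trans dy).
  apply: ler_wpM2l.
    by apply/ltW; apply: le_lt_trans gap; rewrite mulr_ge0// addr_ge0// ltW.
  have dyd : 0 < dist y < delta0 by rewrite (lt_le_trans tp tdy) (lt_trans dy).
  rewrite ler_pXn2r// ?nnegrE ?(ltW (m_pos _))//; apply: m_mono => //; by case/andP: dyd.
- by rewrite -dE ltW.
- by rewrite TE subr_gt0.
Qed.

(* Here the barrier is shifted outwards, hence bounded, while u is infinite on
   the boundary. *)
Lemma lower_bound (xi B : R) : 0 < xi ->
  (exists2 d : R, 0 < d & forall x, Omega x -> dist x < d -> b x <= B * m (dist x) ^+ k.+1) ->
  0 <= B -> B < xi ^+ k.+1 * kappa * l0 k Omega ->
  exists C : R, exists2 d : R, 0 < d & forall x, Omega x -> dist x < d -> prof xi (dist x) <= u x + C.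
Proof.
move=> xi0 [d d0 hb] B0 xiB; set a := xi ^+ k.+1 * kappa in xiB.
have a0 : 0 < a by rewrite mulr_gt0 ?exprn_gt0// kappa_gt0.
have l00 := l0_gt0.
have [eta0 eta00 heta] := product_gap_lower a0 l00 xiB.
have eta01 : 0 < eta0 <= eta0 by rewrite eta00 lexx.
have [ea el gap] := heta _ eta01.
have [t1 [r1 [c1 [eps [K [[/andP[t10 t1d] t1delta] [r10 r1t] c10 hp hB]]]]]] := barrier_estimates xi0 eta00 ea el d0.
have decr : forall s t : R, 0 < s -> s <= t -> t < t1 -> prof xi t <= prof xi s.
  by apply: (@nonincreasing_of_derive R _ (profile1 k f m xi)) => t /hp[].
have t1del : t1 < delta0 by rewrite (le_lt_trans t1delta)// ltr_pdivrMr// mulr_natr mulr2n ltrDl.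
pose c2 := Num.min c1 r1; have c20 : 0 < c2 by rewrite lt_min c10.
(* On the lateral sphere the argument of the profile is at least c1 >= c2, and the profile is
   nonincreasing. *)
pose C := Num.max 0 (prof xi c2); have C0 : 0 <= C by rewrite le_max lexx.
exists C, r1 => // x Ox xr; have dx0 := dist_bd_gt0 HOmega n0 Ox.
have [xb bx dE] := dist_bd_attained HOmega n0 x.
have [nu [g [r' H]]] := Hbd bx.
have xE := nearest_point_normal HOmega n0 Ox bx dE H.
have nu1 := chart_unit H; have [As nA] := chart_hess_data H.
have r1t1 : r1 < t1 by lra.
have pc : {for dist x, continuous (prof xi)}.
  by have [|_ /is_derive_continuous] := hp (dist x); first by rewrite dx0 (lt_trans xr).
(* The barrier argument is at most 2 r1 + sg, and 2 r1 <= t1/4, so a shift below t1/4 stays in the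
   range of the profile. *)
have t4 : 0 < t1 / 4 by rewrite divr_gt0.
apply: (le_of_right_limit t4 pc) => sg /andP[sg0 sgt].
have TE : qfun nu (hess g 0) (- (2 * eps)) 0 (x - xb) + sg = dist x + sg.
  by rewrite {1}xE [xb + _]addrC addrK qfun_normal.
have geo y : enorm (y - xb) <= r1 -> Omega y ->
    dist y <= qfun nu (hess g 0) (- (2 * eps)) 0 (y - xb) /\ qfun nu (hess g 0) (- (2 * eps)) 0 (y - xb) + sg < t1.
  move=> yr Oy; have [[[_ _ _ i4 _] i6] _] := hB _ _ _ _ _ bx H yr.
  by rewrite [xb + _]addrC subrK in i4; split; [exact: i4|lra].
rewrite -TE; apply: (lower_comparison (nu := nu) (A := hess g 0) (e := - (2 * eps)) (L := 0) (sg := sg)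
  HOmega n0 u_cont u_pos b1_pos f1_mono As _ _ _ _ super Hu_inf C0 sg0 _ _ _ _ _ Ox (t0 := t1) (r1 := r1)
  (h1 := profile1 k f m xi) (h2 := profile2 k f m xi)).
- by move=> t /hp[].
- by move=> t /hp[].
- by move=> t /hp[].
- by move=> y [Oy yr Ty]; have [_ /(_ _ _ _ (or_intror (conj erefl erefl)) Ty)[]] := hB _ _ _ _ _ bx H (ltW yr).
- by move=> t /andP[sgt' tt]; exact: decr.
- move=> y yr Oy /=; have [i1 i2] := geo y yr Oy; rewrite i2 andbT lerDr.
  by apply: le_trans i1; exact: ltW (dist_bd_gt0 HOmega n0 Oy).
- move=> y yr Oy /=; have yr' : enorm (y - xb) <= r1 by rewrite yr.
  have [i1 i2] := geo y yr' Oy.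
  have [[[_ _ _ _ i5] _] _] := hB _ _ _ _ _ bx H yr'.
  rewrite [xb + _]addrC subrK in i5; have {}i5 := i5 yr Oy.
  rewrite le_max; apply/orP; right; apply: decr => //.
  by apply: (@le_trans _ _ c1); [rewrite ge_min lexx|apply: le_trans i5 _; rewrite lerDl ltW].
- move=> y [Oy yr Ty] /=; have [_ hS] := hB _ _ _ _ _ bx H (ltW yr).
  have [_ S1 _] := hS _ _ _ (or_intror (conj erefl erefl)) Ty.
  apply: lt_le_trans S1.
  have [i1 _] := geo y (ltW yr) Oy.
  set t := _ + sg in Ty *; have /andP[tp tt] := Ty.
  have td : 0 < t < delta0 by rewrite tp (lt_trans tt).
  have fp : 0 < f (prof xi t) by apply: f1_pos; have [] := hp _ Ty.
  have dy0 := dist_bd_gt0 HOmega n0 Oy.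
  have tdy : dist y <= t by apply: le_trans i1 _; rewrite lerDl ltW.
  apply: (@le_lt_trans _ _ (B * (m t ^+ k.+1 * f (prof xi t)))); last first.
    by rewrite ltr_pM2r// mulr_gt0// exprn_gt0// m_pos.
  rewrite mulrA ler_wpM2r ?(ltW fp)//.
  apply: le_trans (hb _ Oy (le_lt_trans tdy (lt_le_trans tt t1d))) _.
  apply: ler_wpM2l => //.
  have dyd : 0 < dist y < delta0 by rewrite dy0 (le_lt_trans tdy)//; case/andP: td.
  by rewrite ler_pXn2r// ?nnegrE ?(ltW (m_pos _))//; apply: m_mono => //; case/andP: td.
- by rewrite -dE ltW.
Qed.

End LargeSolutions.

(** * Passage to the critical values of xi *)

Lemma inv_near1 (R : realFieldType) (e w : R) : 0 < e <= 2^-1 -> 1 - e <= w -> w^-1 <= 1 + 2 * e.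
Proof.
move=> /andP[e0 e1] we; have w0 : 0 < w by lra.
rewrite -(ler_pM2r w0) mulVf ?gt_eqF//.
have h : (1 + 2 * e) * (1 - e) <= (1 + 2 * e) * w by rewrite ler_wpM2l//; lra.
have h2 : e * e <= e * 2^-1 by rewrite ler_wpM2l// ltW.
have h3 : (1 + 2 * e) * (1 - e) = 1 + e - 2 * (e * e) by ring.
by rewrite h3 in h; lra.
Qed.

(** p is the profile at the critical xi, q the one at the moved xi, w = theta^P and v = u. The ratio
    of profiles and the constant C each cost e p. *)
Lemma ratio_lower_arith (R : realFieldType) (c e p q v w C : R) : 0 < p -> e <= (1 - c) / 2 ->
  1 - e <= w -> w * p <= q -> q <= v + C -> C <= e * p -> c * p <= v.
Proof.
move=> p0 e2 we wq qv Cp; have h : (1 - e) * p <= w * p by rewrite ler_wpM2r// ltW.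
have h' : c * p <= (1 - 2 * e) * p by rewrite ler_wpM2r ?(ltW p0)//; lra.
by lra.
Qed.

Lemma ratio_upper_arith (R : realFieldType) (c e p q v w C : R) : 0 < p -> e <= (c - 1) / 3 ->
  w <= 1 + 2 * e -> q <= w * p -> v <= q + C -> C <= e * p -> v <= c * p.
Proof.
move=> p0 e2 we wq qv Cp; have h : w * p <= (1 + 2 * e) * p by rewrite ler_wpM2r// ltW.
have h' : (1 + 3 * e) * p <= c * p by rewrite ler_wpM2r ?(ltW p0)//; lra.
by lra.
Qed.

Theorem theorem1p2 (R : realType) (n k : nat)
  (Hn : (2 <= n)%N) (Hk : (1 <= k <= n)%N)
  (Omega : set 'rV[R]_n)
  (HOmega : bounded_domain Omega)
  (Hbd : C31_boundary Omega)
  (Hconv : strictly_convex_k k.-1 Omega)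
  (f : R -> R)
  (f1_pos : forall s : R, 0 < s -> 0 < f s)
  (f1_mono : forall s t : R, 0 < s -> s <= t -> f s <= f t)
  (f1_C1 : forall s : R, 0 < s -> derivable f s 1 /\ {for s, continuous (derive1 f)})
  (f2 : forall s : R, 0 < s -> (Phi_int k f s < +oo)%E)
  (C_f : R) (HCf : 0 < C_f)
  (f3 : derive1 (Hfun k f) s * Phi k f s @[s --> +oo] --> C_f)
  (b : 'rV[R]_n -> R)
  (b1_reg : Ck1_closure 1 Omega b)
  (b1_pos : forall x, Omega x -> 0 < b x)
  (delta0 : R) (m : R -> R) (b_lo b_hi C_m : R)
  (Hdelta0 : 0 < delta0)
  (m_pos : forall t : R, 0 < t < delta0 -> 0 < m t)
  (m_mono : forall s t : R, 0 < s -> s <= t -> t < delta0 -> m s <= m t)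
  (m_C1 : forall t : R, 0 < t < delta0 -> derivable m t 1 /\ {for t, continuous (derive1 m)})
  (Hb_lo : 0 < b_lo) (Hb_hi : 0 < b_hi)
  (b2_lo : liminf_bd Omega (fun x => b x / m (dist_bd Omega x) ^+ k.+1) = b_lo%:E)
  (b2_hi : limsup_bd Omega (fun x => b x / m (dist_bd Omega x) ^+ k.+1) = b_hi%:E)
  (M_fin : forall t : R, 0 < t < delta0 ->
     (\int[lebesgue_measure]_(s in `]0%R, t[) (m s)%:E < +oo)%E)
  (HC_m : 0 <= C_m)
  (b2_Cm : derive1 (fun s => Mint m s / m s) t @[t --> 0^'+] --> C_m)
  (HCfm : 1 - C_m < C_f)
  (u : 'rV[R]_n -> R)
  (Hu : visc_sol k Omega b f u)
  (Hu_inf : blows_up Omega u) :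
  let xi_lo := (b_lo / (L0 k Omega * (1 - C_f^-1 * (1 - C_m)))) `^ (k.+1%:R)^-1 in
  let xi_hi := (b_hi / (l0 k Omega * (1 - C_f^-1 * (1 - C_m)))) `^ (k.+1%:R)^-1 in
  (1%:E <= liminf_bd Omega
             (fun x => u x / varphi k f (xi_hi * Mint m (dist_bd Omega x)))%R)%E /\
  (limsup_bd Omega
             (fun x => u x / varphi k f (xi_lo * Mint m (dist_bd Omega x)))%R <= 1%:E)%E.
Proof.
move=> xi_lo xi_hi.
have n0 : (0 < n)%N by exact: leq_trans Hn.
have l00 : 0 < l0 k Omega := l0_gt0 Hn Hk HOmega Hbd Hconv.
have L00 : 0 < L0 k Omega := lt_le_trans l00 (l0_le_L0 Hn Hk HOmega Hbd Hconv).
have kap0 : 0 < 1 - C_f^-1 * (1 - C_m) := kappa_gt0 HCf HCfm.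
(* Only the positivity of these constants and the two one-sided bounds are used from here on, so the
   constants are abstracted. *)
move: (l0 k Omega) (L0 k Omega) l00 L00 (upper_bound Hn Hk HOmega Hbd Hconv f1_pos f1_mono f1_C1 f2 HCf f3 b1_pos
  Hdelta0 m_pos m_mono m_C1 b2_Cm HCfm Hu) (lower_bound Hn Hk HOmega Hbd Hconv f1_pos f1_mono f1_C1 f2 HCf f3
  b1_pos Hdelta0 m_pos m_mono m_C1 b2_Cm HCfm Hu Hu_inf) @xi_lo @xi_hi => l L l00 L00.
move: (1 - C_f^-1 * (1 - C_m)) kap0 => kap kap0 upper lower xi_lo xi_hi.
have lo0 : 0 < xi_lo by rewrite powR_gt0// divr_gt0// mulr_gt0.
have hi0 : 0 < xi_hi by rewrite powR_gt0// divr_gt0// mulr_gt0.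
have loE : xi_lo ^+ k.+1 * kap * L = b_lo.
  rewrite /xi_lo root_pow ?divr_gt0// ?mulr_gt0//; field; by rewrite !gt_eqF.
have hiE : xi_hi ^+ k.+1 * kap * l = b_hi.
  rewrite /xi_hi root_pow ?divr_gt0// ?mulr_gt0//; field; by rewrite !gt_eqF.
move: xi_lo xi_hi lo0 hi0 loE hiE => xi_lo xi_hi lo0 hi0 loE hiE.
have mpow x : Omega x -> dist_bd Omega x < delta0 -> 0 < m (dist_bd Omega x) ^+ k.+1.
  by move=> Ox xd; rewrite exprn_gt0// m_pos// xd andbT; exact: (dist_bd_gt0 HOmega n0 Ox).
have b_ge B : B < b_lo -> exists2 d : R, 0 < d & forall x, Omega x -> dist_bd Omega x < d ->
    B * m (dist_bd Omega x) ^+ k.+1 <= b x.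
  move=> /(liminf_bd_gt b2_lo)[d d0 hd]; exists (Num.min d delta0); first by rewrite lt_min d0.
  move=> x Ox; rewrite lt_min => /andP[xd xd0].
  by rewrite -ler_pdivlMr ?mpow// ltW// hd.
have b_le B : b_hi < B -> exists2 d : R, 0 < d & forall x, Omega x -> dist_bd Omega x < d ->
    b x <= B * m (dist_bd Omega x) ^+ k.+1.
  move=> /(limsup_bd_lt b2_hi)[d d0 hd]; exists (Num.min d delta0); first by rewrite lt_min d0.
  move=> x Ox; rewrite lt_min => /andP[xd xd0].
  by rewrite -ler_pdivrMr ?mpow// ltW// hd.
have [P [T0 T00 hr]] := varphi_ratio f1_pos f1_mono f1_C1 f2 HCf f3.
have profile_ratio xi th : 0 < xi -> 0 < th < 1 -> exists2 tau : R, 0 < tau & forall t, 0 < t < tau ->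
    profile k f m (th * xi) t <= th ^- P * profile k f m xi t.
  move=> xi0 th01.
  have [tau /andP[tau0 _] htau] := Mint_small Hdelta0 m_pos m_mono m_C1 (divr_gt0 T00 xi0).
  exists tau => // t /htau /andP[M0 MT]; rewrite /profile -mulrA; apply: hr => //.
  by rewrite mulr_gt0//= mulrC -ltr_pdivlMr.
have absorb xi C e : 0 < xi -> 0 < e -> exists2 tau : R, 0 < tau & forall t, 0 < t < tau ->
    0 < profile k f m xi t /\ C <= e * profile k f m xi t.
  move=> xi0 e0.
  have [tau tau0 htau] := profile_unbounded f1_pos f1_mono f1_C1 f2 Hdelta0 m_pos m_mono m_C1 xi0 (Num.max 0 (C / e)).
  exists tau => // t /htau; rewrite gt_max => /andP[-> h]; split=> //.
  by rewrite mulrC -ler_pdivrMr// ltW.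
have pow_lt th : 0 < th < 1 -> th ^+ k.+1 < 1.
  by move=> /andP[th0 th1]; rewrite exprn_ilt1// ltW.
split.
  apply: liminf_bd_ge => c c1.
  have c1' : 0 < (1 - c) / 2 by rewrite divr_gt0// subr_gt0.
  have h2 : (0 : R) < 2^-1 by rewrite invr_gt0.
  have [e e0 [e1 e2 _]] := @exists_small R 2^-1 ((1 - c) / 2) 1 1 h2 c1' ltr01 ltr01.
  have [|th th01 the] := @power_near1 R P e; first by rewrite e0 (le_lt_trans e1)// invf_lt1 ?ltr1n.
  have /andP[th0 th1] := th01.
  have xi0 : 0 < th^-1 * xi_hi by rewrite mulr_gt0// invr_gt0.
  (* The lower bound needs xi above the critical value; dividing by theta multiplies the right side
     by theta^(-k-1). The midpoint of the gap serves as B: above [b_hi], so that it bounds b/m^(k+1)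
     near the boundary, and still strictly subcritical. *)
  have gap : b_hi < (th^-1 * xi_hi) ^+ k.+1 * kap * l.
    rewrite exprMn -!mulrA [_ * (kap * l)]mulrA hiE exprVn ltr_pdivlMl ?exprn_gt0//.
    by rewrite gtr_pMl// pow_lt.
  have [C [d1 d10 hd1]] := lower _ _ xi0 (b_le _ (midf_lt gap).1) (ltac:(by rewrite ltW// (lt_trans Hb_hi)// midf_lt)) (midf_lt gap).2.
  have [d2 d20 hd2] := profile_ratio _ _ xi0 th01.
  have [d3 d30 hd3] := absorb xi_hi C e hi0 e0.
  exists (Num.min d1 (Num.min d2 d3)); first by rewrite !lt_min d10 d20.
  move=> x Ox; rewrite !lt_min => /and3P[x1 x2 x3].
  have dx := dist_bd_gt0 HOmega n0 Ox.
  have [|p0 Cp] := hd3 (dist_bd Omega x); first by rewrite dx.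
  (* The ratio bound is used at theta^(-1) [xi_hi], so that the smaller parameter is the critical
     one. *)
  have := hd2 (dist_bd Omega x); rewrite dx x2 mulrA divff ?gt_eqF// mul1r => /(_ isT).
  rewrite ler_pdivlMl ?exprn_gt0// => rat.
  have := hd1 x Ox x1; rewrite -/(profile k f m xi_hi _) ler_pdivlMr// => low.
  set p := profile k f m xi_hi _ in p0 Cp rat *.
  exact: ratio_lower_arith p0 e2 the rat low Cp.
apply: limsup_bd_le => c c1.
have c1' : 0 < (c - 1) / 3 by rewrite divr_gt0// subr_gt0.
have h2 : (0 : R) < 2^-1 by rewrite invr_gt0.
have [e e0 [e1 e2 _]] := @exists_small R 2^-1 ((c - 1) / 3) 1 1 h2 c1' ltr01 ltr01.
have [|th th01 the] := @power_near1 R P e; first by rewrite e0 (le_lt_trans e1)// invf_lt1 ?ltr1n.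
have /andP[th0 th1] := th01.
have xi0 : 0 < th * xi_lo by rewrite mulr_gt0.
(* Dually, the upper bound needs xi below the critical value, and B lies between the two sides. *)
have gap : (th * xi_lo) ^+ k.+1 * kap * L < b_lo.
  rewrite exprMn -!mulrA [_ * (kap * L)]mulrA loE.
  by rewrite gtr_pMl// pow_lt.
have [C [d1 d10 hd1]] := upper _ _ xi0 (b_ge _ (midf_lt gap).2) (midf_lt gap).1.
have [d2 d20 hd2] := profile_ratio _ _ lo0 th01.
have [d3 d30 hd3] := absorb xi_lo C e lo0 e0.
exists (Num.min d1 (Num.min d2 d3)); first by rewrite !lt_min d10 d20.
move=> x Ox; rewrite !lt_min => /and3P[x1 x2 x3].
have dx := dist_bd_gt0 HOmega n0 Ox.
have [|p0 Cp] := hd3 (dist_bd Omega x); first by rewrite dx.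
have := hd2 (dist_bd Omega x); rewrite dx x2 => /(_ isT) rat.
have := hd1 x Ox x1; rewrite -/(profile k f m xi_lo _) ler_pdivrMr// => upp.
set p := profile k f m xi_lo _ in p0 Cp rat *.
have ie : th ^- P <= 1 + 2 * e by apply: inv_near1 the; rewrite e0.
exact: ratio_upper_arith p0 e2 ie rat upp Cp.
Qed.
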